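(* Let $\{X_t\}_{t\in\mathbb{Z}}$ be a real-valued, mean zero time series with the following properties. (A) $\{X_t\}$ is second order stationary with autocovariance $c(r)=\mathrm{cov}[X_t,X_{t+r}]$; its spectral density $f(\omega)=\sum_{r\in\mathbb{Z}}c(r)e^{ir\omega}$ is bounded and strictly positive; and for some $K\ge 1$, $\sum_{r\in\mathbb{Z}}|r^{K}c(r)|<\infty$. (B) $\{X_t\}$ is fourth order stationary, $\mathbb{E}|X_t|^4<\infty$, and for each $2\le h\le 4$ the joint cumulants $\kappa_h(s_1,\dots,s_{h-1})=\mathrm{cum}(X_t,X_{t+s_1},\dots,X_{t+s_{h-1}})$ (which do not depend on $t$) satisfy $\sum_{s_1,\dots,s_{h-1}\in\mathbb{Z}}|\kappa_h(s_1,\dots,s_{h-1})|<\infty$. Let $I_n(\omega;f)$ be the complete periodogram and $I_{\infty,n}(\omega;f)$ its AR($\infty$) approximation, both defined in the context. Then $$I_{\infty,n}(\omega;f)=I_n(\omega;f)+\Delta_0(\omega),$$ where, as $n\to\infty$, $$\sup_{\omega}\big|\mathbb{E}[\Delta_0(\omega)]\big|=O(n^{-K}),\qquad \sup_{\omega}\mathrm{var}[\Delta_0(\omega)]=O(n^{-2K}).$$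
   Context: The observed data are $X_1,\dots,X_n$; $i=\sqrt{-1}$. For a complex random variable $Z$, $\mathrm{var}[Z]=\mathbb{E}|Z-\mathbb{E}Z|^2$. Regular DFT: $J_n(\omega)=n^{-1/2}\sum_{t=1}^{n}X_te^{it\omega}$. Best linear predictor: for $\tau\in\mathbb{Z}$, $\widehat X_{\tau,n}=\sum_{t=1}^n\phi_{t,n}(\tau;f)X_t$ is the $L_2$-projection of $X_\tau$ onto the linear span of $X_1,\dots,X_n$. Predictive DFT: $\widehat J_n(\omega;f)=n^{-1/2}\sum_{\tau=-\infty}^{0}\widehat X_{\tau,n}e^{i\tau\omega}+n^{-1/2}\sum_{\tau=n+1}^{\infty}\widehat X_{\tau,n}e^{i\tau\omega}$. Complete DFT: $\widetilde J_n(\omega;f)=J_n(\omega)+\widehat J_n(\omega;f)$. Complete periodogram: $I_n(\omega;f)=\widetilde J_n(\omega;f)\,\overline{J_n(\omega)}$. AR($\infty$) representation: under (A), $X_t=\sum_{j=1}^\infty a_jX_{t-j}+\varepsilon_t$, where $\{\varepsilon_t\}$ are the (uncorrelated) linear innovations and $\sum_j|a_j|<\infty$. Put $a(\omega;f)=1-\sum_{j=1}^\infty a_je^{-ij\omega}$ and $$\widehat J_{\infty,n}(\omega;f)=\frac{n^{-1/2}}{a(\omega;f)}\sum_{\ell=1}^nX_\ell\sum_{s=0}^\infty a_{\ell+s}e^{-is\omega}+e^{in\omega}\frac{n^{-1/2}}{\overline{a(\omega;f)}}\sum_{\ell=1}^nX_{n+1-\ell}\sum_{s=0}^\infty a_{\ell+s}e^{i(s+1)\omega}.$$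 AR($\infty$) approximation of the complete periodogram: $I_{\infty,n}(\omega;f)=[J_n(\omega)+\widehat J_{\infty,n}(\omega;f)]\,\overline{J_n(\omega)}$. *)

(* Defs.v *)
From HB Require Import structures.
From mathcomp Require Import all_boot all_order all_algebra.
From mathcomp Require Import complex.
From mathcomp Require Import all_classical all_reals all_analysis.

Set Implicit Arguments.
Unset Strict Implicit.
Unset Printing Implicit Defensive.

Import Order.TTheory GRing.Theory Num.Theory.
Import numFieldNormedType.Exports.

Local Open Scope classical_set_scope.
Local Open Scope ring_scope.
Local Open Scope complex_scope.

Section ComplexSeries.
Variable R : realType.

(* exp (i theta) *)
Definition cis (theta : R) : R[i] := cos theta +i* sin theta.

(* MathComp-Analysis puts no topology on R[i]: the sum of a complex series is
   taken on the real and imaginary parts. *)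
Definition cseries (u : nat -> R[i]) : R[i] :=
  limn (series (fun k => complex.Re (u k))) +i*
  limn (series (fun k => complex.Im (u k))).

(* Sum over all integers, as the sum over r >= 0 plus the sum over r <= -1. *)
Definition cseriesZ (u : int -> R[i]) : R[i] :=
  cseries (fun k => u k%:Z) + cseries (fun k => u (- k.+1%:Z)).

End ComplexSeries.

Section ComplexRandomVariables.
Context {d : measure_display} {T : measurableType d} {R : realType}.
Variable P : probability T R.

Definition cexpectation (Z : T -> R[i]) : R[i] :=
  fine 'E_P[fun x => (complex.Re (Z x))%R]%E +i*
  fine 'E_P[fun x => (complex.Im (Z x))%R]%E.

(* Extended-real valued, so that an infinite variance is not read as 0. *)
Definition cvariance (Z : T -> R[i]) : \bar R :=
  'E_P[fun x => (Normc.normc (Z x - cexpectation Z) ^+ 2)%R]%E.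

End ComplexRandomVariables.

Section TimeSeries.
Context {d : measure_display} {T : measurableType d} {R : realType}.
Variable P : probability T R.
Variable X : int -> {RV P >-> R}.

Definition mean_zero := forall t, ('E_P[X t] = 0)%E.

Definition second_order_stationary :=
  [/\ forall t, ('E_P[fun x => (X t x ^+ 2)%R] < +oo)%E,
      forall t, ('E_P[X t] = 'E_P[X 0%R])%E
    & forall t r, covariance P (X t) (X (t + r)) = covariance P (X 0) (X r)].

Definition autocov (r : int) : R := fine (covariance P (X 0) (X r)).

Definition spectral_density (w : R) : R[i] :=
  cseriesZ (fun r => (autocov r)%:C * cis (r%:~R * w)).

(* In R[i], [0 < z] says that z is real and positive. *)
Definition assumptionA (K : R) :=
  [/\ second_order_stationary,
      exists M : R, forall w, Normc.normc (spectral_density w) <= M,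
      forall w, 0 < spectral_density w
    & summable [set: int] (fun r => (`|r%:~R| `^ K * autocov r)%:E)].

Definition fourth_order_stationary :=
  forall (h : nat) (s : 'I_h -> int) (t : int), (h <= 4)%N ->
    ('E_P[fun x => (\prod_(i < h) X (t + s i) x)%R] =
     'E_P[fun x => (\prod_(i < h) X (s i) x)%R])%E.

(* Joint cumulant of Y_0, ..., Y_(h-1), by the moment formula: the sum runs
   over the set partitions of {0, ..., h-1}. *)
Definition cumulant (h : nat) (Y : 'I_h -> T -> R) : R :=
  \sum_(Q : {set {set 'I_h}} | finset.partition Q [set: 'I_h]%SET)
    (-1) ^+ #|Q|.-1 * (#|Q|.-1)`!%:R *
    \prod_(B in Q) fine 'E_P[fun x => (\prod_(i in B) Y i x)%R]%E.

(* cum (X_t, X_(t + s_1), ..., X_(t + s_(h-1))) *)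
Definition kappa (h : nat) (t : int) (s : h.-1.-tuple int) : R :=
  cumulant (fun i : 'I_h => X (t + nth 0 (0 :: s) i)).

Definition assumptionB :=
  [/\ fourth_order_stationary,
      forall t, ('E_P[fun x => (`|X t x| ^+ 4)%R] < +oo)%E
    & forall (h : nat) (t : int), (2 <= h <= 4)%N ->
        summable [set: h.-1.-tuple int] (fun s => (kappa t s)%:E)].

Definition DFT (n : nat) (w : R) (x : T) : R[i] :=
  ((Num.sqrt n%:R)^-1)%:C *
  \sum_(1 <= t < n.+1) (X t%:Z x)%:C * cis (t%:R * w).

Definition lincomb (n : nat) (b : nat -> R) (x : T) : R :=
  \sum_(1 <= t < n.+1) b t * X t%:Z x.

(* [lincomb n b] is the point of the span of X_1, ..., X_n nearest to X_tau
   in L^2. Under assumption A the values b_1, ..., b_n are unique; the other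
   values of b are irrelevant. *)
Definition best_linear_predictor (n : nat) (tau : int) (b : nat -> R) :=
  forall b' : nat -> R,
    ('E_P[fun x => ((X tau x - lincomb n b x) ^+ 2)%R] <=
     'E_P[fun x => ((X tau x - lincomb n b' x) ^+ 2)%R])%E.

Definition blp_coef (n : nat) (tau : int) : nat -> R :=
  xget (fun=> 0) [set b | best_linear_predictor n tau b].

Definition predictor (n : nat) (tau : int) (x : T) : R :=
  lincomb n (blp_coef n tau) x.

Definition predictive_DFT (n : nat) (w : R) (x : T) : R[i] :=
  ((Num.sqrt n%:R)^-1)%:C *
    cseries (fun k => (predictor n (- k%:Z) x)%:C * cis (- k%:R * w)) +
  ((Num.sqrt n%:R)^-1)%:C *
    cseries (fun k => (predictor n (n.+1 + k)%:Z x)%:C *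
                      cis ((n.+1 + k)%:R * w)).

Definition complete_DFT (n : nat) (w : R) (x : T) : R[i] :=
  DFT n w x + predictive_DFT n w x.

Definition complete_periodogram (n : nat) (w : R) (x : T) : R[i] :=
  complete_DFT n w x * (DFT n w x)^*.

(* e is X_t minus its L^2-projection onto the closed linear span of the past
   {X_s : s < t}: X_t - e lies in that closed span, and e is uncorrelated with
   the past. *)
Definition linear_innovation (t : int) (e : T -> R) :=
  [/\ ('E_P[fun x => (e x ^+ 2)%R] < +oo)%E,
      forall eps : R, 0 < eps -> exists (m : nat) (b : nat -> R),
        ('E_P[fun x => ((X t x - e x -
           \sum_(1 <= j < m.+1) b j * X (t - j%:Z) x) ^+ 2)%R] < eps%:E)%E
    & forall s : int, (s < t)%R -> covariance P e (X s) = 0%E].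

(* The series over j converges in mean square; a_0 plays no role. *)
Definition ar_representation (a : nat -> R) :=
  cvgn (series (fun j => `|a j.+1|)) /\
  exists eps : int -> {RV P >-> R},
    [/\ forall t, linear_innovation t (eps t),
        forall s t, s != t -> covariance P (eps s) (eps t) = 0%E
      & forall t, 'E_P[fun x => ((X t x -
          (\sum_(1 <= j < m.+1) a j * X (t - j%:Z) x + eps t x)) ^+ 2)%R]%E
          @[m --> \oo] --> 0%E].

(* Under assumption A the representation exists, and a_1, a_2, ... are
   unique. *)
Definition ar_coef : nat -> R :=
  xget (fun=> 0) [set a | ar_representation a].

Definition ar_transfer (w : R) : R[i] :=
  1 - cseries (fun k => (ar_coef k.+1)%:C * cis (- k.+1%:R * w)).

Definition predictive_DFT_inf (n : nat) (w : R) (x : T) : R[i] :=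
  ((Num.sqrt n%:R)^-1)%:C / ar_transfer w *
    (\sum_(1 <= l < n.+1) (X l%:Z x)%:C *
       cseries (fun s => (ar_coef (l + s))%:C * cis (- s%:R * w))) +
  cis (n%:R * w) * (((Num.sqrt n%:R)^-1)%:C / (ar_transfer w)^*) *
    (\sum_(1 <= l < n.+1) (X (n.+1 - l)%N%:Z x)%:C *
       cseries (fun s => (ar_coef (l + s))%:C * cis (s.+1%:R * w))).

Definition complete_periodogram_inf (n : nat) (w : R) (x : T) : R[i] :=
  (DFT n w x + predictive_DFT_inf n w x) * (DFT n w x)^*.

End TimeSeries.

(* Main.v *)
Require Import Defs.
From mathcomp Require Import all_boot all_order all_algebra.
From mathcomp Require Import complex ring lra zify.
From mathcomp Require Import all_classical all_reals all_analysis.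
From mathcomp Require Import measurable_realfun.

Set Implicit Arguments.
Unset Strict Implicit.
Unset Printing Implicit Defensive.

Import Order.TTheory GRing.Theory Num.Theory.
Import numFieldNormedType.Exports.

Local Open Scope classical_set_scope.
Local Open Scope ring_scope.
Local Open Scope complex_scope.

(** Both periodograms are quadratic forms in X_1, ..., X_n, and their difference
is (1/n) (sum_t D_t X_t) conj(sum_s X_s e^(isw)), where D_t is the error in the
weight of X_t when the finite predictors are replaced by the AR(infinity) ones.
The mean of this form is at most a constant times n^(-1/2) ||D||_2, because c is
absolutely summable. Its variance is at most a constant times ||D||_2^2 / n: the
covariance matrix of the products X_t X_s has bounded row sums, as the second
and fourth order cumulants are absolutely summable, and Schur's test applies
([quad_variance]). So it is enough to show that ||D||_2^2 = O(n^(1 - 2K))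
uniformly in w ([Derr_l2]).

By time reversal it suffices to treat the prediction of the past. Let C_n be the
Toeplitz matrix (c(t - l)), 1 <= t, l <= n. The normal equations give C_n y = g
for the total weights y_1, ..., y_n of the finite predictors, where
g_t = sum_(u >= 0) c(t + u) e^(-iuw). The AR(infinity) weights are z_l / alpha,
where z_l = sum_(s >= 0) a_(l+s) e^(-isw) and alpha = 1 - e^(-iw) z_1 is the
transfer function. By the Yule-Walker equations they solve the same system on
the whole half line ([hconvE]). Hence their restriction to 1, ..., n solves the
finite system up to the truncated terms sum_(l > n) c(t - l) z_l / alpha, each of
size O(n^(-K)) if |z_l| = O(l^(-K)). The spectral density is continuous and
positive, hence bounded below, and so is C_n on l^2 ([coercive_spectrum]); the
bound on the weights follows ([finite_section_error]).

Two facts remain. The first is sum_j j^K |a_j| < oo, usually derived from a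
weighted form of Wiener's lemma. Here the coefficients are limits of solutions
of C_n a = (c(1), ..., c(n)), which are bounded uniformly in n by commutators:
as K >= 1, the commutator of C_n with the position operator is bounded, so the
columns of the inverse have a first moment in l^2 and are bounded in l^1
([inv_l1]); the commutator of C_n with the weight l^K is a small multiple of that
weight plus a bounded operator, and the small part is absorbed
([yule_walker_finite]). The second is a lower bound for |alpha|. The same
half-line system reads C z = alpha g, so a small alpha forces a small z_1, which
contradicts 1 = alpha + e^(-iw) z_1 ([alpha_lower]). *)

Local Notation Re := complex.Re.
Local Notation Im := complex.Im.
Local Notation normc := Normc.normc.

(** * Absolutely summable families and Schur's test *)

Section Schur.
Context {R : realType}.

(** Bounding the sums over finite lists avoids any order of summation; after an
injective reindexing ([l1_bounded_inj]) it bounds the rows and columns of the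
matrices used below. *)
Definition l1_bounded {I : eqType} (g : I -> R) (B : R) :=
  forall s : seq I, uniq s -> \sum_(i <- s) `|g i| <= B.

Lemma l1_bounded_le {I : eqType} (g : I -> R) (B B' : R) : B <= B' ->
  l1_bounded g B -> l1_bounded g B'.
Proof. by move=> BB' gB s us; apply: le_trans (gB s us) BB'. Qed.

Lemma summable_l1_bounded {I : choiceType} (g : I -> R) :
  summable [set: I] (fun i => (g i)%:E) -> exists B, l1_bounded g B.
Proof.
rewrite /summable => gy; set E := esum _ _ in gy.
have E0 : (0 <= E)%E by apply: esum_ge0 => i _; exact: abse_ge0.
exists (fine E) => s us; rewrite -lee_fin fineK ?ge0_fin_numE//.
rewrite -sumEFin; apply: esum_ge; exists [set` s] => //.
by rewrite fsbig_seq//=.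
Qed.

Lemma l1_bounded_inj {I J : eqType} (g : I -> R) B (h : J -> I) (s : seq J) :
  l1_bounded g B -> uniq s -> injective h -> \sum_(j <- s) `|g (h j)| <= B.
Proof.
move=> gB us hinj; have := gB (map h s); rewrite big_map; apply.
by rewrite map_inj_uniq.
Qed.

(** AM-GM on |x_i| |y_j|, weighted by |k_ij|. *)
Lemma schur_test {I J : eqType} (s : seq I) (r : seq J) (k : I -> J -> R) B
    (x : I -> R) (y : J -> R) :
  (forall i, i \in s -> \sum_(j <- r) `|k i j| <= B) ->
  (forall j, j \in r -> \sum_(i <- s) `|k i j| <= B) ->
  \sum_(i <- s) \sum_(j <- r) `|x i| * `|k i j| * `|y j| <=
  B / 2 * (\sum_(i <- s) x i ^+ 2 + \sum_(j <- r) y j ^+ 2).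
Proof.
move=> rowB colB.
have amgm i j : `|x i| * `|k i j| * `|y j| <=
    x i ^+ 2 / 2 * `|k i j| + y j ^+ 2 / 2 * `|k i j|.
  rewrite -(real_normK (num_real (x i))) -(real_normK (num_real (y j))).
  have : 0 <= `|k i j| * (`|x i| - `|y j|) ^+ 2.
    by rewrite mulr_ge0 // sqr_ge0.
  set a := `|x i|; set b := `|y j|; set q := `|k i j|; nra.
apply: (@le_trans _ _ (\sum_(i <- s) \sum_(j <- r)
    (x i ^+ 2 / 2 * `|k i j| + y j ^+ 2 / 2 * `|k i j|))).
  by apply: ler_sum => i _; apply: ler_sum => j _; exact: amgm.
under eq_bigr do rewrite big_split /=.
rewrite big_split /= mulrDr lerD //.
  rewrite mulr_sumr big_seq [leRHS]big_seq; apply: ler_sum => i si.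
  rewrite -mulr_sumr; have := rowB i si; have := sqr_ge0 (x i).
  set q := \sum_(_ <- _) _; nra.
rewrite exchange_big mulr_sumr big_seq [leRHS]big_seq; apply: ler_sum => j rj.
rewrite -mulr_sumr; have := colB j rj; have := sqr_ge0 (y j).
set q := \sum_(_ <- _) _; nra.
Qed.

(** Schur's test against the image itself and B y. *)
Lemma schur_l2 {I J : eqType} (s : seq I) (r : seq J) (k : I -> J -> R) B
    (y : J -> R) : 0 < B ->
  (forall i, i \in s -> \sum_(j <- r) `|k i j| <= B) ->
  (forall j, j \in r -> \sum_(i <- s) `|k i j| <= B) ->
  \sum_(i <- s) (\sum_(j <- r) k i j * y j) ^+ 2 <=
  B ^+ 2 * \sum_(j <- r) y j ^+ 2.
Proof.
move=> B0 rowB colB; set b := fun i => \sum_(j <- r) k i j * y j.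
have := schur_test b (fun j => B * y j) rowB colB.
set lhs := (X in X <= _ -> _) => schurb.
have : B * \sum_(i <- s) b i ^+ 2 <= lhs.
  rewrite mulr_sumr; apply: ler_sum => i _.
  apply: (@le_trans _ _ (\sum_(j <- r) b i * k i j * (B * y j))).
    rewrite {1}/b expr2 -/(b i) mulrCA mulr_suml mulr_sumr.
    rewrite [leRHS](eq_bigr (fun j => b i * (B * (k i j * y j)))); last first.
      by move=> j _; ring.
    by rewrite -mulr_sumr -mulr_sumr [in leRHS]/b mulr_sumr -mulr_suml lexx.
  apply: ler_sum => j _; rewrite -!normrM ler_norm//.
move=> /le_trans /(_ schurb).
under [X in _ <= _ * (_ + X)]eq_bigr do rewrite exprMn.
rewrite -mulr_sumr; set u := \sum_(_ <- _) _; set v := \sum_(_ <- _) _.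
rewrite mulrAC -mulrA ler_pM2l // => h; lra.
Qed.

End Schur.

(** * Finite Toeplitz systems *)

Section FiniteToeplitz.
Context {R : realType}.
Implicit Types (c : int -> R) (x y b : nat -> R).

(** Vectors are functions on nat of which only the entries 1, ..., n matter, as the
observations are numbered from 1. *)
Definition toeplitz c n x (t : nat) : R :=
  \sum_(1 <= l < n.+1) c (t%:Z - l%:Z) * x l.

Definition coercive c (m : R) := forall n x,
  m * \sum_(1 <= t < n.+1) x t ^+ 2 <=
  \sum_(1 <= t < n.+1) x t * toeplitz c n x t.

Lemma toeplitzB c n x y t :
  toeplitz c n (fun l => x l - y l) t = toeplitz c n x t - toeplitz c n y t.
Proof. by rewrite /toeplitz -sumrB; apply: eq_bigr => l _; rewrite mulrBr. Qed.

Lemma sub_nat_inj (t : nat) : injective (fun l : nat => t%:Z - l%:Z).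
Proof. by move=> a b /=; lia. Qed.

Lemma subl_nat_inj (l : nat) : injective (fun t : nat => t%:Z - l%:Z).
Proof. by move=> a b /=; lia. Qed.

Lemma l1_row (k : int -> R) B n t : l1_bounded k B ->
  \sum_(1 <= l < n.+1) `|k (t%:Z - l%:Z)| <= B.
Proof.
by move=> kB; apply: (l1_bounded_inj kB (iota_uniq _ _)); exact: sub_nat_inj.
Qed.

Lemma l1_col (k : int -> R) B n l : l1_bounded k B ->
  \sum_(1 <= t < n.+1) `|k (t%:Z - l%:Z)| <= B.
Proof.
move=> kB; apply: (l1_bounded_inj (h := fun t : nat => t%:Z - l%:Z) kB (iota_uniq _ _)).
exact: subl_nat_inj.
Qed.

Lemma ge0_bound {I : eqType} (k : I -> R) B : l1_bounded k B -> 0 <= B.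
Proof. by move=> /(_ [::] isT); rewrite big_nil. Qed.

Lemma sumsq_ge (n l : nat) x : (1 <= l < n.+1)%N ->
  x l ^+ 2 <= \sum_(1 <= t < n.+1) x t ^+ 2.
Proof.
move=> ln; rewrite (bigD1_seq l) ?mem_index_iota ?iota_uniq//= lerDl.
by apply: sumr_ge0 => i _; rewrite sqr_ge0.
Qed.

Section Coercive.
Variables (c : int -> R) (m : R).
Hypotheses (m_gt0 : 0 < m) (cm : coercive c m).

(** Coercivity and AM-GM: m |x|^2 <= <x, Cx> <= m |x|^2 / 2 + |Cx|^2 / (2m). *)
Lemma toeplitz_l2 n x :
  \sum_(1 <= t < n.+1) x t ^+ 2 <=
  m ^- 2 * \sum_(1 <= t < n.+1) toeplitz c n x t ^+ 2.
Proof.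
have := cm n x; set u := \sum_(_ <= _ < _) x _ ^+ 2.
set v := \sum_(_ <= _ < _) toeplitz _ _ _ _ ^+ 2; set w := (X in _ <= X -> _).
have uvw : w * m <= m ^+ 2 * u / 2 + v / 2.
  rewrite /u /v !mulr_sumr !mulr_suml -big_split /=; apply: ler_sum => t _.
  by have := sqr_ge0 (m * x t - toeplitz c n x t); nra.
move=> muw; rewrite mulrC ler_pdivlMr ?exprn_gt0//.
have : 0 <= m * (w - m * u) by apply: mulr_ge0; [exact: ltW|rewrite subr_ge0].
nra.
Qed.

Lemma toeplitz_inj n x y :
  (forall t, (1 <= t < n.+1)%N -> toeplitz c n x t = toeplitz c n y t) ->
  forall t, (1 <= t < n.+1)%N -> x t = y t.
Proof.
move=> xy t tn.
have := toeplitz_l2 n (fun l => x l - y l).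
rewrite [X in _ <= _ * X]big_nat [X in _ <= _ * X]big1 => [|i /xy e]; last first.
  by rewrite toeplitzB e subrr expr0n.
rewrite mulr0 => /(le_trans (sumsq_ge (fun l => x l - y l) tn)) h.
by apply/subr0_eq/eqP; rewrite -sqrf_eq0 eq_le h sqr_ge0.
Qed.

(** A coercive square system is injective, hence solvable. *)
Lemma toeplitz_solve n b :
  exists x, forall t, (1 <= t < n.+1)%N -> toeplitz c n x t = b t.
Proof.
pose A : 'M[R]_n := \matrix_(i, j) c (i%:Z - j%:Z).
have toepE (v : 'cV[R]_n) (x : nat -> R) : (forall i : 'I_n, x i.+1 = v i 0) ->
    forall i : 'I_n, toeplitz c n x i.+1 = (A *m v) i 0.
  move=> xv i; rewrite /toeplitz big_add1 big_mkord mxE; apply: eq_bigr => j _.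
  by rewrite mxE xv; have -> : i.+1%:Z - j.+1%:Z = i%:Z - j%:Z by lia.
pose ext (v : 'cV[R]_n) (t : nat) : R :=
  if insub t.-1 is Some i then v i 0 else 0.
have extE (v : 'cV[R]_n) (i : 'I_n) : ext v i.+1 = v i 0.
  by rewrite /ext /= valK.
have Aunit : A \in unitmx.
  rewrite -unitmx_tr -row_free_unit -kermx_eq0; apply/eqP/row_matrixP => i.
  rewrite row0; set v := row i _.
  have vA : A *m v^T = 0.
    by apply: trmx_inj; rewrite trmx_mul trmxK trmx0 -row_mul mulmx_ker row0.
  have v0 := @toeplitz_inj n (ext v^T) (fun=> 0).
  apply/rowP => j; rewrite [RHS]mxE.
  have /= := v0 _ j.+1; rewrite ltnS ltn_ord => /(_ _ isT).
  rewrite extE mxE; apply=> -[//|t] /=; rewrite ltnS => tn.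
  rewrite (toepE v^T _ (extE _) (Ordinal tn)) vA mxE.
  by rewrite /toeplitz big1// => l _; rewrite mulr0.
exists (ext (invmx A *m \col_i b i.+1)) => -[//|t] /=; rewrite ltnS => tn.
by rewrite (toepE _ _ (extE _) (Ordinal tn)) mulmxA mulmxV// mul1mx mxE.
Qed.

End Coercive.

(** Telescoping, with u(r) = r / (1 + |r|): the increment u(r + 1) - u(r) is
comparable to 1 / (1 + r^2), and |u| <= 1. *)
Lemma sum_inv_dist_le (n i : nat) :
  \sum_(1 <= l < n.+1) (1 + ((l%:Z - i%:Z)%:~R : R) ^+ 2)^-1 <= 8.
Proof.
pose u (r : int) : R := r%:~R / (1 + `|r%:~R|).
have u1 r : `|u r| <= 1.
  have p : (0 : R) < 1 + `|r%:~R| by rewrite ltr_pwDl.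
  by rewrite /u normrM normfV (gtr0_norm p) ler_pdivrMr// mul1r lerDr.
have du r : (1 + (r%:~R : R) ^+ 2)^-1 <= 4 * (u (r + 1) - u r).
  rewrite /u.
  have pos (a : R) : 0 < 1 + a ^+ 2 by rewrite ltr_pwDl// sqr_ge0.
  have key (a : R) : 0 <= a ->
      (a + 1) / (1 + (a + 1)) - a / (1 + a) = ((a + 1) * (a + 2))^-1.
    by move=> a0; field; apply/andP; split; apply: lt0r_neq0; lra.
  have p12 (a : R) : 0 <= a -> 0 < (a + 1) * (a + 2).
    by move=> a0; apply: mulr_gt0; lra.
  case: r => k; have k0 : (0 : R) <= k%:R by rewrite ler0n.
    have -> : (k%:Z + 1)%:~R = k%:R + 1 :> R by rewrite intrD.
    rewrite -pmulrn (ger0_norm k0) ger0_norm ?addr_ge0// key//.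
    rewrite ler_pdivlMr ?p12// mulrC ler_pdivrMr//.
    have := sqr_ge0 (k%:R - 1 : R); nra.
  have -> : (Negz k + 1)%:~R = - k%:R :> R.
    have -> : Negz k + 1 = - (k%:Z) by lia.
    by rewrite mulrNz.
  have -> : (Negz k)%:~R = - (k%:R + 1) :> R by rewrite NegzE mulrNz natr1.
  rewrite !normrN (ger0_norm k0) ger0_norm ?addr_ge0// sqrrN.
  rewrite !mulNr opprK [- _ + _]addrC key// ler_pdivlMr ?p12// mulrC ler_pdivrMr//.
  nra.
apply: (@le_trans _ _ (\sum_(1 <= l < n.+1)
    4 * (u (l.+1%:Z - i%:Z) - u (l%:Z - i%:Z)))).
  apply: ler_sum => l _; have -> : l.+1%:Z - i%:Z = l%:Z - i%:Z + 1 by lia.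
  exact: du.
rewrite -mulr_sumr telescope_sumr//.
have := u1 (n.+1%:Z - i%:Z); have := u1 (1%N%:Z - i%:Z).
rewrite !ler_norml => /andP[? ?] /andP[? ?]; lra.
Qed.

End FiniteToeplitz.

(** * Decay of the inverse of a coercive Toeplitz matrix *)

Section InverseDecay.
Context {R : realType}.
Variables (c : int -> R) (m S0 S1 : R).
Hypotheses (m_gt0 : 0 < m) (cm : coercive c m).
Hypotheses (S0_gt0 : 0 < S0) (cS0 : l1_bounded c S0).
Hypotheses (S1_gt0 : 0 < S1) (cS1 : l1_bounded (fun r => r%:~R * c r) S1).

Lemma toeplitz_row_l2 (k : int -> R) B n (x : nat -> R) :
  0 < B -> l1_bounded k B ->
  \sum_(1 <= t < n.+1) toeplitz k n x t ^+ 2 <=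
  B ^+ 2 * \sum_(1 <= l < n.+1) x l ^+ 2.
Proof.
move=> B0 kB; apply: schur_l2 => // i _; [exact: l1_row|exact: l1_col].
Qed.

(** The 4 is half of the bound of [sum_inv_dist_le]; the other term is half of
a bound for sum_l (1 + (l - i)^2) g_l^2 on a column g of the inverse. *)
Definition inv_l1_cst : R := 4 + m ^- 2 * (1 + m ^- 2 * S1 ^+ 2) / 2.

Lemma inv_l1_cst_ge0 : 0 <= inv_l1_cst.
Proof.
rewrite /inv_l1_cst addr_ge0// divr_ge0// mulr_ge0 ?invr_ge0 ?sqr_ge0//.
by rewrite addr_ge0// mulr_ge0 ?sqr_ge0// invr_ge0 sqr_ge0.
Qed.

(** Multiplication by the distance to i commutes with the Toeplitz matrix up to the
Toeplitz matrix of r c(r), which is bounded on l^2. It kills the right-hand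
side of the system, which is supported at i, so (l - i) g_l is again in l^2; the
l^1 bound follows as 1 / (1 + (l - i)^2) is summable. *)
Lemma inv_column_l1 n i (g : nat -> R) : (1 <= i < n.+1)%N ->
  (forall t, (1 <= t < n.+1)%N -> toeplitz c n g t = (t == i)%:R) ->
  \sum_(1 <= l < n.+1) `|g l| <= inv_l1_cst.
Proof.
move=> iin gE; set G := \sum_(1 <= l < n.+1) g l ^+ 2.
have GE : G <= m ^- 2.
  apply: (le_trans (toeplitz_l2 m_gt0 cm n g)).
  rewrite ler_piMr ?invr_ge0 ?exprn_ge0 ?(ltW m_gt0)//.
  rewrite (bigD1_seq i) ?mem_index_iota ?iota_uniq//= gE// eqxx expr1n.
  rewrite big_seq_cond big1 ?addr0 ?lexx// => t; rewrite mem_index_iota.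
  by move=> /andP[/gE -> /negbTE ->]; rewrite expr0n.
pose d (l : nat) : R := (l%:Z - i%:Z)%:~R.
pose k (r : int) : R := r%:~R * c r.
have comm t : (1 <= t < n.+1)%N ->
    toeplitz c n (fun l => d l * g l) t = - toeplitz k n g t.
  move=> tn; transitivity (d t * toeplitz c n g t - toeplitz k n g t).
    rewrite /toeplitz mulr_sumr -sumrB; apply: eq_bigr => l _.
    rewrite /k /d !intrB; ring.
  rewrite gE//; case: eqP => [->|_]; last by rewrite mulr0 sub0r.
  by rewrite /d subrr mul0r sub0r.
have dG : \sum_(1 <= l < n.+1) (d l * g l) ^+ 2 <= m ^- 2 * (S1 ^+ 2 * m ^- 2).
  apply: (le_trans (toeplitz_l2 m_gt0 cm n _)).
  rewrite ler_pM2l ?invr_gt0 ?exprn_gt0//.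
  rewrite (eq_big_nat _ _ (F2 := fun t => toeplitz k n g t ^+ 2)); last first.
    by move=> t tn; rewrite comm// sqrrN.
  apply: (le_trans (toeplitz_row_l2 n g S1_gt0 cS1)).
  by rewrite ler_pM2l// exprn_gt0.
(* AM-GM: 2 |g| <= 1 / p + p g^2 with p = 1 + (l - i)^2 *)
apply: (@le_trans _ _ (\sum_(1 <= l < n.+1)
    ((1 + d l ^+ 2)^-1 / 2 + (g l ^+ 2 + (d l * g l) ^+ 2) / 2))).
  apply: ler_sum => l _; rewrite exprMn.
  have p0 : 0 < 1 + d l ^+ 2 by rewrite ltr_pwDl// sqr_ge0.
  set p := 1 + d l ^+ 2 in p0 *.
  have -> : g l ^+ 2 + d l ^+ 2 * g l ^+ 2 = p * `|g l| ^+ 2.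
    by rewrite real_normK ?num_real// /p; ring.
  have : 0 <= p^-1 * (1 - p * `|g l|) ^+ 2.
    by rewrite mulr_ge0 ?sqr_ge0// invr_ge0 ltW.
  have -> : p^-1 * (1 - p * `|g l|) ^+ 2 = p^-1 - 2 * `|g l| + p * `|g l| ^+ 2.
    by field; exact: lt0r_neq0.
  lra.
rewrite big_split /= -!mulr_suml big_split /= -/G.
have := sum_inv_dist_le n i (R := R); rewrite -/(d _) => h8.
rewrite /inv_l1_cst; set q := \sum_(_ <= _ < _) (_ + _)^-1 in h8 *.
set q2 := \sum_(_ <= _ < _) _ in dG *; lra.
Qed.

(** By linearity from the columns of the inverse. *)
Lemma inv_l1 n (x b : nat -> R) :
  (forall t, (1 <= t < n.+1)%N -> toeplitz c n x t = b t) ->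
  \sum_(1 <= l < n.+1) `|x l| <= inv_l1_cst * \sum_(1 <= t < n.+1) `|b t|.
Proof.
move=> xb.
have /choice[g gE] (i : nat) := toeplitz_solve m_gt0 cm n (fun t => (t == i)%:R).
have xE l : (1 <= l < n.+1)%N -> x l = \sum_(1 <= i < n.+1) b i * g i l.
  apply: (toeplitz_inj m_gt0 cm (y := fun l => \sum_(1 <= i < n.+1) b i * g i l)).
  move=> t tn; rewrite xb// /toeplitz.
  under eq_bigr do rewrite mulr_sumr.
  rewrite exchange_big /=.
  under eq_bigr do (under eq_bigr do rewrite mulrCA; rewrite -mulr_sumr).
  rewrite (bigD1_seq t) ?mem_index_iota ?iota_uniq//=.
  rewrite [X in b t * X](_ : _ = 1) ?mulr1; last first.
    by have := gE t t tn; rewrite eqxx.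
  rewrite big1 ?addr0// => i it.
  rewrite [X in b i * X](_ : _ = 0) ?mulr0//.
  by have := gE i t tn; rewrite eq_sym (negbTE it).
apply: (@le_trans _ _ (\sum_(1 <= l < n.+1) \sum_(1 <= i < n.+1) `|b i| * `|g i l|)).
  rewrite big_nat [leRHS]big_nat; apply: ler_sum => l ln; rewrite xE//.
  by apply: (le_trans (ler_norm_sum _ _ _)); apply: ler_sum => i _; rewrite normrM.
rewrite exchange_big mulr_sumr /= big_nat [leRHS]big_nat; apply: ler_sum => i iin.
rewrite -mulr_sumr [leRHS]mulrC; apply: ler_wpM2l => //.
by apply: (inv_column_l1 iin) => t; exact: gE.
Qed.

End InverseDecay.

Section PowerWeight.
Context {R : realType}.

Lemma powR_near1 (K eta : R) : 0 < eta -> exists e : R, 0 < e < 1 /\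
  forall s, `|s - 1| <= e -> `|s `^ K - 1| <= eta.
Proof.
move=> eta0.
have cont : {for 1, continuous (fun s : R => s `^ K)}.
  apply/differentiable_continuous/derivable1_diffP/derivable_powR.
  by rewrite in_itv /= ltr01.
have /cvgrPdist_le/(_ _ eta0) := cont.
rewrite powR1 => -[e /= e0 he].
exists (Num.min (e / 2) (1 / 2)); split.
  by rewrite lt_min !divr_gt0//= gt_min [X in _ || X](_ : _ = true) ?orbT//; lra.
move=> s; rewrite le_min => /andP[se _]; rewrite distrC; apply: he => /=.
rewrite distrC; apply: (le_lt_trans se); lra.
Qed.

(** The weight is almost constant on neighbours: if |x - y| <= e x then y^K is close
to x^K, and otherwise both are bounded by a multiple of |x - y|^K. *)
Lemma powR_dist (K eta : R) : 0 < K -> 0 < eta -> exists C : R, 0 <= C /\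
  forall x y : R, 0 <= x -> 0 <= y ->
    `|x `^ K - y `^ K| <= eta * x `^ K + C * `|x - y| `^ K.
Proof.
move=> K0 eta0; have [e [/andP[e0 e1] he]] := powR_near1 K eta0.
exists ((1 + e^-1) `^ K); split; first exact: powR_ge0.
move=> x y x0 y0; have [xe|xe] := leP (`|x - y|) (e * x); last first.
  apply: ler_wpDl; first by rewrite mulr_ge0 ?powR_ge0 ?(ltW eta0).
  rewrite -powRM ?addr_ge0 ?invr_ge0 ?(ltW e0)//.
  set z := (1 + e^-1) * _.
  have xz : x <= `|x - y| / e by rewrite ler_pdivlMr// mulrC ltW.
  have xyz : `|x - y| + `|x - y| / e = z by rewrite /z; field; exact: lt0r_neq0.
  have d0 : 0 <= `|x - y| / e by rewrite divr_ge0// ltW.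
  have xz' : x <= z by rewrite -xyz; apply: ler_wpDl.
  have yz : y <= z.
    rewrite -xyz; have : y - x <= `|x - y| by rewrite distrC ler_norm.
    lra.
  have z0 : 0 <= z by apply: le_trans xz'.
  have h1 : x `^ K <= z `^ K by apply: ge0_ler_powR; rewrite ?nnegrE// ltW.
  have h2 : y `^ K <= z `^ K by apply: ge0_ler_powR; rewrite ?nnegrE// ltW.
  have h3 := powR_ge0 x K; have h4 := powR_ge0 y K.
  by rewrite ler_norml; apply/andP; split; lra.
apply: ler_wpDr; first by rewrite mulr_ge0 ?powR_ge0.
move: x0; rewrite le_eqVlt => /predU1P[x0|x0].
  move: xe; rewrite -x0 mulr0 sub0r normrN normr_le0 => /eqP ->.
  by rewrite powR0 ?gt_eqF// subrr normr0 mulr0.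
have -> : y = x * (y / x) by field; exact: lt0r_neq0.
rewrite powRM ?divr_ge0 ?(ltW x0)// -{1}(mulr1 (x `^ K)) -mulrBr normrM mulrC.
rewrite (ger0_norm (powR_ge0 x K)) ler_wpM2r ?powR_ge0// distrC; apply: he.
have -> : y / x - 1 = (y - x) / x by field; exact: lt0r_neq0.
by rewrite normrM normfV (gtr0_norm x0) ler_pdivrMr// distrC.
Qed.

Lemma l1_bounded_moment1 (c : int -> R) (K B : R) : 1 <= K ->
  l1_bounded (fun r => `|r%:~R| `^ K * c r) B ->
  l1_bounded (fun r => r%:~R * c r) B.
Proof.
move=> K1 cB s us; apply: le_trans (cB s us); apply: ler_sum => r _.
rewrite !normrM ler_wpM2r// (ger0_norm (powR_ge0 _ _)).
have [->|r0] := eqVneq r 0; first by rewrite normr0 powR_ge0.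
apply: le1r_powR => //; rewrite -intr_norm -[1]/(1%:~R) ler_int; lia.
Qed.

(** The weight |r|^K vanishes at r = 0, whence the extra term. *)
Lemma l1_bounded_unweighted (c : int -> R) (K B : R) : 1 <= K ->
  l1_bounded (fun r => `|r%:~R| `^ K * c r) B -> l1_bounded c (`|c 0| + B).
Proof.
move=> K1 cB s us.
have h0 : \sum_(r <- s) `|c r| * (r == 0)%:R <= `|c 0|.
  have [s0|s0] := boolP (0 \in s).
    rewrite (bigD1_seq 0)//= mulr1 big1 ?addr0// => r /negbTE ->.
    by rewrite mulr0.
  rewrite big_seq big1// => r rs; case: eqP => [r0|_]; last by rewrite mulr0.
  by rewrite -r0 rs in s0.
apply: le_trans (lerD h0 (cB s us)); rewrite -big_split /=.
apply: ler_sum => r _; have [->|r0] := eqVneq r 0; first by rewrite mulr1 lerDl.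
rewrite mulr0 add0r normrM ger0_norm ?powR_ge0// ler_peMl//.
have r1 : 1 <= `|r%:~R| :> R by rewrite -intr_norm -[1]/(1%:~R) ler_int; lia.
by apply: le_trans (le1r_powR r1 K1).
Qed.

End PowerWeight.

Section YuleWalkerFinite.
Context {R : realType}.
Variables (c : int -> R) (m S0 SK K : R).
Hypotheses (K1 : 1 <= K) (m_gt0 : 0 < m) (cm : coercive c m).
Hypotheses (S0_gt0 : 0 < S0) (cS0 : l1_bounded c S0).
Hypotheses (SK_gt0 : 0 < SK).
Hypothesis cSK : l1_bounded (fun r => `|r%:~R| `^ K * c r) SK.

(** With w_l = l^K, the vector w a solves the system up to the commutator of w with
the matrix, whose entries are c(t - l) (w_l - w_t). By [powR_dist] the l^1 norm of
the commutator applied to a is at most eta S0 |w a|_1 plus a constant; eta is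
chosen so that the l^1 bound of the inverse lets the left-hand side absorb this
term. The absorbed norm is finite since the system is. *)
Lemma yule_walker_finite : exists A : R, 0 < A /\ forall n (a : nat -> R),
  (forall t, (1 <= t < n.+1)%N -> toeplitz c n a t = c t%:Z) ->
  \sum_(1 <= l < n.+1) l%:R `^ K * `|a l| <= A.
Proof.
have K0 : 0 < K by apply: lt_le_trans K1.
pose C1 := inv_l1_cst m SK.
have C1_gt0 : 0 < C1.
  rewrite /C1 /inv_l1_cst ltr_pwDl// divr_ge0// mulr_ge0 ?invr_ge0//.
    by rewrite exprn_ge0// ltW.
  by rewrite addr_ge0// mulr_ge0 ?sqr_ge0// invr_ge0 sqr_ge0.
have eta0 : 0 < (C1 * S0 * 2)^-1 by rewrite invr_gt0 !mulr_gt0.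
have [C [C0 powC]] := powR_dist K0 eta0.
have L1 := inv_l1 m_gt0 cm SK_gt0 (l1_bounded_moment1 K1 cSK); rewrite -/C1 in L1.
exists (2 * C1 * (SK + C * SK * (C1 * S0))); split.
  rewrite !mulr_gt0// ltr_pwDl// !mulr_ge0//; exact: ltW.
move=> n a aE.
have cn : \sum_(1 <= t < n.+1) `|c t%:Z| <= S0.
  by apply: (l1_bounded_inj cS0 (iota_uniq _ _)) => i j [].
have a1 : \sum_(1 <= l < n.+1) `|a l| <= C1 * S0.
  apply: (le_trans (L1 n a _ aE)); rewrite ler_pM2l//.
pose w (l : nat) : R := l%:R `^ K.
set W := \sum_(_ <= _ < _) _.
have wa : \sum_(1 <= l < n.+1) `|w l * a l| = W.
  by apply: eq_bigr => l _; rewrite normrM (ger0_norm (powR_ge0 _ _)).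
have := L1 n (fun l => w l * a l) _ (fun t _ => erefl); rewrite wa => h.
suff le : \sum_(1 <= t < n.+1) `|toeplitz c n (fun l => w l * a l) t| <=
    SK + ((C1 * S0 * 2)^-1 * S0 * W + C * SK * (C1 * S0)).
  have : W <= C1 * (SK + ((C1 * S0 * 2)^-1 * S0 * W + C * SK * (C1 * S0))).
    by apply: (le_trans h); rewrite ler_pM2l.
  have -> : C1 * (SK + ((C1 * S0 * 2)^-1 * S0 * W + C * SK * (C1 * S0))) =
     C1 * (SK + C * SK * (C1 * S0)) + W / 2.
    by field; apply/andP; split; exact: lt0r_neq0.
  lra.
apply: (@le_trans _ _ (\sum_(1 <= t < n.+1) (`|w t * c t%:Z| +
   \sum_(1 <= l < n.+1) (`|c (t%:Z - l%:Z)| * ((C1 * S0 * 2)^-1 * w l * `|a l|) +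
     `|(`|(t%:Z - l%:Z)%:~R| `^ K * c (t%:Z - l%:Z))| * (C * `|a l|))))).
  rewrite big_nat [leRHS]big_nat; apply: ler_sum => t tn.
  have -> : toeplitz c n (fun l => w l * a l) t =
      w t * c t%:Z + \sum_(1 <= l < n.+1) c (t%:Z - l%:Z) * (w l - w t) * a l.
    rewrite -aE// /toeplitz mulr_sumr -big_split /=; apply: eq_bigr => l _; ring.
  apply: (le_trans (ler_normD _ _)); rewrite lerD2l.
  apply: (le_trans (ler_norm_sum _ _ _)); apply: ler_sum => l _.
  rewrite !normrM (ger0_norm (powR_ge0 _ _)).
  have := powC l%:R t%:R (ler0n _ _) (ler0n _ _); rewrite -/(w _) -/(w _).
  have -> : `|(t%:Z - l%:Z)%:~R : R| = `|l%:R - t%:R|.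
    by rewrite intrB distrC.
  set p := `|c _|; set q := `|a l|; set v := _ `^ K.
  have p0 : 0 <= p := normr_ge0 _.
  have q0 : 0 <= q := normr_ge0 _.
  have -> : p * ((C1 * S0 * 2)^-1 * w l * q) + v * p * (C * q) =
    p * ((C1 * S0 * 2)^-1 * w l + C * v) * q by ring.
  by move=> hw; rewrite ler_wpM2r// ler_wpM2l.
rewrite big_split /= lerD//.
  apply: le_trans (l1_bounded_inj cSK (iota_uniq 1 n) (h := Posz) _).
    by rewrite /index_iota subSS subn0; apply: ler_sum => t _; rewrite /w -pmulrn normr_nat.
  by move=> i j [].
rewrite exchange_big /=.
under eq_bigr do rewrite big_split /= -!mulr_suml.
rewrite big_split /= lerD//.
  rewrite /W mulr_sumr; apply: ler_sum => l _.
  have -> : (C1 * S0 * 2)^-1 * S0 * (l%:R `^ K * `|a l|) =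
     S0 * ((C1 * S0 * 2)^-1 * w l * `|a l|) by rewrite /w; ring.
  rewrite ler_wpM2r ?l1_col// !mulr_ge0 ?powR_ge0//; exact: ltW.
apply: (@le_trans _ _ (C * SK * \sum_(1 <= l < n.+1) `|a l|)); last first.
  by rewrite ler_wpM2l// mulr_ge0// ltW.
rewrite mulr_sumr; apply: ler_sum => l _.
rewrite [C * SK]mulrC -mulrA ler_wpM2r ?mulr_ge0//.
exact: (l1_col n l cSK).
Qed.

End YuleWalkerFinite.

(** * The Yule-Walker equations on the half line *)

Section Limits.
Context {R : realType}.

Lemma cvg_seq_ext {V : topologicalType} (u v : nat -> V) (l : V) :
  u =1 v -> u n @[n --> \oo] --> l -> v n @[n --> \oo] --> l.
Proof. by move=> /funext ->. Qed.

Lemma cvg_sum_seq {I : eqType} (s : seq I) (u : I -> nat -> R) (v : I -> R) :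
  (forall i, i \in s -> u i n @[n --> \oo] --> v i) ->
  \sum_(i <- s) u i n @[n --> \oo] --> \sum_(i <- s) v i.
Proof.
elim: s => [|i s IH] uv.
  under eq_fun do rewrite big_nil; rewrite big_nil; exact: cvg_cst.
under eq_fun do rewrite big_cons; rewrite big_cons; apply: cvgD.
  by apply: uv; rewrite mem_head.
by apply: IH => j js; apply: uv; rewrite in_cons js orbT.
Qed.

Lemma cvg_sum_nat p q (u : nat -> nat -> R) (v : nat -> R) :
  (forall i, (p <= i < q)%N -> u i n @[n --> \oo] --> v i) ->
  \sum_(p <= i < q) u i n @[n --> \oo] --> \sum_(p <= i < q) v i.
Proof. by move=> uv; apply: cvg_sum_seq => i; rewrite mem_index_iota => /uv. Qed.

Lemma bounded_sums_tail (u : nat -> R) (B : R) :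
  (forall n, \sum_(1 <= k < n.+1) `|u k| <= B) ->
  forall e : R, 0 < e -> exists n0, forall n N, (n0 <= n)%N ->
    \sum_(n.+1 <= k < N.+1) `|u k| <= e.
Proof.
move=> uB e e0; pose s n : R := \sum_(1 <= k < n.+1) `|u k|.
have smono : nondecreasing_seq s.
  apply/nondecreasing_seqP => n; rewrite /s [leRHS]big_nat_recr//=.
  by rewrite lerDl.
have scvg : cvgn s.
  by apply: nondecreasing_is_cvgn => //; exists B => _ [n _ <-]; exact: uB.
have /cvgrPdist_le/(_ e e0)[n0 _ n0P] := scvg.
exists n0 => n N n0n; have [nN|Nn] := leqP n N; last first.
  by rewrite big_geq; [exact: ltW|exact: ltnW].
have -> : \sum_(n.+1 <= k < N.+1) `|u k| = s N - s n.
  by rewrite /s [X in _ = X - _](@big_cat_nat _ _ _ n.+1)//= addrAC subrr add0r.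
have := n0P n n0n; rewrite ger0_norm; last first.
  by rewrite subr_ge0; exact: (nondecreasing_cvgn_le smono scvg).
by have := nondecreasing_cvgn_le smono scvg N => h1 h2; apply: le_trans h2; rewrite lerD2r.
Qed.

Lemma powR_nat_ge (K : R) n : 1 <= K -> (0 < n)%N -> n%:R <= n%:R `^ K.
Proof. by move=> K1 n0; apply: le1r_powR => //; rewrite ler1n. Qed.

Lemma powR_decay (A K : R) : 0 <= A -> 1 <= K ->
  forall e : R, 0 < e -> \forall n \near \oo, A / n%:R `^ K <= e.
Proof.
move=> A0 K1 e e0; near=> n.
have n0 : (0 < n)%N by near: n; exact: nbhs_infty_gt.
have nA : A / e <= n%:R by near: n; exact: nbhs_infty_ger.
have nK := powR_nat_ge K1 n0.
rewrite ler_pdivrMr; last by apply: lt_le_trans nK; rewrite ltr0n.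
by rewrite mulrC -ler_pdivrMr// (le_trans nA).
Unshelve. all: by end_near. Qed.

End Limits.

Section YuleWalker.
Context {R : realType}.

(** The infinite sum over j >= 1 of c(t - j) a_j is the limit of the truncated
products, so that truncated systems need no separate notation. *)
Definition yule_walker (c : int -> R) (a : nat -> R) :=
  forall t, (1 <= t)%N -> toeplitz c N a t @[N --> \oo] --> c t%:Z.

Definition toeplitz_tail (c : int -> R) n N (x : nat -> R) t : R :=
  \sum_(n.+1 <= l < N.+1) c (t%:Z - l%:Z) * x l.

Lemma toeplitz_cat (c : int -> R) n N x t : (n <= N)%N ->
  toeplitz c N x t = toeplitz c n x t + toeplitz_tail c n N x t.
Proof. by move=> nN; rewrite /toeplitz (@big_cat_nat _ _ _ n.+1). Qed.

Lemma toeplitz_tail_l1 (c : int -> R) S0 n N x : l1_bounded c S0 ->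
  \sum_(1 <= t < n.+1) `|toeplitz_tail c n N x t| <=
  S0 * \sum_(n.+1 <= l < N.+1) `|x l|.
Proof.
move=> cS0; apply: (@le_trans _ _ (\sum_(1 <= t < n.+1)
    \sum_(n.+1 <= l < N.+1) `|c (t%:Z - l%:Z)| * `|x l|)).
  apply: ler_sum => t _; apply: (le_trans (ler_norm_sum _ _ _)).
  by apply: ler_sum => l _; rewrite normrM.
rewrite exchange_big mulr_sumr; apply: ler_sum => l _.
by rewrite -mulr_suml ler_wpM2r// (l1_col n l cS0).
Qed.

Lemma weighted_tail (a : nat -> R) (A K : R) n N : 0 <= K -> (0 < n)%N ->
  \sum_(1 <= l < N.+1) l%:R `^ K * `|a l| <= A ->
  \sum_(n.+1 <= l < N.+1) `|a l| <= A / n%:R `^ K.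
Proof.
move=> K0 n0 aA; rewrite ler_pdivlMr ?powR_gt0 ?ltr0n//.
have [nN|Nn] := leqP n N; last first.
  rewrite big_geq ?mul0r; last exact: ltnW.
  by apply: le_trans aA; apply: sumr_ge0 => l _; rewrite mulr_ge0 ?powR_ge0.
apply: le_trans aA; rewrite [leRHS](@big_cat_nat _ _ _ n.+1)//= ler_wpDl//.
  by apply: sumr_ge0 => l _; rewrite mulr_ge0 ?powR_ge0.
rewrite mulr_suml [leLHS]big_nat [leRHS]big_nat; apply: ler_sum => l /andP[nl _].
by rewrite mulrC ler_wpM2r// ge0_ler_powR ?nnegrE// ler_nat ltnW.
Qed.

Variables (c : int -> R) (m S0 SK K : R).
Hypotheses (K1 : 1 <= K) (m_gt0 : 0 < m) (cm : coercive c m).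
Hypotheses (S0_gt0 : 0 < S0) (cS0 : l1_bounded c S0).
Hypotheses (SK_gt0 : 0 < SK).
Hypothesis cSK : l1_bounded (fun r => `|r%:~R| `^ K * c r) SK.

Let inv1 := inv_l1 m_gt0 cm SK_gt0 (l1_bounded_moment1 K1 cSK).

(** The difference e solves every finite section up to the contribution of its
tail, which tends to 0 in l^1, and the sections have uniformly bounded inverses. *)
Lemma yule_walker_uniq (a b : nat -> R) B :
  (forall n, \sum_(1 <= l < n.+1) `|a l| <= B) ->
  (forall n, \sum_(1 <= l < n.+1) `|b l| <= B) ->
  yule_walker c a -> yule_walker c b ->
  forall l, (1 <= l)%N -> a l = b l.
Proof.
move=> aB bB aYW bYW l l1; pose e l := a l - b l.
have eB n : \sum_(1 <= l < n.+1) `|e l| <= B + B.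
  apply: le_trans (lerD (aB n) (bB n)); rewrite -big_split /=.
  by apply: ler_sum => i _; rewrite ler_normB.
have eYW t : (1 <= t)%N -> toeplitz c N e t @[N --> \oo] --> 0.
  move=> t1; rewrite -(subrr (c t%:Z)).
  under eq_fun do rewrite /e toeplitzB; apply: cvgB; [exact: aYW|exact: bYW].
apply/subr0_eq/normr0_eq0/eqP; rewrite -/(e l) eq_le normr_ge0 andbT.
apply/ler_addgt0Pr => eps eps0; rewrite add0r.
have d0 : 0 < eps / (inv_l1_cst m SK * S0 + 1).
  by rewrite divr_gt0// ltr_wpDl// mulr_ge0 ?inv_l1_cst_ge0// ltW.
have [n0 n0P] := bounded_sums_tail eB d0; pose n := maxn n0 l.
apply: (@le_trans _ _ (\sum_(1 <= l < n.+1) `|e l|)).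
  rewrite (bigD1_seq l) ?mem_index_iota ?iota_uniq//= ?ltnS ?leq_maxr ?l1//.
  by rewrite lerDl sumr_ge0.
apply: (le_trans (inv1 (fun t _ => erefl))).
have lim : \sum_(1 <= t < n.+1) `|toeplitz c n e t| <=
    S0 * (eps / (inv_l1_cst m SK * S0 + 1)).
  pose f N : R := \sum_(1 <= t < n.+1) `|toeplitz c N e t - toeplitz c n e t|.
  have fl : f N @[N --> \oo] --> \sum_(1 <= t < n.+1) `|toeplitz c n e t|.
    apply: cvg_sum_nat => t /andP[t1 _].
    have -> : `|toeplitz c n e t| = `|0 - toeplitz c n e t|.
      by rewrite sub0r normrN.
    by apply: cvg_norm; apply: cvgB; [exact: eYW|exact: cvg_cst].
  apply: (cvgr_to_le fl); near=> N.
  have nN : (n <= N)%N by near: N; exact: nbhs_infty_ge.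
  apply: (@le_trans _ _ (S0 * \sum_(n.+1 <= l < N.+1) `|e l|)).
    rewrite /f (eq_bigr (fun t => `|toeplitz_tail c n N e t|)).
      exact: toeplitz_tail_l1.
    by move=> t _; rewrite (toeplitz_cat _ _ _ nN) addrC addKr.
  by rewrite ler_pM2l// n0P// leq_maxl.
apply: (le_trans (ler_wpM2l (inv_l1_cst_ge0 m SK) lim)).
rewrite mulrA mulrCA -[leRHS]mulr1 ler_pM2l// ler_pdivrMr.
  by rewrite mul1r lerDl.
by rewrite ltr_wpDl// mulr_ge0 ?inv_l1_cst_ge0// ltW.
Unshelve. all: by end_near. Qed.

(** The solutions of the sections of orders n <= M differ on 1, ..., n by the inverse
applied to the tail of the longer one, which is O(n^(-K)): they converge
entrywise, and the weighted bound and the equations pass to the limit. *)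
Lemma yule_walker_exists : exists A a, [/\ 0 < A,
  forall n, \sum_(1 <= l < n.+1) l%:R `^ K * `|a l| <= A & yule_walker c a].
Proof.
have K0 : 0 <= K by apply: le_trans K1.
have [A [A0 Afin]] := yule_walker_finite K1 m_gt0 cm S0_gt0 cS0 SK_gt0 cSK.
have /choice[a aE] n := toeplitz_solve m_gt0 cm n (fun t => c t%:Z).
have aA n : \sum_(1 <= l < n.+1) l%:R `^ K * `|a n l| <= A by apply: Afin; exact: aE.
pose C := inv_l1_cst m SK * (S0 * A).
have C0 : 0 <= C by rewrite !mulr_ge0 ?inv_l1_cst_ge0// ltW.
have tailE n M t : (n <= M)%N -> (1 <= t < n.+1)%N ->
    toeplitz c n (a M) t = c t%:Z - toeplitz_tail c n M (a M) t.
  move=> nM /andP[t1 tn]; rewrite -(aE M).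
    by rewrite (toeplitz_cat _ _ _ nM) addrK.
  by rewrite t1 (leq_trans tn).
have cauchy n M l : (n <= M)%N -> (1 <= l < n.+1)%N ->
    `|a n l - a M l| <= C / n%:R `^ K.
  move=> nM ln; have n0 : (0 < n)%N by lia.
  apply: (@le_trans _ _ (\sum_(1 <= l < n.+1) `|a n l - a M l|)).
    rewrite (bigD1_seq l) ?mem_index_iota ?iota_uniq//= lerDl.
    exact: sumr_ge0.
  apply: (le_trans (inv1 (b := toeplitz_tail c n M (a M)) _)).
    by move=> t tn; rewrite toeplitzB (tailE n M)// aE// opprB addrC subrK.
  rewrite -[leRHS]mulrA ler_wpM2l ?inv_l1_cst_ge0//.
  apply: (le_trans (toeplitz_tail_l1 _ _ _ cS0)).
  by rewrite -mulrA ler_pM2l//; exact: weighted_tail.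
have acvg l : (1 <= l)%N -> cvgn (fun n => a n l).
  move=> l1; apply/cauchy_cvgP/cauchy_exP => e e0.
  have e20 : 0 < e / 2 by rewrite divr_gt0.
  have [n0 _ n0P] := powR_decay C0 K1 e20.
  pose n := maxn n0 l; exists (a n l); exists n => // M /= nM.
  rewrite /ball /=; apply: le_lt_trans (cauchy n M l nM _) _.
    by rewrite l1 ltnS leq_maxr.
  by apply: le_lt_trans (n0P n (leq_maxl _ _)) _; lra.
pose al l := limn (fun n => a n l).
have alP l : (1 <= l)%N -> a n l @[n --> \oo] --> al l by move=> /acvg.
have al_sum (g : nat -> R -> R) n : (forall l, continuous (g l)) ->
    \sum_(1 <= l < n.+1) g l (a M l) @[M --> \oo] -->
    \sum_(1 <= l < n.+1) g l (al l).
  move=> gc; apply: cvg_sum_nat => l /andP[l1 _].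
  by apply: continuous_cvg; [exact: gc|exact: alP].
have alA n : \sum_(1 <= l < n.+1) l%:R `^ K * `|al l| <= A.
  apply: (cvgr_to_le (al_sum (fun l x => l%:R `^ K * `|x|) n _)).
    by move=> l x; apply: cvgMr; exact: cvg_norm.
  near=> M; apply: le_trans (aA M).
  have nM : (n <= M)%N by near: M; exact: nbhs_infty_ge.
  rewrite [leRHS](@big_cat_nat _ _ _ n.+1)//= lerDl.
  by apply: sumr_ge0 => l _; rewrite mulr_ge0 ?powR_ge0.
exists A, al; split => // t t1.
have SA0 : 0 <= S0 * A := mulr_ge0 (ltW S0_gt0) (ltW A0).
apply/cvgrPdist_le => e e0; have hN := powR_decay SA0 K1 e0; near=> N.
have tN : (1 <= t < N.+1)%N.
  by rewrite t1 ltnS; near: N; exact: nbhs_infty_ge.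
have N0 : (0 < N)%N by lia.
apply: (@le_trans _ _ (S0 * A / N%:R `^ K)); last first.
  by near: N; exact: hN.
have lim : `|c t%:Z - toeplitz c N (a M) t| @[M --> \oo] -->
    `|c t%:Z - toeplitz c N al t|.
  apply: cvg_norm; apply: cvgB; first exact: cvg_cst.
  by apply: (al_sum (fun l x => c (t%:Z - l%:Z) * x)) => l x; exact: cvgMr.
apply: (cvgr_to_le lim); near=> M.
have NM : (N <= M)%N by near: M; exact: nbhs_infty_ge.
rewrite tailE// subKr.
apply: (@le_trans _ _ (\sum_(1 <= t < N.+1) `|toeplitz_tail c N M (a M) t|)).
  by rewrite (bigD1_seq t) ?mem_index_iota ?iota_uniq//= lerDl sumr_ge0.
apply: (le_trans (toeplitz_tail_l1 _ _ _ cS0)).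
by rewrite -mulrA ler_pM2l//; exact: weighted_tail.
Unshelve. all: by end_near. Qed.

End YuleWalker.

(** * Series of complex numbers *)

Section ComplexModulus.
Context {R : realType}.
Implicit Types (z : R[i]) (x : R).

Lemma sqr_normc z : normc z ^+ 2 = Re z ^+ 2 + Im z ^+ 2.
Proof. by case: z => a b /=; rewrite sqr_sqrtr// addr_ge0 ?sqr_ge0. Qed.

Lemma normc_ge0 z : 0 <= normc z.
Proof. by case: z => a b; exact: sqrtr_ge0. Qed.

Lemma normc_Re z : `|Re z| <= normc z.
Proof.
rewrite -(@ler_pXn2r _ 2)// ?nnegrE ?normc_ge0// sqr_normc.
by rewrite real_normK ?num_real// lerDl sqr_ge0.
Qed.

Lemma normc_Im z : `|Im z| <= normc z.
Proof.
rewrite -(@ler_pXn2r _ 2)// ?nnegrE ?normc_ge0// sqr_normc.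
by rewrite real_normK ?num_real// lerDr sqr_ge0.
Qed.

Lemma normc_real x : normc x%:C = `|x|.
Proof. by rewrite /= expr0n /= addr0 sqrtr_sqr. Qed.

Lemma conjE z : Num.conj z = Re z -i* Im z.
Proof. by case: z. Qed.

Lemma normc_conj z : normc (Num.conj z) = normc z.
Proof. by rewrite conjE; case: z => a b /=; rewrite sqrrN. Qed.

Lemma normcN z : normc (- z) = normc z.
Proof. by case: z => a b /=; rewrite !sqrrN. Qed.

Lemma normcD z1 z2 : normc (z1 + z2) <= normc z1 + normc z2.
Proof. exact: le_normcD. Qed.

Lemma sqr_normcD z1 z2 :
  normc (z1 + z2) ^+ 2 <= 2 * normc z1 ^+ 2 + 2 * normc z2 ^+ 2.
Proof.
rewrite !sqr_normc; case: z1 => a b; case: z2 => a' b' /=.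
have := sqr_ge0 (a - a'); have := sqr_ge0 (b - b'); nra.
Qed.

Lemma normc_sum {I : Type} (s : seq I) (u : I -> R[i]) :
  normc (\sum_(i <- s) u i) <= \sum_(i <- s) normc (u i).
Proof.
elim: s => [|i s IH]; first by rewrite !big_nil Normc.normc0.
by rewrite !big_cons (le_trans (normcD _ _))// lerD2l.
Qed.

Lemma normc_cis x : normc (cis x) = 1.
Proof. by rewrite /= cos2Dsin2 sqrtr1. Qed.

Lemma cisD x1 x2 : cis (x1 + x2) = cis x1 * cis x2 :> R[i].
Proof.
by apply/eqP; rewrite eq_complex /= cosD sinD [X in _ && (X == _)]addrC !eqxx.
Qed.

Lemma cis0 : cis 0 = 1 :> R[i].
Proof. by rewrite /cis cos0 sin0. Qed.

Lemma conj_realcis x y : Num.conj (x%:C * cis y) = x%:C * cis (- y).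
Proof.
rewrite conjE; apply/eqP; rewrite eq_complex /= cosN sinN !mul0r !subr0 !addr0.
by rewrite mulrN !eqxx.
Qed.

Lemma ReD z1 z2 : Re (z1 + z2) = Re z1 + Re z2.
Proof. by case: z1; case: z2. Qed.

Lemma Re_sum {I : Type} (s : seq I) (u : I -> R[i]) :
  Re (\sum_(i <- s) u i) = \sum_(i <- s) Re (u i).
Proof.
by elim: s => [|i s IH]; rewrite ?big_nil// !big_cons -IH; case: (u i); case: (\sum_(_ <- _) _).
Qed.

Lemma Im_sum {I : Type} (s : seq I) (u : I -> R[i]) :
  Im (\sum_(i <- s) u i) = \sum_(i <- s) Im (u i).
Proof.
by elim: s => [|i s IH]; rewrite ?big_nil// !big_cons -IH; case: (u i); case: (\sum_(_ <- _) _).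
Qed.

Lemma normc_realcis x1 x2 : normc (x1%:C * cis x2) = `|x1|.
Proof. by rewrite Normc.normcM normc_real normc_cis mulr1. Qed.

Lemma Re_realM x z : Re (x%:C * z) = x * Re z.
Proof. by case: z => a b /=; rewrite mul0r subr0. Qed.

Lemma Im_realM x z : Im (x%:C * z) = x * Im z.
Proof. by case: z => a b /=; rewrite mul0r addr0. Qed.

Lemma conjcM z1 z2 :
  Num.conj (z1 * z2) = Num.conj z1 * Num.conj z2.
Proof. exact: rmorphM. Qed.

Lemma conjcB z1 z2 :
  Num.conj (z1 - z2) = Num.conj z1 - Num.conj z2.
Proof. exact: rmorphB. Qed.

Lemma conjc_real x : Num.conj x%:C = x%:C.
Proof. by rewrite conjE oppr0. Qed.

Lemma conjc_sum (s : seq nat) (u : nat -> R[i]) :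
  Num.conj (\sum_(i <- s) u i) = \sum_(i <- s) Num.conj (u i).
Proof. exact: rmorph_sum. Qed.

Lemma conjcV z : Num.conj z^-1 = (Num.conj z)^-1.
Proof. exact: fmorphV. Qed.

End ComplexModulus.

Section ComplexSums.
Context {R : realType}.
Implicit Types (u v : nat -> R[i]) (z w : R[i]).

Definition ccvg u z :=
  Re (u n) @[n --> \oo] --> Re z /\ Im (u n) @[n --> \oo] --> Im z.

Lemma ccvg_cst z : ccvg (fun=> z) z.
Proof. by split; exact: cvg_cst. Qed.

Lemma ccvgD u v z w : ccvg u z -> ccvg v w -> ccvg (fun n => u n + v n) (z + w).
Proof.
move=> [ur ui] [vr vi]; split.
  have -> : Re (z + w) = Re z + Re w by case: z {ur ui}; case: w {vr vi}.
  rewrite (_ : (fun n => _) = (fun n => Re (u n) + Re (v n))); first exact: cvgD.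
  by apply/funext => n; case: (u n); case: (v n).
have -> : Im (z + w) = Im z + Im w by case: z {ur ui}; case: w {vr vi}.
rewrite (_ : (fun n => _) = (fun n => Im (u n) + Im (v n))); first exact: cvgD.
by apply/funext => n; case: (u n); case: (v n).
Qed.

Lemma ccvgZ u z w : ccvg u z -> ccvg (fun n => w * u n) (w * z).
Proof.
move=> [ur ui]; split.
  have -> : Re (w * z) = Re w * Re z - Im w * Im z by case: z {ur ui}; case: w.
  rewrite (_ : (fun n => _) = (fun n => Re w * Re (u n) - Im w * Im (u n))).
    by apply: cvgB; apply: cvgMr.
  by apply/funext => n; case: (u n); case: w.
have -> : Im (w * z) = Re w * Im z + Im w * Re z by case: z {ur ui}; case: w.
rewrite (_ : (fun n => _) = (fun n => Re w * Im (u n) + Im w * Re (u n))).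
  by apply: cvgD; apply: cvgMr.
by apply/funext => n; case: (u n); case: w.
Qed.

Lemma ccvg_uniq u z w : ccvg u z -> ccvg u w -> z = w.
Proof.
move=> [ur ui] [ur' ui']; apply/eqP; rewrite eq_complex.
by rewrite (cvg_unique _ ur ur') ?(cvg_unique _ ui ui') ?eqxx.
Qed.

Lemma ccvg_real (u : nat -> R) (x : R) :
  u n @[n --> \oo] --> x -> ccvg (fun n => (u n)%:C) x%:C.
Proof. by move=> ux; split => //; exact: cvg_cst. Qed.

Lemma normc_ccvg_le u z (B : R) : ccvg u z ->
  (\forall n \near \oo, normc (u n) <= B) -> normc z <= B.
Proof.
move=> [ur ui] uB.
have B0 : 0 <= B.
  by near \oo => n; apply: le_trans (normc_ge0 (u n)) _; near: n.
rewrite -(@ler_pXn2r _ 2)// ?nnegrE ?normc_ge0// sqr_normc.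
have lim : Re (u n) ^+ 2 + Im (u n) ^+ 2 @[n --> \oo] --> Re z ^+ 2 + Im z ^+ 2.
  by rewrite !expr2; apply: cvgD; apply: cvgM.
apply: (cvgr_to_le lim); near=> n.
rewrite -sqr_normc ler_pXn2r ?nnegrE ?normc_ge0//.
by near: n.
Unshelve. all: by end_near. Qed.

Definition csummable u (B : R) := forall n, \sum_(0 <= k < n) normc (u k) <= B.

(** [cseries] is total; this relation also records that the series converges. *)
Definition is_csum u z := ccvg (fun n => \sum_(0 <= k < n) u k) z.

Lemma Re_partial u :
  (fun n => Re (\sum_(0 <= k < n) u k)) = series (fun k => Re (u k)).
Proof. by apply/funext => n; rewrite Re_sum seriesEnat. Qed.

Lemma Im_partial u :
  (fun n => Im (\sum_(0 <= k < n) u k)) = series (fun k => Im (u k)).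
Proof. by apply/funext => n; rewrite Im_sum seriesEnat. Qed.

Lemma is_csumP u z : is_csum u z -> cseries u = z.
Proof.
rewrite /is_csum /ccvg Re_partial Im_partial => -[ur ui].
by apply/eqP; rewrite eq_complex /=; apply/andP; split; apply/eqP/cvg_lim.
Qed.

Lemma bounded_series_cvg (u : nat -> R) (B : R) :
  (forall n, \sum_(0 <= k < n) `|u k| <= B) -> cvgn (series u).
Proof.
move=> uB; apply: normed_cvg.
apply: nondecreasing_is_cvgn.
  by apply: nondecreasing_series => n _ _; exact: normr_ge0.
by exists B => _ [n _ <-]; exact: uB.
Qed.

Lemma csummable_is_csum u B : csummable u B -> is_csum u (cseries u).
Proof.
rewrite /is_csum /ccvg Re_partial Im_partial => uB; split.
  apply: (@bounded_series_cvg _ B) => n; apply: le_trans (uB n).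
  by apply: ler_sum => k _; exact: normc_Re.
apply: (@bounded_series_cvg _ B) => n; apply: le_trans (uB n).
by apply: ler_sum => k _; exact: normc_Im.
Qed.

Lemma normc_cseries_le u B : csummable u B -> normc (cseries u) <= B.
Proof.
move=> uB; apply: (normc_ccvg_le (csummable_is_csum uB)); near=> n.
exact: le_trans (normc_sum _ _) (uB n).
Unshelve. all: by end_near. Qed.

Lemma is_csum_ext u v z : u =1 v -> is_csum u z -> is_csum v z.
Proof. by move=> /funext ->. Qed.

Lemma is_csumD u v z w : is_csum u z -> is_csum v w ->
  is_csum (fun k => u k + v k) (z + w).
Proof.
rewrite /is_csum => uz vw; under [X in ccvg X]eq_fun do rewrite big_split /=.
exact: ccvgD.
Qed.

Lemma is_csumZ u z w : is_csum u z -> is_csum (fun k => w * u k) (w * z).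
Proof.
rewrite /is_csum => uz; under [X in ccvg X]eq_fun do rewrite -mulr_sumr.
exact: ccvgZ.
Qed.

Lemma is_csum_sum (s : seq nat) (u : nat -> nat -> R[i]) (z : nat -> R[i]) :
  (forall i, i \in s -> is_csum (u i) (z i)) ->
  is_csum (fun k => \sum_(i <- s) u i k) (\sum_(i <- s) z i).
Proof.
elim: s => [|i s IH] uz.
  rewrite big_nil; apply: (@is_csum_ext (fun=> 0)).
    by move=> k; rewrite big_nil.
  by rewrite /is_csum; under [X in ccvg X]eq_fun do rewrite big1//; exact: ccvg_cst.
rewrite big_cons; apply: (@is_csum_ext (fun k => u i k + \sum_(i <- s) u i k)).
  by move=> k; rewrite big_cons.
apply: is_csumD; first by apply: uz; rewrite mem_head.
by apply: IH => j js; apply: uz; rewrite in_cons js orbT.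
Qed.

Lemma ccvg_shift u z : ccvg (fun n => u n.+1) z <-> ccvg u z.
Proof.
by rewrite /ccvg (cvg_shiftS (fun n => Re (u n))) (cvg_shiftS (fun n => Im (u n))).
Qed.

Lemma is_csum_recl u z : is_csum (fun k => u k.+1) z <-> is_csum u (u 0 + z).
Proof.
rewrite /is_csum -(ccvg_shift (fun n => \sum_(0 <= k < n) u k)).
under [X in _ <-> ccvg X _]eq_fun do rewrite big_nat_recl//.
split => h; first exact: (ccvgD (ccvg_cst (u 0)) h).
have := ccvgD (ccvg_cst (- u 0)) h; rewrite addKr.
by under [X in ccvg X]eq_fun do rewrite addKr.
Qed.

Lemma is_csum_conj u z :
  is_csum u z -> is_csum (fun k => Num.conj (u k)) (Num.conj z).
Proof.
move=> [ur ui]; split; rewrite conjE /=.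
  rewrite (_ : (fun n => _) = (fun n => Re (\sum_(0 <= k < n) u k)))//.
  by apply/funext => n; rewrite !Re_sum; apply: eq_bigr => k _; rewrite conjE.
rewrite (_ : (fun n => _) = (fun n => - Im (\sum_(0 <= k < n) u k))); first exact: cvgN.
by apply/funext => n; rewrite !Im_sum -sumrN; apply: eq_bigr => k _; rewrite conjE.
Qed.

End ComplexSums.

(** * The transfer function and the finite section error *)

Section ComplexToeplitz.
Context {R : realType}.
Variables (c : int -> R) (m : R).
Hypotheses (m_gt0 : 0 < m) (cm : coercive c m).

(** The matrix is real, so the real bound applies to both parts. *)
Lemma ctoeplitz_l2 n (x : nat -> R[i]) :
  \sum_(1 <= t < n.+1) normc (x t) ^+ 2 <=
  m ^- 2 * \sum_(1 <= t < n.+1)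
    normc (\sum_(1 <= l < n.+1) (c (t%:Z - l%:Z))%:C * x l) ^+ 2.
Proof.
under eq_bigr do rewrite sqr_normc.
under [X in _ <= _ * X]eq_bigr do rewrite sqr_normc Re_sum Im_sum.
rewrite !big_split /= mulrDr lerD//.
  apply: le_trans (toeplitz_l2 m_gt0 cm n (fun t => Re (x t))) _.
  rewrite ler_pM2l ?invr_gt0 ?exprn_gt0//; apply: ler_sum => t _.
  by rewrite /toeplitz; under [X in _ <= X ^+ 2]eq_bigr do rewrite Re_realM.
apply: le_trans (toeplitz_l2 m_gt0 cm n (fun t => Im (x t))) _.
rewrite ler_pM2l ?invr_gt0 ?exprn_gt0//; apply: ler_sum => t _.
by rewrite /toeplitz; under [X in _ <= X ^+ 2]eq_bigr do rewrite Im_realM.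
Qed.

End ComplexToeplitz.

Section HalfLine.
Context {R : realType}.

Definition halfline (b : nat -> R) (w : R) : R[i] :=
  cseries (fun s => (b s)%:C * cis (- s%:R * w)).

Lemma halfline_summable (b : nat -> R) (B w : R) :
  (forall n, \sum_(0 <= s < n) `|b s| <= B) ->
  csummable (fun s => (b s)%:C * cis (- s%:R * w)) B.
Proof. by move=> bB n; under eq_bigr do rewrite normc_realcis. Qed.

Lemma halfline_recl (b : nat -> R) (B w : R) :
  (forall n, \sum_(0 <= s < n) `|b s| <= B) ->
  halfline b w = (b 0)%:C + cis (- w) * halfline (fun s => b s.+1) w.
Proof.
move=> bB; apply: is_csumP.
have -> : (b 0)%:C = (b 0)%:C * cis (- 0%:R * w).
  by rewrite oppr0 mul0r cis0 mulr1.
apply/is_csum_recl.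
apply: (@is_csum_ext _ (fun s => cis (- w) * ((b s.+1)%:C * cis (- s%:R * w)))).
  move=> s; rewrite mulrCA -cisD; congr (_ * cis _).
  by rewrite -natr1; ring.
apply: is_csumZ; apply: (@csummable_is_csum _ _ B); apply: halfline_summable.
move=> n; apply: le_trans (bB n.+1).
by rewrite [leRHS]big_nat_recl// lerDr.
Qed.

Lemma weighted_sums (K : R) (b : nat -> R) (B : R) l n : 0 <= K -> (0 < l)%N ->
  (forall n, \sum_(1 <= j < n.+1) j%:R `^ K * `|b j| <= B) ->
  \sum_(0 <= s < n) `|b (l + s)%N| <= B / l%:R `^ K.
Proof.
move=> K0 l0 bB; rewrite ler_pdivlMr ?powR_gt0 ?ltr0n//.
case: n => [|n]; first by rewrite big_geq// mul0r; apply: le_trans (bB 0%N); rewrite big_geq.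
apply: le_trans (bB (l + n)%N).
rewrite [leRHS](@big_cat_nat _ _ _ l)//; last by rewrite ltnW// ltnS leq_addr.
rewrite ler_wpDl//=.
  by apply: sumr_ge0 => j _; rewrite mulr_ge0 ?powR_ge0.
rewrite -[X in _ <= \sum_(X <= _ < _) _]add0n [leRHS]big_addn.
have -> : ((l + n).+1 - l = n.+1)%N by lia.
rewrite mulr_suml; apply: ler_sum => s _.
rewrite mulrC addnC ler_wpM2r// ge0_ler_powR ?nnegrE//.
by rewrite ler_nat leq_addl.
Qed.

End HalfLine.

Section Transfer.
Context {R : realType}.
Variables (c : int -> R) (m S0 SK K A : R) (a : nat -> R).
Hypotheses (K1 : 1 <= K) (m_gt0 : 0 < m) (cm : coercive c m).
Hypotheses (S0_gt0 : 0 < S0) (cS0 : l1_bounded c S0).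
Hypotheses (SK_gt0 : 0 < SK).
Hypothesis cSK : l1_bounded (fun r => `|r%:~R| `^ K * c r) SK.
Hypotheses (A_gt0 : 0 < A).
Hypothesis aA : forall n, \sum_(1 <= l < n.+1) l%:R `^ K * `|a l| <= A.
Hypothesis aYW : yule_walker c a.

Let K0 : 0 <= K. Proof. exact: le_trans K1. Qed.

(** Divided by [alpha], the total weight of X_l in the AR(infinity) predictors of
X_0, X_(-1), ..., with the phases of the transform. *)
Definition ztail (w : R) l := halfline (fun s => a (l + s)%N) w.
(** The right-hand side of the normal equations, summed over the predicted times. *)
Definition gtail (w : R) t := halfline (fun u => c (t + u)%N%:Z) w.
(** The AR transfer function 1 - sum_(j >= 1) a_j e^(-ijw). *)
Definition alpha (w : R) : R[i] := 1 - cis (- w) * ztail w 1.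

Lemma c_weighted n : \sum_(1 <= j < n.+1) j%:R `^ K * `|c j%:Z| <= SK.
Proof.
apply: le_trans (l1_bounded_inj cSK (iota_uniq 1 n) (h := Posz) _); last first.
  by move=> i j [].
rewrite /index_iota subSS subn0; apply: ler_sum => t _.
by rewrite normrM -pmulrn normr_nat ger0_norm ?powR_ge0.
Qed.

Lemma normc_ztail w l : (0 < l)%N -> normc (ztail w l) <= A / l%:R `^ K.
Proof.
move=> l0; apply: normc_cseries_le; apply: halfline_summable => n.
exact: (weighted_sums _ K0 _ aA).
Qed.

Lemma normc_gtail w t : (0 < t)%N -> normc (gtail w t) <= SK / t%:R `^ K.
Proof.
move=> t0; apply: normc_cseries_le; apply: halfline_summable => n.
by apply: (weighted_sums (b := fun j => c j%:Z) _ K0 t0) => k; exact: c_weighted.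
Qed.

Lemma ztail_rec w l : (0 < l)%N ->
  ztail w l = (a l)%:C + cis (- w) * ztail w l.+1.
Proof.
move=> l0; rewrite /ztail (@halfline_recl _ _ (A / l%:R `^ K)); last first.
  by move=> n; exact: (weighted_sums _ K0 _ aA).
by rewrite addn0; under [X in halfline X]eq_fun do rewrite addnS -addSn.
Qed.

Lemma gtail_rec w t : (0 < t)%N ->
  gtail w t = (c t%:Z)%:C + cis (- w) * gtail w t.+1.
Proof.
move=> t0; rewrite /gtail (@halfline_recl _ _ (SK / t%:R `^ K)); last first.
  move=> n; apply: (weighted_sums (b := fun j => c j%:Z) _ K0 t0) => k.
  exact: c_weighted.
by rewrite addn0; under [X in halfline X]eq_fun do rewrite addnS -addSn.
Qed.

Lemma normc_ztail_le w l : (0 < l)%N -> normc (ztail w l) <= A.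
Proof.
move=> l0; apply: (le_trans (normc_ztail w l0)).
rewrite ler_pdivrMr ?powR_gt0 ?ltr0n// ler_peMr ?(ltW A_gt0)//.
by apply: le_trans (powR_nat_ge K1 l0); rewrite ler1n.
Qed.

Lemma l_ztail_le w l : (0 < l)%N -> l%:R * normc (ztail w l) <= A.
Proof.
move=> l0; have lK := powR_nat_ge K1 l0.
apply: (le_trans (ler_wpM2l _ (normc_ztail w l0))); first by rewrite ler0n.
have lK0 : 0 < l%:R `^ K by rewrite powR_gt0// ltr0n.
by rewrite mulrCA ler_piMr ?(ltW A_gt0)// ler_pdivrMr ?mul1r.
Qed.

(** The half-line Toeplitz operator applied to [ztail]. *)
Definition hconv (w : R) t : R[i] :=
  cseries (fun k => (c (t%:Z - k.+1%:Z))%:C * ztail w k.+1).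

Lemma hconv_summable w t :
  csummable (fun k => (c (t%:Z - k.+1%:Z))%:C * ztail w k.+1) (S0 * A).
Proof.
move=> n; under eq_bigr do rewrite Normc.normcM normc_real.
apply: (@le_trans _ _ (\sum_(0 <= k < n) `|c (t%:Z - k.+1%:Z)| * A)).
  by apply: ler_sum => k _; rewrite ler_wpM2l// normc_ztail_le.
rewrite -mulr_suml ler_wpM2r ?(ltW A_gt0)//.
apply: (l1_bounded_inj cS0 (iota_uniq _ _) (h := fun k : nat => t%:Z - k.+1%:Z)).
by move=> i j /=; lia.
Qed.

Lemma hconv_is_csum w t :
  is_csum (fun k => (c (t%:Z - k.+1%:Z))%:C * ztail w k.+1) (hconv w t).
Proof. exact: csummable_is_csum (hconv_summable w t). Qed.

(** Split t <= |t - l| + l: the first part falls on c, the second on z. *)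
Lemma normc_hconv w t : (0 < t)%N -> t%:R * normc (hconv w t) <= A * (SK + S0).
Proof.
move=> t0; rewrite mulrC -ler_pdivlMr ?ltr0n//.
apply: normc_cseries_le => n; rewrite ler_pdivlMr ?ltr0n// mulrC mulr_sumr.
pose k (r : int) : R := r%:~R * c r.
apply: (@le_trans _ _ (\sum_(0 <= j < n)
    (`|k (t%:Z - j.+1%:Z)| * A + `|c (t%:Z - j.+1%:Z)| * A))).
  apply: ler_sum => j _; rewrite Normc.normcM normc_real.
  have h1 := normc_ztail_le w (ltn0Sn j); have h2 := l_ztail_le w (ltn0Sn j).
  have z0 := normc_ge0 (ztail w j.+1).
  rewrite /k normrM.
  have : t%:R <= `|(t%:Z - j.+1%:Z)%:~R : R| + j.+1%:R.
    by rewrite intrB -lerBlDr; exact: ler_norm.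
  move: z0 h1 h2; set z := normc _; set d := `|_%:~R|; set q := `|c _|.
  move=> z0 h1 h2 h3.
  have q0 : 0 <= q := normr_ge0 _; have d0 : 0 <= d := normr_ge0 _.
  have -> : t%:R * (q * z) = q * (t%:R * z) by ring.
  have -> : d * q * A + q * A = q * (d * A + A) by ring.
  rewrite ler_wpM2l//; apply: le_trans (lerD (ler_wpM2l d0 h1) h2).
  by rewrite -mulrDl ler_wpM2r.
rewrite big_split /= -!mulr_suml -mulrDl mulrC ler_wpM2l ?(ltW A_gt0)//.
apply: lerD.
  apply: (l1_bounded_inj (l1_bounded_moment1 K1 cSK) (iota_uniq _ _)
    (h := fun k : nat => t%:Z - k.+1%:Z)).
  by move=> i j /=; lia.
apply: (l1_bounded_inj cS0 (iota_uniq _ _) (h := fun k : nat => t%:Z - k.+1%:Z)).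
by move=> i j /=; lia.
Qed.

(** Substitute z_l = a_l + e^(-iw) z_(l+1). The first terms sum to c(t) by the
Yule-Walker equations; the others are the convolution at t + 1 without its
first term c(t) z_1. *)
Lemma hconv_rec w t : (0 < t)%N ->
  hconv w t = alpha w * (c t%:Z)%:C + cis (- w) * hconv w t.+1.
Proof.
move=> t0; apply: (ccvg_uniq (hconv_is_csum w t)).
have split1 : is_csum (fun k => (c (t%:Z - k.+1%:Z) * a k.+1)%:C) (c t%:Z)%:C.
  rewrite /is_csum; apply/ccvg_shift.
  rewrite (_ : (fun n => _) = (fun n => (toeplitz c n.+1 a t)%:C)).
    by apply/(ccvg_shift (fun n => (toeplitz c n a t)%:C)); apply: ccvg_real; exact: aYW.
  by apply/funext => n; rewrite -rmorph_sum /toeplitz big_add1.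
have split2 : is_csum (fun k => (c (t%:Z - k.+1%:Z))%:C * ztail w k.+2)
    (hconv w t.+1 - (c t%:Z)%:C * ztail w 1).
  have e : hconv w t.+1 = (c (t.+1%:Z - 1%N%:Z))%:C * ztail w 1 +
     (hconv w t.+1 - (c t%:Z)%:C * ztail w 1).
    have -> : t.+1%:Z - 1%N%:Z = t%:Z by lia.
    by rewrite addrC subrK.
  have := hconv_is_csum w t.+1; rewrite [X in is_csum _ X -> _]e.
  move=> /(is_csum_recl (fun k => (c (t.+1%:Z - k.+1%:Z))%:C * ztail w k.+1) _).2.
  apply: is_csum_ext => k.
  by have -> : t.+1%:Z - k.+2%:Z = t%:Z - k.+1%:Z by lia.
have := is_csumD split1 (is_csumZ (cis (- w)) split2).
have -> : (c t%:Z)%:C + cis (- w) * (hconv w t.+1 - (c t%:Z)%:C * ztail w 1) =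
  alpha w * (c t%:Z)%:C + cis (- w) * hconv w t.+1 by rewrite /alpha; ring.
apply: is_csum_ext => k.
by rewrite [in RHS]ztail_rec// rmorphM mulrDr [X in _ + X = _]mulrCA.
Qed.

(** Both sides satisfy the same first order recursion in t with a multiplier of
modulus 1 ([hconv_rec], [gtail_rec]), and both tend to 0. *)
Lemma hconvE w t : (0 < t)%N -> hconv w t = alpha w * gtail w t.
Proof.
pose e t := hconv w t - alpha w * gtail w t.
have erec s : (0 < s)%N -> e s = cis (- w) * e s.+1.
  by move=> s0; rewrite /e hconv_rec// gtail_rec//; ring.
have enorm s n : (0 < s)%N -> normc (e s) = normc (e (s + n)%N).
  move=> s0; elim: n => [|n IH]; first by rewrite addn0.
  rewrite IH erec; last by rewrite ltn_addr.
  by rewrite Normc.normcM normc_cis mul1r addnS.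
pose B := A * (SK + S0) + normc (alpha w) * SK.
have ebound s : (0 < s)%N -> s%:R * normc (e s) <= B.
  move=> s0; apply: (@le_trans _ _ (s%:R * (normc (hconv w s) +
      normc (alpha w) * normc (gtail w s)))).
    rewrite ler_wpM2l ?ler0n// (le_trans (normcD _ _))// lerD2l.
    by rewrite normcN Normc.normcM.
  rewrite mulrDr lerD ?normc_hconv// mulrCA ler_wpM2l ?normc_ge0//.
  rewrite mulrC -ler_pdivlMr ?ltr0n//; apply: (le_trans (normc_gtail w s0)).
  rewrite ler_pM2l// lef_pV2 ?posrE ?powR_gt0 ?ltr0n//.
  exact: powR_nat_ge.
move=> t0; apply/subr0_eq/Normc.eq0_normc/eqP; rewrite -/(e t).
rewrite eq_le normc_ge0 andbT; apply/ler_addgt0Pr => eps eps0; rewrite add0r.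
near \oo => n.
have Bn : B / eps <= (t + n)%:R.
  rewrite natrD; apply: ler_wpDl; first by rewrite ler0n.
  by near: n; exact: nbhs_infty_ger.
have tn0 : (0 < t + n)%N by rewrite ltn_addr.
rewrite (enorm t n)// -(@ler_pM2l _ (t + n)%:R) ?ltr0n//.
by apply: (le_trans (ebound _ tn0)); rewrite -ler_pdivrMr.
Unshelve. all: by end_near. Qed.

(** By [hconvE], the terms l > n of the convolution of c and [ztail]. *)
Definition remainder (w : R) n t : R[i] :=
  alpha w * gtail w t - \sum_(1 <= l < n.+1) (c (t%:Z - l%:Z))%:C * ztail w l.

Lemma normc_remainder w n t : (0 < n)%N -> (0 < t)%N ->
  normc (remainder w n t) <= S0 * A / n%:R `^ K.
Proof.
move=> n0 t0; rewrite /remainder -hconvE//.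
have lim := hconv_is_csum w t; rewrite /is_csum in lim.
pose s := \sum_(1 <= l < n.+1) (c (t%:Z - l%:Z))%:C * ztail w l.
apply: (normc_ccvg_le (ccvgD lim (ccvg_cst (- s)))); near=> N.
have nN : (n <= N)%N by near: N; exact: nbhs_infty_ge.
have -> : \sum_(0 <= k < N) (c (t%:Z - k.+1%:Z))%:C * ztail w k.+1 - s =
    \sum_(n.+1 <= l < N.+1) (c (t%:Z - l%:Z))%:C * ztail w l.
  rewrite -(big_add1 _ _ 0 N.+1 xpredT (fun l => (c (t%:Z - l%:Z))%:C * ztail w l)).
  by rewrite (@big_cat_nat _ _ _ n.+1)//= addrAC subrr add0r.
apply: (le_trans (normc_sum _ _)).
apply: (@le_trans _ _ (\sum_(n.+1 <= l < N.+1) `|c (t%:Z - l%:Z)| * (A / n%:R `^ K))).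
  rewrite big_nat [leRHS]big_nat; apply: ler_sum => l /andP[nl _].
  have l0 : (0 < l)%N by lia.
  rewrite Normc.normcM normc_real ler_wpM2l//.
  apply: (le_trans (normc_ztail w l0)).
  rewrite ler_pM2l// lef_pV2 ?posrE ?powR_gt0 ?ltr0n//.
  by rewrite ge0_ler_powR ?nnegrE// ler_nat ltnW.
rewrite -mulr_suml -mulrA ler_wpM2r ?divr_ge0 ?powR_ge0 ?(ltW A_gt0)//.
apply: (l1_bounded_inj cS0 (iota_uniq _ _)) => i j /=; lia.
Unshelve. all: by end_near. Qed.

Lemma sum_remainder w n : (0 < n)%N ->
  \sum_(1 <= t < n.+1) normc (remainder w n t) ^+ 2 <=
  n%:R * (S0 * A / n%:R `^ K) ^+ 2.
Proof.
move=> n0; apply: (@le_trans _ _ (\sum_(1 <= t < n.+1) (S0 * A / n%:R `^ K) ^+ 2)).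
  rewrite big_nat [leRHS]big_nat; apply: ler_sum => t /andP[t0 _].
  rewrite ler_pXn2r ?nnegrE ?normc_ge0 ?normc_remainder//.
  by rewrite divr_ge0 ?powR_ge0// mulr_ge0// ltW.
by rewrite sumr_const_nat subSS subn0 -[X in X <= _]mulr_natl.
Qed.

Lemma sum_gtail w n : \sum_(1 <= t < n.+1) normc (gtail w t) ^+ 2 <= 16 * SK ^+ 2.
Proof.
have SK2 : 0 <= 2 * SK ^+ 2 by rewrite mulr_ge0// sqr_ge0.
have := ler_wpM2l SK2 (@sum_inv_dist_le R n 0).
have -> : 2 * SK ^+ 2 * 8 = 16 * SK ^+ 2 by ring.
apply: le_trans; rewrite mulr_sumr big_nat [leRHS]big_nat; apply: ler_sum => t /andP[t0 _].
have tK : t%:R <= t%:R `^ K by exact: powR_nat_ge.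
have t1 : 1 <= t%:R :> R by rewrite ler1n.
apply: (@le_trans _ _ ((SK / t%:R) ^+ 2)).
  have SKt : 0 <= SK / t%:R by rewrite divr_ge0// ltW.
  rewrite ler_pXn2r ?nnegrE ?normc_ge0//.
  apply: (le_trans (normc_gtail w t0)).
  by rewrite ler_pM2l// lef_pV2 ?posrE ?powR_gt0 ?ltr0n.
rewrite subr0 -pmulrn expr_div_n; set x := t%:R in t1 *.
have x0 : 0 < x ^+ 2 by rewrite exprn_gt0// (lt_le_trans _ t1).
have p0 : 0 < 1 + x ^+ 2 by rewrite addr_gt0.
rewrite ler_pdivrMr// mulrC mulrA ler_pdivlMr//.
have : 0 <= SK ^+ 2 * (x ^+ 2 - 1).
  by rewrite mulr_ge0 ?sqr_ge0// subr_ge0 exprn_ege1.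
lra.
Qed.

(** z restricted to 1, ..., n solves the finite section with right-hand side
alpha g - remainder. *)
Lemma ztail_l2_le w n : (0 < n)%N ->
  m ^+ 2 * \sum_(1 <= l < n.+1) normc (ztail w l) ^+ 2 <=
  normc (alpha w) ^+ 2 * (32 * SK ^+ 2) +
  2 * (n%:R * (S0 * A / n%:R `^ K) ^+ 2).
Proof.
move=> n0; rewrite mulrC -ler_pdivlMr ?exprn_gt0// mulrC.
apply: (le_trans (ctoeplitz_l2 m_gt0 cm n _)).
rewrite ler_pM2l ?invr_gt0 ?exprn_gt0//.
apply: (@le_trans _ _ (\sum_(1 <= t < n.+1)
  (2 * normc (alpha w) ^+ 2 * normc (gtail w t) ^+ 2 +
   2 * normc (remainder w n t) ^+ 2))).
  apply: ler_sum => t _; set s := \sum_(_ <= _ < _) _.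
  have sE : s = alpha w * gtail w t - remainder w n t.
    by rewrite /remainder -/s opprB addrC subrK.
  rewrite sE (le_trans (sqr_normcD _ _))// normcN Normc.normcM exprMn mulrA.
  exact: lexx.
rewrite big_split /= -!mulr_sumr lerD ?ler_wpM2l ?sum_remainder//.
rewrite [2 * _]mulrC -mulrA ler_wpM2l ?sqr_ge0//.
have := sum_gtail w n; lra.
Qed.

(** The remainder in [ztail_l2_le] vanishes as n grows, so |z_1| is at most a
multiple of |alpha|, while 1 = alpha + e^(-iw) z_1. *)
Lemma alpha_lower w : 1 <= normc (alpha w) ^+ 2 * (2 + 64 * SK ^+ 2 / m ^+ 2).
Proof.
have z1 : m ^+ 2 * normc (ztail w 1) ^+ 2 <= normc (alpha w) ^+ 2 * (32 * SK ^+ 2).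
  have rate (b x : R) : 0 < x -> 2 * (x * (b / x) ^+ 2) = 2 * b ^+ 2 / x.
    by move=> x0; field; exact: lt0r_neq0.
  apply/ler_addgt0Pr => eps eps0; near \oo => n.
  have n0 : (0 < n)%N by near: n; exact: nbhs_infty_gt.
  apply: (@le_trans _ _ (m ^+ 2 * \sum_(1 <= l < n.+1) normc (ztail w l) ^+ 2)).
    rewrite ler_wpM2l ?sqr_ge0//.
    by apply: (sumsq_ge (fun l => normc (ztail w l))); lia.
  apply: (le_trans (ztail_l2_le w n0)); rewrite lerD2l.
  have nK := powR_nat_ge K1 n0.
  have n1 : 0 < n%:R :> R by rewrite ltr0n.
  have SA0 : 0 <= S0 * A by rewrite mulr_ge0// ltW.
  apply: (@le_trans _ _ (2 * (n%:R * (S0 * A / n%:R) ^+ 2))).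
    rewrite ler_wpM2l// ler_wpM2l ?ler0n//.
    rewrite ler_pXn2r ?nnegrE ?divr_ge0 ?powR_ge0//.
    by rewrite ler_wpM2l// lef_pV2 ?posrE ?powR_gt0.
  rewrite rate// ler_pdivrMr// [leRHS]mulrC -ler_pdivrMr//.
  by near: n; exact: nbhs_infty_ger.
have : 1 <= normc (alpha w) + normc (ztail w 1).
  have e : 1 = alpha w + cis (- w) * ztail w 1 by rewrite /alpha subrK.
  rewrite -{1}(Normc.normc1 R) {1}e (le_trans (normcD _ _))//.
  by rewrite Normc.normcM normc_cis mul1r.
have := normc_ge0 (alpha w); have := normc_ge0 (ztail w 1).
move: z1; rewrite -ler_pdivlMl ?exprn_gt0//.
set x := normc _; set y := normc _ => z1 x0 y0 xy.
have -> : y ^+ 2 * (2 + 64 * SK ^+ 2 / m ^+ 2) =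
    2 * y ^+ 2 + 2 * ((m ^+ 2)^-1 * (y ^+ 2 * (32 * SK ^+ 2))).
  by field; exact: lt0r_neq0.
have : 0 <= (x - y) ^+ 2 by exact: sqr_ge0.
have : 1 <= (x + y) ^+ 2 by rewrite addrC exprn_ege1.
lra.
Unshelve. all: by end_near. Qed.

Definition section_cst : R := m ^- 2 * (2 + 64 * SK ^+ 2 / m ^+ 2) * (S0 * A) ^+ 2.

(** The error solves the finite section with right-hand side - remainder / alpha. *)
Lemma finite_section_error w n (y : nat -> R[i]) : (0 < n)%N ->
  (forall t, (1 <= t < n.+1)%N ->
    \sum_(1 <= l < n.+1) (c (t%:Z - l%:Z))%:C * y l = gtail w t) ->
  \sum_(1 <= l < n.+1) normc (ztail w l / alpha w - y l) ^+ 2 <=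
  section_cst * (n%:R * (n%:R `^ (- K)) ^+ 2).
Proof.
move=> n0 yE; have a1 := alpha_lower w.
set L := 2 + _ in a1; have L0 : 0 < L.
  by rewrite ltr_pwDl// divr_ge0 ?sqr_ge0// mulr_ge0 ?sqr_ge0.
have a0 : 0 < normc (alpha w) ^+ 2.
  have : 0 < normc (alpha w) ^+ 2 * L by apply: lt_le_trans a1.
  by rewrite pmulr_lgt0.
have aN0 : alpha w != 0.
  by apply/eqP => e; move: a0; rewrite e Normc.normc0 expr0n /= ltxx.
apply: (le_trans (ctoeplitz_l2 m_gt0 cm n _)).
have -> : section_cst * (n%:R * (n%:R `^ (- K)) ^+ 2) =
    m ^- 2 * (L * (n%:R * (S0 * A / n%:R `^ K) ^+ 2)).
  by rewrite /section_cst -/L powRN; ring.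
rewrite ler_pM2l ?invr_gt0 ?exprn_gt0//.
apply: (@le_trans _ _ (L * \sum_(1 <= t < n.+1) normc (remainder w n t) ^+ 2)); last first.
  by rewrite ler_pM2l// sum_remainder.
rewrite mulr_sumr big_nat [leRHS]big_nat; apply: ler_sum => t tn.
have -> : \sum_(1 <= l < n.+1) (c (t%:Z - l%:Z))%:C * (ztail w l / alpha w - y l) =
    - (remainder w n t / alpha w).
  rewrite /remainder -yE// mulrBl mulrAC divff// mul1r opprB mulr_suml -sumrB.
  by apply: eq_bigr => l _; rewrite mulrBr mulrA.
rewrite normcN Normc.normcM Normc.normcV exprMn mulrC exprVn.
rewrite ler_wpM2r ?sqr_ge0//.
by rewrite -[leLHS]mul1r ler_pdivrMr// mulrC.
Qed.

End Transfer.

(** * Coercivity from the positivity of the spectral density *)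

Section CosineGrid.
Context {R : realType}.
Implicit Types (x y w : R).

Lemma cos_lipschitz x y : `|cos x - cos y| <= `|x - y|.
Proof.
wlog xy : x y / x < y => [hw|].
  have [xy|yx|->] := ltgtP x y; [exact: hw| |by rewrite !subrr].
  by rewrite distrC [leRHS]distrC; exact: hw.
have cosd (z : R) : z \in `]x, y[%R -> is_derive z 1 (@cos R) (- sin z).
  by move=> _; exact: is_derive_cos.
have [|z _ e] := MVT xy cosd.
  by apply: continuous_subspaceT => z; exact: continuous_cos.
rewrite distrC e normrM normrN distrC ler_piMl//.
exact: sin_max.
Qed.

(** Multiplied by sin(h / 2), h = 2 pi q / N, the sum telescopes to the difference of
sin at two points that differ by a multiple of the period. *)
Lemma cos_grid_sum (q : int) N : (`|q| < N)%N ->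
  \sum_(0 <= k < N) cos (q%:~R * (2 * pi * k%:R / N%:R)) =
  (q == 0)%:R * N%:R :> R.
Proof.
move=> qN; have N0 : (0 < N)%N by lia.
have NR0 : (N%:R : R) != 0 by rewrite pnatr_eq0 -lt0n.
have [->|q0] := eqVneq q 0.
  under eq_bigr do rewrite mul0r cos0.
  by rewrite sumr_const_nat subn0 mul1r.
rewrite mul0r; pose h : R := q%:~R * (2 * pi) / N%:R.
have sin0 : sin (h / 2) != 0.
  have hE : h / 2 = q%:~R * pi / N%:R by rewrite /h; field.
  have sgt (p : nat) : (0 < p < N)%N -> sin (p%:R * pi / N%:R : R) != 0.
    move=> /andP[p0 pN]; apply: lt0r_neq0; apply: sin_gt0_pi.
    rewrite divr_gt0 ?mulr_gt0 ?pi_gt0 ?ltr0n//=.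
    by rewrite ltr_pdivrMr ?ltr0n// mulrC ltr_pM2l ?pi_gt0// ltr_nat.
  rewrite hE; case: q q0 qN {h hE} => p q0 qN.
    by rewrite -pmulrn; apply: sgt; rewrite lt0n; lia.
  rewrite NegzE mulrNz !mulNr sinN oppr_eq0 -pmulrn.
  by apply: sgt; lia.
apply: (mulfI sin0); rewrite mulr0 mulr_sumr.
have tele k : sin (h / 2) * cos (q%:~R * (2 * pi * k%:R / N%:R)) =
    (sin (k.+1%:R * h - h / 2) - sin (k%:R * h - h / 2)) / 2.
  have -> : q%:~R * (2 * pi * k%:R / N%:R) = k%:R * h by rewrite /h; field.
  have -> : k.+1%:R * h - h / 2 = k%:R * h + h / 2 by rewrite -natr1; field.
  by rewrite sinD sinB; field.
under eq_bigr do rewrite tele.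
rewrite -mulr_suml telescope_sumr// mul0r sub0r.
have -> : N%:R * h - h / 2 = - (h / 2) + q%:~R * (2 * pi) by rewrite /h; field.
have per (p : nat) y : sin (y + p%:R * (2 * pi)) = sin y.
  have := periodicn (@sinD2pi R) p y.
  have -> : pi *+ 2 *+ p = p%:R * (2 * pi) :> R.
    by rewrite !mulr_natl.
  by [].
have -> : sin (- (h / 2) + q%:~R * (2 * pi)) = sin (- (h / 2)).
  case: q {q0 qN h sin0 tele} (h / 2) => p y; first exact: per.
  rewrite NegzE mulrNz -pmulrn -[LHS](per p.+1); congr sin.
  by rewrite mulNr subrK.
by rewrite subrr mul0r.
Qed.

End CosineGrid.

Section Coercivity.
Context {R : realType}.
Variables (c : int -> R) (S0 S1 : R).
Hypotheses (c_even : forall r, c (- r) = c r) (cS0 : l1_bounded c S0).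
Hypotheses (cS1 : l1_bounded (fun r => r%:~R * c r) S1).

Definition spectrum (w : R) : R[i] :=
  cseriesZ (fun r => (c r)%:C * cis (r%:~R * w)).

(** The indices run over -N, ..., N - 1, as in [cseriesZ]. *)
Definition spectrum_part N (w : R) : R := \sum_(0 <= k < N)
  (c k%:Z * cos (k%:Z%:~R * w) + c (- k.+1%:Z) * cos ((- k.+1%:Z)%:~R * w)).

Lemma negS_inj : injective (fun k : nat => - k.+1%:Z).
Proof. by move=> i j /=; lia. Qed.

Lemma posz_inj : injective (fun k : nat => k%:Z).
Proof. by move=> i j /=; lia. Qed.

Lemma spectrum_cvg w : spectrum_part N w @[N --> \oo] --> Re (spectrum w).
Proof.
pose u (r : int) := (c r)%:C * cis (r%:~R * w).
have us (h : nat -> int) : injective h -> is_csum (fun k => u (h k)) (cseries (fun k => u (h k))).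
  move=> hinj; apply: (@csummable_is_csum _ _ S0) => n.
  under eq_bigr do rewrite normc_realcis.
  exact: (l1_bounded_inj cS0 (iota_uniq _ _)).
have [h _] := is_csumD (us _ posz_inj) (us _ negS_inj).
rewrite (_ : (fun N => _) = (fun N => spectrum_part N w)) in h; first exact: h.
apply/funext => N; rewrite Re_sum; apply: eq_bigr => k _.
by rewrite /u ReD !Re_realM.
Qed.

(** cos is 1-Lipschitz and r c(r) is absolutely summable. *)
Lemma spectrum_lipschitz w w' :
  `|Re (spectrum w) - Re (spectrum w')| <= 2 * S1 * `|w - w'|.
Proof.
have lim : `|spectrum_part N w - spectrum_part N w'| @[N --> \oo] -->
    `|Re (spectrum w) - Re (spectrum w')|.
  by apply: cvg_norm; apply: cvgB; exact: spectrum_cvg.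
apply: (cvgr_to_le lim); near=> N.
rewrite /= /spectrum_part -sumrB.
apply: (le_trans (ler_norm_sum _ _ _)).
have bd r : `|c r * cos (r%:~R * w) - c r * cos (r%:~R * w')| <=
    `|r%:~R * c r| * `|w - w'|.
  rewrite -mulrBr !normrM [`|r%:~R| * _]mulrC -mulrA ler_wpM2l//.
  by apply: (le_trans (cos_lipschitz _ _)); rewrite -mulrBr normrM.
apply: (@le_trans _ _ (\sum_(0 <= k < N) (`|k%:Z%:~R * c k%:Z| * `|w - w'| +
    `|(- k.+1%:Z)%:~R * c (- k.+1%:Z)| * `|w - w'|))).
  apply: ler_sum => k _; rewrite opprD addrACA.
  by apply: (le_trans (ler_normD _ _)); rewrite lerD ?bd.
rewrite big_split /= -!mulr_suml -mulrDl ler_wpM2r//.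
have := l1_bounded_inj cS1 (iota_uniq 0 (N - 0)) posz_inj.
have := l1_bounded_inj cS1 (iota_uniq 0 (N - 0)) negS_inj.
rewrite -/(index_iota 0 N); lra.
Unshelve. all: by end_near. Qed.

Lemma spectrum_part_unif (e : R) : 0 < e ->
  exists N0, forall N w, (N0 <= N)%N -> `|Re (spectrum w) - spectrum_part N w| <= e.
Proof.
move=> e0; pose u k : R := `|c k.-1%:Z| + `|c (- k%:Z)|.
have uB n : \sum_(1 <= k < n.+1) `|u k| <= S0 + S0.
  rewrite big_add1 /=; under eq_bigr do rewrite ger0_norm ?addr_ge0//.
  rewrite big_split /= lerD//.
    exact: (l1_bounded_inj cS0 (iota_uniq _ _) posz_inj).
  exact: (l1_bounded_inj cS0 (iota_uniq _ _) negS_inj).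
have [N0 N0P] := bounded_sums_tail uB e0.
exists N0 => N w N0N.
have lim : `|spectrum_part M w - spectrum_part N w| @[M --> \oo] -->
    `|Re (spectrum w) - spectrum_part N w|.
  by apply: cvg_norm; apply: cvgB; [exact: spectrum_cvg|exact: cvg_cst].
apply: (cvgr_to_le lim); near=> M.
have NM : (N <= M)%N by near: M; exact: nbhs_infty_ge.
rewrite /spectrum_part [X in `|X - _|](@big_cat_nat _ _ _ N)//= addrAC subrr add0r.
apply: le_trans (N0P _ M N0N).
rewrite big_add1 /=.
apply: (le_trans (ler_norm_sum _ _ _)); apply: ler_sum => k _.
rewrite /u /= [leRHS]ger0_norm ?addr_ge0// (le_trans (ler_normD _ _))//.
by rewrite lerD// normrM ler_piMr// cos_max.
Unshelve. all: by end_near. Qed.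

Lemma spectrum_min : (forall w, 0 < spectrum w) ->
  exists m : R, 0 < m /\ forall w : R, 0 <= w <= 2 * pi -> m <= Re (spectrum w).
Proof.
move=> fpos; have ab : (0 : R) <= 2 * pi by rewrite mulr_ge0 ?pi_ge0.
have S1_ge0 : 0 <= S1 by exact: ge0_bound cS1.
have cont : continuous (fun w => Re (spectrum w)).
  move=> w; apply/cvgrPdist_le => e e0.
  have d0 : 0 < e / (2 * S1 + 1) by rewrite divr_gt0// ltr_wpDl// mulr_ge0.
  exists (e / (2 * S1 + 1)) => //= w' /= ww'.
  apply: (le_trans (spectrum_lipschitz _ _)).
  apply: (@le_trans _ _ ((2 * S1 + 1) * (e / (2 * S1 + 1)))).
    by rewrite ler_pM ?mulr_ge0 ?lerDl// ltW.
  by rewrite mulrCA divff ?mulr1// gt_eqF// ltr_wpDl// mulr_ge0.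
have [w0 _ w0P] := EVT_min ab (continuous_subspaceT cont).
exists (Re (spectrum w0)); split; last by move=> w ww; apply: w0P; rewrite in_itv.
by have := fpos w0; rewrite ltcE => /andP[].
Qed.

Lemma sum_delta (p : int) M : (`|p| < M)%N ->
  \sum_(0 <= j < M) ((j%:Z == p)%:R * c j%:Z +
    (- j.+1%:Z == p)%:R * c (- j.+1%:Z)) = c p.
Proof.
case: p => k kM.
  rewrite (bigD1_seq k) ?mem_index_iota ?iota_uniq//= eqxx mul1r mul0r addr0.
  rewrite big1 ?addr0// => j /negbTE jk.
  by rewrite (_ : (j%:Z == k%:Z) = false) ?mul0r ?addr0.
rewrite (bigD1_seq k) ?mem_index_iota ?iota_uniq//=; last by lia.
rewrite -NegzE eqxx mul1r mul0r add0r big1 ?addr0// => j /negbTE jk.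
by rewrite (_ : (- j.+1%:Z == Negz k) = false) ?mul0r ?addr0//; lia.
Qed.

(** The inversion formula for a trigonometric polynomial by an average over a grid
of N points: with N > M + n no two of the frequencies involved are congruent
mod N without being equal. *)
Lemma spectrum_grid n (x : nat -> R) M N : (n <= M)%N -> (M + n < N)%N ->
  \sum_(0 <= k < N) spectrum_part M (2 * pi * k%:R / N%:R) *
    (\sum_(1 <= s < n.+1) \sum_(1 <= t < n.+1) x s * x t *
      cos ((s%:Z - t%:Z)%:~R * (2 * pi * k%:R / N%:R))) =
  N%:R * \sum_(1 <= s < n.+1) \sum_(1 <= t < n.+1) x s * x t * c (s%:Z - t%:Z).
Proof.
move=> nM MN; pose th k : R := 2 * pi * k%:R / N%:R.
rewrite -/(th _).
have one (q : int) : (`|q| < n)%N -> 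
    \sum_(0 <= k < N) spectrum_part M (th k) * cos (q%:~R * th k) = N%:R * c q.
  move=> qn.
  have prodcos (r : int) : (`|r| <= M)%N ->
      \sum_(0 <= k < N) cos (r%:~R * th k) * cos (q%:~R * th k) =
      N%:R * ((r == - q)%:R + (r == q)%:R) / 2.
    move=> rM; transitivity (\sum_(0 <= k < N) (cos ((r + q)%:~R * th k) +
        cos ((r - q)%:~R * th k)) / 2).
      by apply: eq_bigr => k _; rewrite !intrD mulrNz !mulrDl mulNr cosB cosD; field.
    rewrite -mulr_suml big_split /= !cos_grid_sum; try lia.
    by rewrite -mulrDl subr_eq0 addr_eq0 [_ * N%:R]mulrC.
  rewrite /spectrum_part; under eq_bigr do rewrite mulr_suml.
  rewrite exchange_big /=.
  transitivity (\sum_(0 <= j < M) (c j%:Z * (N%:R * ((j%:Z == - q)%:R + (j%:Z == q)%:R) / 2) +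
     c (- j.+1%:Z) * (N%:R * ((- j.+1%:Z == - q)%:R + (- j.+1%:Z == q)%:R) / 2))).
    rewrite big_nat [RHS]big_nat; apply: eq_bigr => j /andP[_ jM].
    rewrite -!prodcos; try lia.
    rewrite !mulr_sumr -big_split /=; apply: eq_bigr => k _; ring.
  transitivity (N%:R / 2 * (\sum_(0 <= j < M) ((j%:Z == - q)%:R * c j%:Z +
        (- j.+1%:Z == - q)%:R * c (- j.+1%:Z)) +
      \sum_(0 <= j < M) ((j%:Z == q)%:R * c j%:Z +
        (- j.+1%:Z == q)%:R * c (- j.+1%:Z)))).
    by rewrite -big_split mulr_sumr; apply: eq_bigr => j _ /=; field.
  rewrite !sum_delta; try lia.
  by rewrite c_even; field.
transitivity (\sum_(0 <= k < N) \sum_(1 <= s < n.+1) \sum_(1 <= t < n.+1)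
    x s * x t * (spectrum_part M (th k) * cos ((s%:Z - t%:Z)%:~R * th k))).
  apply: eq_bigr => k _; rewrite mulr_sumr; apply: eq_bigr => s _.
  by rewrite mulr_sumr; apply: eq_bigr => t _; rewrite mulrCA.
rewrite exchange_big /= mulr_sumr big_nat [RHS]big_nat; apply: eq_bigr => s sn.
rewrite exchange_big /= mulr_sumr big_nat [RHS]big_nat; apply: eq_bigr => t tn.
by rewrite -mulr_sumr one 1?mulrCA//; lia.
Qed.

Lemma sum_cos_ge0 n (x : nat -> R) y :
  0 <= \sum_(1 <= s < n.+1) \sum_(1 <= t < n.+1) x s * x t *
      cos ((s%:Z - t%:Z)%:~R * y).
Proof.
have -> : \sum_(1 <= s < n.+1) \sum_(1 <= t < n.+1) x s * x t *
      cos ((s%:Z - t%:Z)%:~R * y) =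
    (\sum_(1 <= s < n.+1) x s * cos (s%:R * y)) ^+ 2 +
    (\sum_(1 <= s < n.+1) x s * sin (s%:R * y)) ^+ 2.
  rewrite !expr2 !mulr_suml -big_split /=; apply: eq_bigr => s _.
  rewrite !mulr_sumr -big_split /=; apply: eq_bigr => t _.
  by rewrite intrB mulrBl cosB -!pmulrn; ring.
by rewrite addr_ge0 ?sqr_ge0.
Qed.

(** The Toeplitz form is the grid average of the truncated density times
|sum_s x_s e^(isw)|^2. The truncation order is such that the truncated density
stays above m / 2, where m is the minimum of the density. *)
Lemma coercive_spectrum : (forall w, 0 < spectrum w) ->
  exists m : R, 0 < m /\ coercive c m.
Proof.
move=> fpos; have [m [m0 fm]] := spectrum_min fpos.
have m2 : 0 < m / 2 by rewrite divr_gt0.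
exists (m / 2); split => // n x.
have [N0 N0P] := spectrum_part_unif m2.
pose M := maxn N0 n; pose N := (M + n).+1.
have NR : 0 < N%:R :> R by rewrite ltr0n.
rewrite -(ler_pM2l NR).
have -> : \sum_(1 <= t < n.+1) x t * toeplitz c n x t =
    \sum_(1 <= s < n.+1) \sum_(1 <= t < n.+1) x s * x t * c (s%:Z - t%:Z).
  apply: eq_bigr => s _; rewrite /toeplitz mulr_sumr; apply: eq_bigr => t _.
  by rewrite mulrAC mulrA.
(* replace the Toeplitz form by its grid average *)
rewrite -(@spectrum_grid n x M N)//; last by rewrite leq_maxr.
pose P y := \sum_(1 <= s < n.+1) \sum_(1 <= t < n.+1) x s * x t *
      cos ((s%:Z - t%:Z)%:~R * y).
apply: (@le_trans _ _ (\sum_(0 <= k < N) m / 2 * P (2 * pi * k%:R / N%:R))).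
  rewrite -mulr_sumr mulrCA ler_pM2l// /P.
  rewrite exchange_big /= mulr_sumr [leLHS]big_nat [leRHS]big_nat; apply: ler_sum => s sn.
  rewrite exchange_big /= (bigD1_seq s) ?mem_index_iota ?iota_uniq//=.
  rewrite -mulr_sumr cos_grid_sum; last by lia.
  rewrite subrr eqxx mul1r mulrC -expr2 lerDl.
  rewrite big_seq_cond big1 // => t; rewrite mem_index_iota => /andP[tn ts].
  rewrite -mulr_sumr cos_grid_sum; last by lia.
  by rewrite subr_eq0 (_ : (s%:Z == t%:Z) = false) ?mul0r ?mulr0//; lia.
rewrite big_nat [leRHS]big_nat; apply: ler_sum => k /andP[_ kN].
rewrite ler_wpM2r ?sum_cos_ge0//.
have w1 : 0 <= 2 * (@pi R) * k%:R / N%:R <= 2 * @pi R.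
  apply/andP; split; first by rewrite divr_ge0 ?mulr_ge0 ?pi_ge0 ?ler0n.
  rewrite ler_pdivrMr//.
  by rewrite ler_wpM2l ?mulr_ge0 ?pi_ge0// ler_nat ltnW.
have := fm _ w1; have := N0P M (2 * pi * k%:R / N%:R) (leq_maxl _ _).
rewrite ler_norml => /andP[_ h1] h2; move: h1 h2.
set f := Re _; set g := spectrum_part _ _; lra.
Qed.

End Coercivity.

(** * Square-integrable random variables *)

Section Expectations.
Context {d : measure_display} {T : measurableType d} {R : realType}.
Variable P : probability T R.
Implicit Types f g h u : T -> R.

Definition L1 f := P.-integrable setT (EFin \o f).
Definition mean f : R := fine 'E_P[f].

Lemma meanE f : mean f = Rintegral P setT f.
Proof. by rewrite /mean unlock. Qed.

Lemma mean_EFin f : L1 f -> 'E_P[f]%E = (mean f)%:E.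
Proof.
move=> f1; rewrite /mean fineK// unlock.
exact: (integrable_fin_num measurableT f1).
Qed.

Lemma L1_le f g : measurable_fun setT f -> (forall x, `|f x| <= g x) ->
  L1 g -> L1 f.
Proof.
move=> mf fg; apply: le_integrable => //; first exact/measurable_EFinP.
by move=> x _ /=; rewrite lee_fin (le_trans (fg x))// ler_norm.
Qed.

Lemma L1_ge0 f : measurable_fun setT f -> (forall x, 0 <= f x) ->
  ('E_P[f] < +oo)%E -> L1 f.
Proof.
move=> mf f0; rewrite unlock => fy; apply/integrableP; split.
  exact/measurable_EFinP.
by under eq_integral do rewrite /= ger0_norm//.
Qed.

Lemma L1_cst (a : R) : L1 (fun=> a).
Proof. exact: finite_measure_integrable_cst. Qed.

Lemma L1D f g : L1 f -> L1 g -> L1 (fun x => f x + g x).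
Proof. by move=> f1 g1; exact: (integrableD measurableT f1 g1). Qed.

Lemma L1Z (a : R) f : L1 f -> L1 (fun x => a * f x).
Proof. by move=> f1; exact: (integrableZl measurableT a f1). Qed.

Lemma L1B f g : L1 f -> L1 g -> L1 (fun x => f x - g x).
Proof. by move=> f1 g1; exact: (integrableB measurableT f1 g1). Qed.

Lemma meanD f g : L1 f -> L1 g -> mean (fun x => f x + g x) = mean f + mean g.
Proof. by move=> f1 g1; rewrite !meanE RintegralD. Qed.

Lemma meanB f g : L1 f -> L1 g -> mean (fun x => f x - g x) = mean f - mean g.
Proof. by move=> f1 g1; rewrite !meanE RintegralB. Qed.

Lemma meanZ (a : R) f : L1 f -> mean (fun x => a * f x) = a * mean f.
Proof. by move=> f1; rewrite !meanE RintegralZl. Qed.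

Lemma mean_cst (a : R) : mean (fun=> a) = a.
Proof.
rewrite meanE Rintegral_cst//; have -> : fine (P setT) = 1 by rewrite probability_setT.
exact: mulr1.
Qed.

Lemma mean_ge0 f : (forall x, 0 <= f x) -> 0 <= mean f.
Proof. by move=> f0; rewrite meanE Rintegral_ge0. Qed.

Lemma L1_sum {I : Type} (s : seq I) (u : I -> T -> R) :
  (forall i, L1 (u i)) -> L1 (fun x => \sum_(i <- s) u i x).
Proof.
move=> u1; elim: s => [|i s IH].
  by under [X in L1 X]eq_fun do rewrite big_nil; exact: L1_cst.
by under [X in L1 X]eq_fun do rewrite big_cons; exact: L1D.
Qed.

Lemma mean_sum {I : Type} (s : seq I) (u : I -> T -> R) :
  (forall i, L1 (u i)) ->
  mean (fun x => \sum_(i <- s) u i x) = \sum_(i <- s) mean (u i).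
Proof.
move=> u1; elim: s => [|i s IH].
  by under [X in mean X]eq_fun do rewrite big_nil; rewrite mean_cst big_nil.
under [X in mean X]eq_fun do rewrite big_cons.
by rewrite meanD ?IH ?big_cons//; exact: L1_sum.
Qed.

Definition L2 f := measurable_fun setT f /\ L1 (fun x => f x ^+ 2).
Definition ip f g : R := mean (fun x => f x * g x).

Lemma L2M f g : L2 f -> L2 g -> L1 (fun x => f x * g x).
Proof.
move=> [mf f2] [mg g2].
apply: (@L1_le _ (fun x => f x ^+ 2 + g x ^+ 2)).
- exact: measurable_funM.
- move=> x; rewrite normrM -(real_normK (num_real (f x))).
  rewrite -(real_normK (num_real (g x))).
  by set a := `|f x|; set b := `|g x|; have := sqr_ge0 (a - b); 
    have := sqr_ge0 (a + b); nra.
- exact: L1D.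
Qed.

Lemma L2_cst (a : R) : L2 (fun=> a).
Proof. by split; [exact: measurable_cst|exact: L1_cst]. Qed.

Lemma L2_L1 f : L2 f -> L1 f.
Proof.
move=> f2; have := L2M f2 (L2_cst 1).
by under [X in L1 X]eq_fun do rewrite mulr1.
Qed.

Lemma L2D f g : L2 f -> L2 g -> L2 (fun x => f x + g x).
Proof.
move=> f2 g2; split; first by apply: measurable_funD; [case: f2|case: g2].
have := L1D (L1D f2.2 g2.2) (L1Z 2 (L2M f2 g2)).
by congr L1; apply/funext => x; ring.
Qed.

Lemma L2Z (a : R) f : L2 f -> L2 (fun x => a * f x).
Proof.
move=> [mf f2]; split; first by apply: measurable_funM => //; exact: measurable_cst.
by under [X in L1 X]eq_fun do rewrite exprMn; exact: L1Z.
Qed.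

Lemma L2B f g : L2 f -> L2 g -> L2 (fun x => f x - g x).
Proof.
move=> f2 g2; have := L2D f2 (L2Z (-1) g2).
by under [X in L2 X]eq_fun do rewrite mulN1r.
Qed.

Lemma L2_sum {I : Type} (s : seq I) (u : I -> T -> R) :
  (forall i, L2 (u i)) -> L2 (fun x => \sum_(i <- s) u i x).
Proof.
move=> u1; elim: s => [|i s IH].
  by under [X in L2 X]eq_fun do rewrite big_nil; exact: L2_cst.
by under [X in L2 X]eq_fun do rewrite big_cons; exact: L2D.
Qed.

Lemma ipC f g : ip f g = ip g f.
Proof. by congr mean; apply/funext => x; rewrite mulrC. Qed.

Lemma ipDl f g h : L2 f -> L2 g -> L2 h ->
  ip (fun x => f x + g x) h = ip f h + ip g h.
Proof.
move=> f2 g2 h2; rewrite /ip -meanD; [|exact: L2M|exact: L2M].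
by congr mean; apply/funext => x; rewrite mulrDl.
Qed.

Lemma ipBl f g h : L2 f -> L2 g -> L2 h ->
  ip (fun x => f x - g x) h = ip f h - ip g h.
Proof.
move=> f2 g2 h2; rewrite /ip -meanB; [|exact: L2M|exact: L2M].
by congr mean; apply/funext => x; rewrite mulrBl.
Qed.

Lemma ipZl (a : R) f h : L2 f -> L2 h -> ip (fun x => a * f x) h = a * ip f h.
Proof.
move=> f2 h2; rewrite /ip -meanZ; last exact: L2M.
by congr mean; apply/funext => x; rewrite mulrA.
Qed.

Lemma ip_suml {I : Type} (s : seq I) (u : I -> T -> R) h :
  (forall i, L2 (u i)) -> L2 h ->
  ip (fun x => \sum_(i <- s) u i x) h = \sum_(i <- s) ip (u i) h.
Proof.
move=> u2 h2; rewrite /ip -mean_sum; last by move=> i; exact: L2M.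
by congr mean; apply/funext => x; rewrite mulr_suml.
Qed.

Lemma ip_ge0 f : 0 <= ip f f.
Proof. by apply: mean_ge0 => x; rewrite -expr2 sqr_ge0. Qed.

Lemma ip_sq f : ip f f = mean (fun x => f x ^+ 2).
Proof. by congr mean; apply/funext => x; rewrite expr2. Qed.

Lemma E_sq f : L2 f -> 'E_P[fun x => (f x ^+ 2)%R]%E = (ip f f)%:E.
Proof. by move=> f2; rewrite mean_EFin ?ip_sq//; case: f2. Qed.

Lemma ip_sqD f g : L2 f -> L2 g ->
  ip (fun x => f x + g x) (fun x => f x + g x) = ip f f + 2 * ip f g + ip g g.
Proof.
move=> f2 g2; have fg := L2D f2 g2.
by rewrite ipDl// (ipC f (fun x => _)) (ipC g (fun x => _)) !ipDl// (ipC g f); ring.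
Qed.

(** The quadratic polynomial E (l f + g)^2 in l is nonnegative. *)
Lemma cauchy_schwarz_ip f g : L2 f -> L2 g -> ip f g ^+ 2 <= ip f f * ip g g.
Proof.
move=> f2 g2.
have quad (l : R) : 0 <= l ^+ 2 * ip f f + 2 * (l * ip f g) + ip g g.
  have := ip_ge0 (fun x => l * f x + g x); rewrite ip_sqD//; last exact: L2Z.
  rewrite !ipZl//; last exact: L2Z.
  by rewrite ipC ipZl// mulrA -expr2.
move: (ip_ge0 f) (ip_ge0 g) quad.
set a := ip f f; set b := ip f g; set c := ip g g => a0 c0 quad.
move: a0; rewrite le_eqVlt => /predU1P[a0|a0].
  have [->|b0] := eqVneq b 0; first by rewrite -a0 mul0r expr0n.
  have := quad (- (c + 1) / (2 * b)); rewrite -a0 mulr0 add0r.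
  have -> : 2 * (- (c + 1) / (2 * b) * b) = - (c + 1) by field.
  lra.
have := quad (- b / a).
have -> : (- b / a) ^+ 2 * a + 2 * (- b / a * b) + c = (a * c - b ^+ 2) / a.
  by field; exact: lt0r_neq0.
by rewrite pmulr_lge0 ?invr_gt0// subr_ge0.
Qed.

Lemma ip_cvg0 (u : nat -> T -> R) g : (forall n, L2 (u n)) -> L2 g ->
  ip (u n) (u n) @[n --> \oo] --> 0 -> ip (u n) g @[n --> \oo] --> 0.
Proof.
move=> u2 g2 u0; apply/cvgrPdist_le => e e0.
have d0 : 0 < e ^+ 2 / (ip g g + 1).
  by rewrite divr_gt0 ?exprn_gt0// ltr_wpDl ?ip_ge0.
have /cvgrPdist_le/(_ _ d0) := u0; apply: filterS => n.
rewrite !sub0r !normrN (ger0_norm (ip_ge0 _)) => un.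
rewrite -(@ler_pXn2r _ 2)// ?nnegrE ?(ltW e0)// real_normK ?num_real//.
apply: (le_trans (cauchy_schwarz_ip (u2 n) g2)).
apply: (@le_trans _ _ (e ^+ 2 / (ip g g + 1) * (ip g g + 1))).
  by rewrite ler_pM ?ip_ge0// lerDl.
by rewrite mulfVK// gt_eqF// ltr_wpDl ?ip_ge0.
Qed.

(** E[(f - E f) g] = E[f g] as soon as g is centred. *)
Lemma covariance_ip f g : L2 f -> L2 g -> 'E_P[g]%E = 0%E ->
  covariance P f g = (ip f g)%:E.
Proof.
move=> f2 g2 g0; rewrite unlock g0 /=.
rewrite (_ : (_ * _) = (fun x => f x * g x - mean f * g x)); last first.
  by apply/funext => x /=; rewrite -[LHS]/((f x - mean f) * (g x - 0)) subr0 mulrBl.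
have f1 := L2M f2 g2; have g1 := L1Z (mean f) (L2_L1 g2).
rewrite mean_EFin; last exact: L1B.
rewrite meanB// meanZ; last exact: L2_L1.
by rewrite /mean g0 /= mulr0 subr0.
Qed.

End Expectations.

(** * Mean-square convergent series *)

Section L2Series.
Context {d : measure_display} {T : measurableType d} {R : realType}.
Variable P : probability T R.

(** Cauchy-Schwarz for the weights |a_j|, by induction on the list. *)
Lemma weighted_cauchy_schwarz (s : seq nat) (a u : nat -> R) :
  (\sum_(j <- s) a j * u j) ^+ 2 <=
  (\sum_(j <- s) `|a j|) * (\sum_(j <- s) `|a j| * u j ^+ 2).
Proof.
suff : (\sum_(j <- s) `|a j| * `|u j|) ^+ 2 <=
    (\sum_(j <- s) `|a j|) * (\sum_(j <- s) `|a j| * u j ^+ 2).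
  apply: le_trans; rewrite -real_normK ?num_real//.
  have S0 : 0 <= \sum_(j <- s) `|a j| * `|u j|.
    by apply: sumr_ge0 => j _; rewrite mulr_ge0.
  rewrite ler_pXn2r ?nnegrE//.
  apply: (le_trans (ler_norm_sum _ _ _)).
  by apply: ler_sum => j _; rewrite normrM.
elim: s => [|j s IH]; first by rewrite !big_nil mul0r expr0n.
rewrite !big_cons -(real_normK (num_real (u j))); move: IH.
have : 0 <= \sum_(j <- s) `|a j| * `|u j| by apply: sumr_ge0 => i _; rewrite mulr_ge0.
have : 0 <= \sum_(j <- s) `|a j| * u j ^+ 2.
  by apply: sumr_ge0 => i _; rewrite mulr_ge0// sqr_ge0.
have : 0 <= \sum_(j <- s) `|a j| by exact: sumr_ge0.
set W := \sum_(_ <- _) _ * _; set S := \sum_(_ <- _) _ * _; set A := \sum_(_ <- _) _.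
have := normr_ge0 (a j); have := normr_ge0 (u j).
set b := `|a j|; set v := `|u j| => v0 b0 A0 W0 S0 IH.
have key : 2 * S * v <= A * v ^+ 2 + W.
  rewrite -(@ler_pXn2r _ 2)// ?nnegrE ?addr_ge0 ?mulr_ge0 ?sqr_ge0//.
  have h1 := sqr_ge0 (A * v ^+ 2 - W).
  have h2 : 0 <= (A * W - S ^+ 2) * v ^+ 2 by rewrite mulr_ge0 ?sqr_ge0// subr_ge0.
  nra.
have h3 : 0 <= b * (A * v ^+ 2 + W - 2 * S * v) by rewrite mulr_ge0// subr_ge0.
nra.
Qed.

(** W = sum_j |a_j| u_j^2 has a finite integral. Where W is finite the series
converges absolutely, and by the weighted Cauchy-Schwarz inequality its tails are
at most (tail of sum |a_j|) W in square; where W is infinite this bound is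
trivial, so no exceptional set has to be removed. *)
Lemma L2_series (u : nat -> T -> R) (a : nat -> R) (B C : R) :
  (forall j, L2 P (u j)) -> (forall j, ip P (u j) (u j) <= C) ->
  (forall n, \sum_(0 <= j < n) `|a j| <= B) ->
  exists Y : T -> R, L2 P Y /\
    ip P (fun x => Y x - \sum_(0 <= j < n) a j * u j x)
         (fun x => Y x - \sum_(0 <= j < n) a j * u j x) @[n --> \oo] --> 0.
Proof.
move=> u2 uC aB.
have mu j : measurable_fun setT (u j) by case: (u2 j).
have C0 : 0 <= C by apply: le_trans (uC 0%N); exact: ip_ge0.
have B0 : 0 <= B by apply: le_trans (aB 0%N); rewrite big_geq.
pose p n x : R := \sum_(0 <= j < n) a j * u j x.
pose W x : \bar R := (\sum_(0 <= j <oo) (`|a j| * u j x ^+ 2)%:E)%E.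
have term0 x j : (0 <= (`|a j| * u j x ^+ 2)%:E)%E.
  by rewrite lee_fin mulr_ge0// sqr_ge0.
have mterm j : measurable_fun setT (fun x => (`|a j| * u j x ^+ 2)%:E).
  apply/measurable_EFinP/measurable_funM; first exact: measurable_cst.
  exact: measurable_funX.
have mW : measurable_fun setT W by apply: ge0_emeasurable_sum.
have W0 x : (0 <= W x)%E by apply: nneseries_ge0 => j _ _; exact: term0.
pose A := [set x | (W x < +oo)%E].
have mA : measurable A.
  by have := emeasurable_fun_infty_o measurableT mW +oo%E; rewrite setTI.
have intW : (\int[P]_x W x <= (B * C)%:E)%E.
  rewrite integral_nneseries//.
  apply: lime_le.
    apply: is_cvg_nneseries => j _ _; apply: integral_ge0 => x _; exact: term0.
  apply: nearW => n.
  have le j : (\int[P]_x (`|a j| * u j x ^+ 2)%:E <= (`|a j| * C)%:E)%E.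
    have := mean_EFin (L1Z `|a j| (u2 j).2).
    rewrite unlock => ->; rewrite lee_fin meanZ; last by case: (u2 j).
    by rewrite ler_wpM2l// -ip_sq.
  apply: (@le_trans _ _ (\sum_(0 <= j < n) (`|a j| * C)%:E)%E).
    by apply: lee_sum => j _; exact: le.
  by rewrite sumEFin lee_fin -mulr_suml ler_wpM2r.
have Wpart x : A x -> forall n, \sum_(0 <= j < n) `|a j| * u j x ^+ 2 <= fine (W x).
  move=> Ax n; rewrite -lee_fin fineK ?ge0_fin_numE// -sumEFin.
  by apply: nneseries_lim_ge => j _ _; exact: term0.
have pcvg x : A x -> cvgn (p ^~ x).
  move=> Ax; rewrite (_ : p ^~ x = series (fun j => a j * u j x)); last first.
    by apply/funext => n; rewrite seriesEnat.
  apply: (@bounded_series_cvg _ _ (B + fine (W x))) => n.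
  apply: le_trans (lerD (aB n) (Wpart x Ax n)); rewrite -big_split /=.
  apply: ler_sum => j _; rewrite normrM -(real_normK (num_real (u j x))).
  have := normr_ge0 (a j); have := sqr_ge0 (`|u j x| - 1).
  have := normr_ge0 (u j x); set v := `|u j x|; set b := `|a j| => v0 q b0.
  have : 0 <= b * (1 + v ^+ 2 - v) by rewrite mulr_ge0//; nra.
  lra.
(* the indicator makes the limit exist everywhere, hence measurable *)
pose Y x : R := limn (fun n => p n x * \1_A x).
have mp n : measurable_fun setT (p n).
  apply: measurable_sum => j; apply: measurable_funM => //.
have YA x : A x -> p n x @[n --> \oo] --> Y x.
  move=> Ax; rewrite /Y indicE mem_set//.
  by under [X in limn X]eq_fun do rewrite mulr1; exact: pcvg.
have mY : measurable_fun setT Y.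
  apply: (@measurable_fun_cvg _ _ _ _ (fun n x => p n x * \1_A x)).
    by move=> n; apply: measurable_funM => //; exact: measurable_indic.
  move=> x _; have [Ax|nAx] := pselect (A x).
    rewrite /Y indicE mem_set//.
    by under [X in X @ _ --> _]eq_fun do rewrite mulr1;
       under [X in limn X]eq_fun do rewrite mulr1; exact: pcvg.
  rewrite /Y indicE memNset//.
  under [X in X @ _ --> _]eq_fun do rewrite mulr0.
  under [X in limn X]eq_fun do rewrite mulr0.
  by rewrite lim_cst//; exact: cvg_cst.
have mYp n : measurable_fun setT (fun x => Y x - p n x) by exact: measurable_funB.
have dist (e : R) : 0 < e -> \forall n \near \oo,
    forall x, (((Y x - p n x) ^+ 2)%:E <= e%:E * W x)%E.
  move=> e0; have aB' n : \sum_(1 <= k < n.+1) `|a k.-1| <= B.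
    by rewrite big_add1 /=; exact: aB.
  have [n0 n0P] := bounded_sums_tail aB' e0.
  exists n0 => // n /= n0n x; have [Ax|nAx] := pselect (A x); last first.
    have -> : W x = +oo%E.
      by apply/eqP; move: nAx; rewrite /A /= ltey => /negP; rewrite negbK.
    by rewrite gt0_muley ?lte_fin// leey.
  rewrite -[W x]fineK ?ge0_fin_numE// -EFinM lee_fin.
  have lim : (p M x - p n x) ^+ 2 @[M --> \oo] --> (Y x - p n x) ^+ 2.
    by rewrite expr2; apply: cvgM; apply: cvgB; (try exact: cvg_cst); exact: YA.
  apply: (cvgr_to_le lim); near=> M.
  have nM : (n <= M)%N by near: M; exact: nbhs_infty_ge.
  have -> : p M x - p n x = \sum_(n <= j < M) a j * u j x.
    by rewrite /p (@big_cat_nat _ _ _ n 0 M)//= addrAC subrr add0r.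
  apply: (le_trans (weighted_cauchy_schwarz _ _ _)).
  apply: ler_pM.
  - exact: sumr_ge0.
  - by apply: sumr_ge0 => j _; rewrite mulr_ge0// sqr_ge0.
  - by have := n0P n M n0n; rewrite big_add1.
  - apply: le_trans (Wpart x Ax M).
    rewrite [leRHS](@big_cat_nat _ _ _ n)//= lerDr.
    by apply: sumr_ge0 => j _; rewrite mulr_ge0// sqr_ge0.
have intdist (e : R) : 0 < e -> \forall n \near \oo,
    ('E_P[fun x => ((Y x - p n x) ^+ 2)%R] <= (e * (B * C))%:E)%E.
  move=> e0; have := dist e e0; apply: filterS => n le.
  rewrite unlock EFinM; apply: (@le_trans _ _ (\int[P]_x (e%:E * W x))%E).
    apply: ge0_le_integral => //.
    - by move=> x _; rewrite lee_fin sqr_ge0.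
    - by apply/measurable_EFinP; exact: measurable_funX.
    - exact: measurable_funeM.
  rewrite ge0_integralZl//; last by rewrite lee_fin ltW.
  by rewrite lee_wpmul2l// lee_fin ltW.
have Yp2 n : L2 P (fun x => Y x - p n x) -> L2 P Y.
  move=> h; have h2 : L2 P (p n) by apply: L2_sum => j; exact: L2Z.
  by have := L2D h h2; congr L2; apply/funext => x; rewrite subrK.
have pL2 n : L2 P (p n) by apply: L2_sum => j; exact: L2Z.
have Y2 : L2 P Y.
  have [n _ /(_ n (leqnn n)) h] := intdist 1 ltr01.
  apply: (Yp2 n); split => //; apply: L1_ge0.
  - exact: measurable_funX.
  - by move=> x; rewrite sqr_ge0.
  - by apply: le_lt_trans h _; rewrite ltry.
exists Y; split => //.
apply/cvgrPdist_le => e e0.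
have d0 : 0 < e / (B * C + 1) by rewrite divr_gt0// ltr_wpDl// mulr_ge0.
have := intdist _ d0; apply: filterS => n.
rewrite E_sq; last exact: L2B.
rewrite lee_fin sub0r normrN (ger0_norm (ip_ge0 _ _)) => /le_trans; apply.
rewrite -mulrA ler_piMr ?(ltW e0)// mulrC ler_pdivrMr.
  by rewrite mul1r lerDl.
by rewrite ltr_wpDl// mulr_ge0.
Unshelve. all: by end_near. Qed.

End L2Series.

(** * Normal equations of the best linear predictors *)

Section SecondOrder.
Context {d : measure_display} {T : measurableType d} {R : realType}.
Variables (P : probability T R) (X : int -> {RV P >-> R}).
Hypotheses (X0 : mean_zero X) (Xss : second_order_stationary X).

Let c := autocov X.

Lemma XL2 t : L2 P (X t).
Proof.
split; first exact: measurable_funP.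
case: Xss => + _ _ => /(_ t); apply: L1_ge0; first exact: measurable_funX.
by move=> x; rewrite sqr_ge0.
Qed.

Lemma ipX s t : ip P (X s) (X t) = c (t - s).
Proof.
have cov s' t' := covariance_ip (XL2 s') (XL2 t') (X0 t').
rewrite /c /autocov cov /=; apply: EFin_inj; rewrite -!cov.
by case: Xss => _ _ /(_ s (t - s)); rewrite addrC subrK.
Qed.

Lemma autocov_even r : c (- r) = c r.
Proof. by rewrite -[in LHS](sub0r r) -ipX ipC ipX subr0. Qed.

Lemma lincombL2 n b : L2 P (lincomb X n b).
Proof. by apply: L2_sum => t; exact: L2Z (XL2 _). Qed.

Lemma ip_lincomb n b t : ip P (lincomb X n b) (X t) =
  \sum_(1 <= l < n.+1) c (t - l%:Z) * b l.
Proof.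
rewrite ip_suml; [|by move=> l; exact: L2Z (XL2 _)|exact: XL2].
by apply: eq_bigr => l _; rewrite ipZl ?ipX 1?mulrC//; exact: XL2.
Qed.

Lemma ip_lincomb_sq n b : ip P (lincomb X n b) (lincomb X n b) =
  \sum_(1 <= t < n.+1) b t * toeplitz c n b t.
Proof.
rewrite ip_suml; [|by move=> l; exact: L2Z (XL2 _)|exact: lincombL2].
apply: eq_bigr => t _; rewrite ipZl; [|exact: XL2|exact: lincombL2].
by rewrite ipC ip_lincomb.
Qed.

(** Any solution phi of the normal equations makes the prediction error orthogonal
to the observations, so the mean square error of b exceeds that of phi by the
Toeplitz form of phi - b. A best b thus agrees with phi by coercivity. *)
Lemma blp_coef_normal (m : R) n tau t : 0 < m -> coercive c m ->
  (1 <= t < n.+1)%N -> toeplitz c n (blp_coef X n tau) t = c (t%:Z - tau).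
Proof.
move=> m0 cm tn.
have [phi phiE] := toeplitz_solve m0 cm n (fun t => c (t%:Z - tau)).
pose Q b : R := ip P (fun x => X tau x - lincomb X n b x)
                     (fun x => X tau x - lincomb X n b x).
have errL2 b : L2 P (fun x => X tau x - lincomb X n b x).
  by apply: L2B; [exact: XL2|exact: lincombL2].
have QE b : Q b = Q phi + \sum_(1 <= t < n.+1) (phi t - b t) *
    toeplitz c n (fun t => phi t - b t) t.
  rewrite -ip_lincomb_sq.
  have -> : Q b = ip P
     (fun x => X tau x - lincomb X n phi x + lincomb X n (fun t => phi t - b t) x)
     (fun x => X tau x - lincomb X n phi x + lincomb X n (fun t => phi t - b t) x).
    have LB x : lincomb X n (fun t => phi t - b t) x =
        lincomb X n phi x - lincomb X n b x.
      by rewrite /lincomb -sumrB; apply: eq_bigr => l _; rewrite mulrBl.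
    by congr ip; apply/funext => x; rewrite LB; ring.
  rewrite ip_sqD//; last exact: lincombL2.
  suff -> : ip P (fun x => X tau x - lincomb X n phi x)
      (lincomb X n (fun t => phi t - b t)) = 0 by rewrite mulr0 addr0.
  rewrite ipC ip_suml//; last by move=> l; exact: L2Z (XL2 _).
  rewrite big_nat big1// => l ln; rewrite ipZl//; last exact: XL2.
  rewrite ipC ipBl; [|exact: XL2|exact: lincombL2|exact: XL2].
  by rewrite ip_lincomb ipX -/(toeplitz c n phi l) phiE// subrr mulr0.
have best b : best_linear_predictor X n tau b <-> forall b', Q b <= Q b'.
  by split => h b'; have := h b'; rewrite !E_sq// lee_fin.
have phibest : best_linear_predictor X n tau phi.
  apply/best => b; rewrite (QE b) lerDl -ip_lincomb_sq; exact: ip_ge0.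
have /best/(_ phi) : best_linear_predictor X n tau (blp_coef X n tau).
  by apply: (@xgetPex _ (fun=> 0) [set b | best_linear_predictor X n tau b]); exists phi.
rewrite QE gerDl => le0.
have := le_trans (cm n (fun t => phi t - blp_coef X n tau t)) le0.
rewrite pmulr_rle0// => sq0.
rewrite -phiE//; apply: eq_big_nat => l ln; congr (_ * _).
apply/esym/subr0_eq/eqP; rewrite -sqrf_eq0 eq_le sqr_ge0 andbT.
exact: le_trans (sumsq_ge (fun t => phi t - blp_coef X n tau t) ln) sq0.
Qed.

End SecondOrder.

(** * The autoregressive representation *)

Section Autoregression.
Context {d : measure_display} {T : measurableType d} {R : realType}.
Variables (P : probability T R) (X : int -> {RV P >-> R}).
Hypotheses (X0 : mean_zero X) (Xss : second_order_stationary X).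

Let c := autocov X.
Let XL2 t : L2 P (X t) := XL2 Xss t.

Definition ar_sum (a : nat -> R) (t : int) m (x : T) : R :=
  \sum_(1 <= j < m.+1) a j * X (t - j%:Z) x.

Lemma ar_sumL2 a t m : L2 P (ar_sum a t m).
Proof. by apply: L2_sum => j; exact: L2Z (XL2 _). Qed.

Lemma ip_ar_sum a t m s : ip P (ar_sum a t m) (X s) =
  \sum_(1 <= j < m.+1) a j * c (t - s - j%:Z).
Proof.
rewrite ip_suml//; last by move=> j; exact: L2Z (XL2 _).
apply: eq_bigr => j _; rewrite ipZl// ipX// -(autocov_even X0 Xss).
by congr (_ * c _); ring.
Qed.

Lemma mean_X t : mean P (X t) = 0.
Proof. by rewrite /mean X0. Qed.

Lemma RV_of_measurable (f : T -> R) : measurable_fun setT f ->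
  exists g : {RV P >-> R}, g = f :> (T -> R).
Proof. by move=> mf; exists (mfun_Sub (mem_set mf)). Qed.

Lemma cvg_E_sq (u : nat -> T -> R) : (forall n, L2 P (u n)) ->
  ip P (u n) (u n) @[n --> \oo] --> 0 ->
  'E_P[fun x => (u n x ^+ 2)%R]%E @[n --> \oo] --> 0%E.
Proof.
move=> u2 u0; under eq_fun do rewrite E_sq//.
by apply: cvg_EFin => //; exact: nearW.
Qed.

(** The innovation is X_t minus the mean-square limit of the autoregressive sums; the
Yule-Walker equations say that it is orthogonal to every X_s with s < t, and
hence to the earlier innovations. *)
Lemma ar_representation_exists (a : nat -> R) (B : R) :
  (forall n, \sum_(1 <= l < n.+1) `|a l| <= B) -> yule_walker c a ->
  ar_representation X a.
Proof.
move=> aB aYW.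
have aB0 n : \sum_(0 <= j < n) `|a j.+1| <= B by rewrite -(big_add1 _ _ 0 n.+1 xpredT (fun j => `|a j|)).
have XC t : ip P (X t) (X t) <= c 0 by rewrite ipX// subrr.
have /choice[Y YP] t : exists Y : T -> R, L2 P Y /\
    ip P (fun x => Y x - ar_sum a t n x) (fun x => Y x - ar_sum a t n x)
      @[n --> \oo] --> 0.
  have [Y [Y2 Ycvg]] := L2_series (u := fun j => X (t - j.+1%:Z) : T -> R)
     (fun j => XL2 _) (fun j => XC _) aB0.
  exists Y; split => //; move: Ycvg; under [X in X @ _ --> _ -> _]eq_fun.
    move=> n; under eq_fun.
      move=> x; rewrite -(big_add1 _ _ 0 n.+1 xpredT (fun j => a j * X (t - j%:Z) x)).
      over.
    over.
  by [].
have Y2 t : L2 P (Y t) by case: (YP t).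
pose q t n x := Y t x - ar_sum a t n x.
have q2 t n : L2 P (q t n) by apply: L2B => //; exact: ar_sumL2.
have qip t g : L2 P g -> ip P (q t n) g @[n --> \oo] --> 0.
  by move=> g2; apply: ip_cvg0 => //; case: (YP t).
pose e t x := X t x - Y t x.
have e2 t : L2 P (e t) by exact: L2B.
have eq t n x : e t x = X t x - ar_sum a t n x - q t n x by rewrite /e /q; ring.
have /choice[eps epsE] t := RV_of_measurable (e2 t).1.
have ip_e t g : L2 P g ->
    ip P (fun x => X t x - ar_sum a t n x) g @[n --> \oo] --> 0 ->
    ip P (e t) g = 0.
  move=> g2 lim.
  have h : ip P (e t) g @[n --> \oo] --> (0 : R).
    rewrite -[X in _ --> X](subr0 0).
    rewrite (_ : (fun=> _) = (fun n => ip P (fun x => X t x - ar_sum a t n x) g -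
        ip P (q t n) g)); first exact: cvgB lim (qip t g g2).
    apply/funext => n; rewrite -ipBl//; last first.
      by apply: L2B => //; exact: ar_sumL2.
    by congr ip; apply/funext => x; exact: eq.
  by rewrite -(cvg_lim _ h)// lim_cst.
have ip_eX t s : (s < t)%R -> ip P (e t) (X s) = 0.
  move=> st; apply: ip_e => //.
  have [i tsi i1] : exists2 i : nat, t - s = i%:Z & (1 <= i)%N.
    by exists `|t - s|%N; lia.
  have : c i%:Z - toeplitz c n a i @[n --> \oo] --> 0.
    by rewrite -(subrr (c i%:Z)); apply: cvgB; [exact: cvg_cst|exact: aYW].
  apply: cvg_seq_ext => n.
  rewrite ipBl//; last exact: ar_sumL2.
  rewrite ip_ar_sum ipX// -(autocov_even X0 Xss) opprB tsi; congr (_ - _).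
  by apply: eq_bigr => l _; rewrite mulrC.
have ex_e t : 'E_P[e t]%E = 0%E.
  rewrite mean_EFin; last exact: L2_L1.
  have -> : mean P (e t) = ip P (e t) (fun=> 1).
    by congr mean; apply/funext => x; rewrite mulr1.
  rewrite ip_e//; first exact: L2_cst.
  rewrite (_ : (fun n => _) = (fun=> 0)); first exact: cvg_cst.
  apply/funext => n; rewrite ipBl//; [|exact: ar_sumL2|exact: L2_cst].
  rewrite ip_suml; [|by move=> j; exact: L2Z (XL2 _)|exact: L2_cst].
  have X1 s : ip P (X s) (fun=> 1) = 0.
    by rewrite -(mean_X s); congr mean; apply/funext => x; rewrite mulr1.
  rewrite X1 big1 ?subrr// => j _; rewrite ipZl ?X1 ?mulr0//; exact: L2_cst.
have ip_ee t s : (s < t)%R -> ip P (e s) (e t) = 0.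
  move=> st; apply: ip_e => //.
  rewrite (_ : (fun n => _) = (fun=> 0)); first exact: cvg_cst.
  apply/funext => n; rewrite ipBl//; last exact: ar_sumL2.
  rewrite ip_suml//; last by move=> j; exact: L2Z (XL2 _).
  rewrite ipC ip_eX// big_nat big1 ?subrr// => j /andP[j1 _].
  by rewrite ipZl// ipC ip_eX ?mulr0//; lia.
split.
  apply: (@bounded_series_cvg _ _ B) => n.
  by under eq_bigr do rewrite normr_id.
exists eps; split.
- move=> t; rewrite epsE; split.
  + by rewrite E_sq// ltry.
  + move=> eta eta0; have /cvgrPdist_lt/(_ _ eta0)[m _ mP] := (YP t).2.
    exists m, a; have := mP m (leqnn m).
    rewrite sub0r normrN ger0_norm ?ip_ge0// => h.
    rewrite (_ : (fun x => _) = (fun x => (q t m x ^+ 2)%R)).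
      by rewrite E_sq// lte_fin.
    by apply/funext => x; rewrite /q /e /ar_sum; congr (_ ^+ 2); ring.
  + by move=> s st; rewrite covariance_ip// ip_eX.
- move=> s t st; rewrite !epsE covariance_ip//.
  have [lt|lt|e0] := ltgtP s t; first by rewrite ip_ee.
    by rewrite ipC ip_ee.
  by rewrite e0 eqxx in st.
- move=> t; have := cvg_E_sq (q2 t) (YP t).2; apply: cvg_seq_ext => m; congr expectation; apply/funext => x.
  by rewrite epsE /q /e /ar_sum; congr (_ ^+ 2); ring.
Qed.

(** Take the inner product of the representation of X_0 with X_(-i). *)
Lemma ar_representation_yule_walker (a : nat -> R) :
  ar_representation X a ->
  yule_walker c a /\ exists B, forall n, \sum_(1 <= l < n.+1) `|a l| <= B.
Proof.
move=> [acvg [eps [einn eunc ecvg]]]; split; last first.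
  exists (limn (series (fun j => `|a j.+1|))) => n.
  rewrite big_add1 /=.
  have := nondecreasing_cvgn_le _ acvg n; rewrite seriesEnat /=; apply.
  by apply: nondecreasing_series => j _ _; exact: normr_ge0.
move=> i i1; have [e2 _ eX] := einn 0.
have eL2 : L2 P (eps 0).
  split; first exact: measurable_funP.
  apply: L1_ge0 => //; first exact: measurable_funX.
  by move=> x; rewrite sqr_ge0.
pose r m x := X 0 x - (ar_sum a 0 m x + eps 0 x).
have r2 m : L2 P (r m) by apply: L2B => //; apply: L2D => //; exact: ar_sumL2.
have rcvg : ip P (r m) (r m) @[m --> \oo] --> 0.
  have := ecvg 0 => /fine_cvgP[_].
  apply: cvg_seq_ext => m /=.
  by rewrite -[LHS]/(fine 'E_P[fun x => (r m x ^+ 2)%R]) E_sq.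
have := ip_cvg0 r2 (XL2 (- i%:Z)) rcvg.
have ip0 : ip P (eps 0) (X (- i%:Z)) = 0.
  by apply: EFin_inj; rewrite -covariance_ip// eX//; lia.
move=> h; rewrite -[X in _ --> X]subr0.
have : c i%:Z - ip P (r m) (X (- i%:Z)) @[m --> \oo] --> c i%:Z - 0.
  by apply: cvgB => //; exact: cvg_cst.
apply: cvg_seq_ext => m.
rewrite ipBl//; last by apply: L2D => //; exact: ar_sumL2.
rewrite ipDl//; last exact: ar_sumL2.
rewrite ip0 addr0 ipX// ip_ar_sum subr0 (autocov_even X0 Xss) subKr /toeplitz.
by apply: eq_bigr => l _; rewrite mulrC sub0r opprK.
Qed.

End Autoregression.

(** * Set partitions of four points *)

Section PartitionsOfFour.

Let o0 : 'I_4 := @Ordinal 4 0 isT.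
Let o1 : 'I_4 := @Ordinal 4 1 isT.
Let o2 : 'I_4 := @Ordinal 4 2 isT.
Let o3 : 'I_4 := @Ordinal 4 3 isT.

Lemma ord4P (i : 'I_4) : [\/ i = o0, i = o1, i = o2 | i = o3].
Proof.
by case: i => -[|[|[|[|//]]]] h; [apply: Or41|apply: Or42|apply: Or43|apply: Or44];
  apply/val_inj.
Qed.

Section Blocks.
Variable Q : {set {set 'I_4}}.
Hypothesis Qpart : finset.partition Q [set: 'I_4]%SET.

Let e i j := j \in finset.pblock Q i.

Let trivQ : finset.trivIset Q. Proof. by case/and3P: Qpart. Qed.

Let inQ i : i \in finset.cover Q.
Proof. by case/and3P: Qpart => /eqP ->; rewrite finset.in_setT. Qed.

Lemma same_blockE i j : e i j = (finset.pblock Q i == finset.pblock Q j).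
Proof. by rewrite eq_pblock. Qed.

Lemma one_block : (forall i, e o0 i) -> Q = [set [set: 'I_4]]%SET.
Proof.
move=> all0; have p0 : finset.pblock Q o0 = [set: 'I_4]%SET.
  by apply/finset.setP => i; rewrite finset.in_setT; exact: all0.
apply/finset.setP => D; rewrite finset.in_set1; apply/idP/eqP => [DQ|->]; last first.
  by rewrite -p0 pblock_mem.
have /finset.set0Pn[x xD] : D != finset.set0.
  by apply: contraTneq DQ => ->; case/and3P: Qpart.
by rewrite -(def_pblock trivQ DQ xD) -p0; apply/eqP; rewrite eq_sym -same_blockE.
Qed.

(** a, b, c enumerate the points other than 0, so the blocks are {0, a} and {b, c}. *)
Lemma two_blocks a b c :
  (forall i, [\/ i = o0, i = a, i = b | i = c]) ->
  e o0 a -> e b c -> ~~ e o0 b -> Q = [set [set o0; a]; ~: [set o0; a]]%SET.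
Proof.
move=> ex; rewrite !same_blockE => /eqP e0a /eqP ebc e0b.
have b0 : (b == o0) = false by apply: contraNF e0b => /eqP ->.
have ba : (b == a) = false by apply: contraNF e0b => /eqP ->; rewrite e0a.
have c0 : (c == o0) = false.
  by apply: contraNF e0b => /eqP c0; rewrite ebc c0.
have ca : (c == a) = false.
  by apply: contraNF e0b => /eqP ca; rewrite ebc ca e0a.
have p0 : finset.pblock Q o0 = [set o0; a]%SET.
  apply/finset.setP => i; rewrite -[LHS]/(e o0 i) same_blockE !finset.inE.
  by case: (ex i) => ->; rewrite ?eqxx ?orbT// ?e0a ?eqxx ?b0 ?ba ?c0 ?ca// -?ebc -?e0a;
    apply/negbTE.
have pb : finset.pblock Q b = (~: [set o0; a])%SET.
  apply/finset.setP => i; rewrite -[LHS]/(e b i) same_blockE !finset.inE.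
  case: (ex i) => ->; rewrite ?eqxx ?orbT// -?e0a -?ebc ?b0 ?ba ?c0 ?ca ?eqxx//;
    by apply/negbTE; rewrite eq_sym.
apply/finset.setP => D; rewrite !finset.inE; apply/idP/orP => [DQ|[] /eqP ->]; last 2 first.
- by rewrite -p0 pblock_mem.
- by rewrite -pb pblock_mem.
have /finset.set0Pn[x xD] : D != finset.set0.
  by apply: contraTneq DQ => ->; case/and3P: Qpart.
rewrite -(def_pblock trivQ DQ xD) -pb -p0.
case: (ex x) => ->; rewrite ?eqxx -?e0a -?ebc ?eqxx; [by left|by left|by right|by right].
Qed.

Lemma pair_partition a b c :
  (forall i, [\/ i = o0, i = a, i = b | i = c]) ->
  (forall i, finset.set1 i \notin Q) -> e o0 a ->
  Q = [set [set: 'I_4]]%SET \/ Q = [set [set o0; a]; ~: [set o0; a]]%SET.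
Proof.
move=> ex ns e0a.
have other i : exists2 j, j != i & e i j.
  have : finset.pblock Q i != finset.set1 i.
    by apply: contraNneq (ns i) => <-; rewrite pblock_mem.
  rewrite finset.eqEsubset finset.sub1set finset.mem_pblock inQ andbT => /subsetPn[j ji].
  by rewrite finset.in_set1 => ?; exists j.
have eall : e o0 b -> e o0 c -> Q = [set [set: 'I_4]]%SET.
  move=> e0b e0c; apply: one_block => i.
  by case: (ex i) => -> //; rewrite same_blockE.
have [e0b|e0b] := boolP (e o0 b).
  left; apply: eall => //.
  have [j jc] := other c; rewrite !same_blockE in e0a e0b *; move/eqP => ecj.
  case: (ex j) jc ecj => ->; rewrite ?eqxx// => _ ->//.
have [j jb] := other b => ebj.
case: (ex j) jb ebj => ->; rewrite ?eqxx// => _ ebj.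
- by move: e0b; rewrite same_blockE eq_sym -same_blockE ebj.
- by move: e0b; rewrite !same_blockE in ebj e0a *; rewrite (eqP ebj) (eqP e0a) eqxx.
- by right; apply: (two_blocks ex).
Qed.

(** Without singletons, 0 shares its block with some a. The other two points then
share a block: either with 0 and a, or on their own. *)
Lemma partition4 : (forall i, finset.set1 i \notin Q) ->
  [\/ Q = [set [set: 'I_4]]%SET, Q = [set [set o0; o1]; ~: [set o0; o1]]%SET,
     Q = [set [set o0; o2]; ~: [set o0; o2]]%SET |
     Q = [set [set o0; o3]; ~: [set o0; o3]]%SET].
Proof.
move=> ns.
have [j j0 e0j] : exists2 j, j != o0 & e o0 j.
  have : finset.pblock Q o0 != finset.set1 o0.
    by apply: contraNneq (ns o0) => <-; rewrite pblock_mem.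
  rewrite finset.eqEsubset finset.sub1set finset.mem_pblock inQ andbT => /subsetPn[j ji].
  by rewrite finset.in_set1 => ?; exists j.
case: (ord4P j) j0 e0j => ->; rewrite ?eqxx// => _ e0j.
- by case: (pair_partition ord4P ns e0j) => ->; [exact: Or41|exact: Or42].
- have ex i : [\/ i = o0, i = o2, i = o1 | i = o3].
    by case: (ord4P i); [apply: Or41|apply: Or43|apply: Or42|apply: Or44].
  by case: (pair_partition ex ns e0j) => ->; [exact: Or41|exact: Or43].
- have ex i : [\/ i = o0, i = o3, i = o1 | i = o2].
    by case: (ord4P i); [apply: Or41|apply: Or43|apply: Or44|apply: Or42].
  by case: (pair_partition ex ns e0j) => ->; [exact: Or41|exact: Or44].
Qed.

End Blocks.

Lemma partition_whole : finset.partition [set [set: 'I_4]]%SET [set: 'I_4]%SET.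
Proof.
apply/and3P; split.
- by rewrite finset.cover1.
- exact: finset.trivIset1.
- rewrite finset.in_set1 eq_sym; apply/finset.set0Pn.
  by exists o0; rewrite finset.in_setT.
Qed.

Lemma partition_compl (B : {set 'I_4}) : B != finset.set0 ->
  (~: B)%SET != finset.set0 ->
  finset.partition [set B; ~: B]%SET [set: 'I_4]%SET.
Proof.
move=> B0 C0; apply/and3P; split.
- rewrite /finset.cover finset.bigcup_setU !big_set1.
  by rewrite finset.setUCr.
- apply/finset.trivIsetP => C D; rewrite !finset.inE.
  move=> /orP[]/eqP -> /orP[]/eqP ->; rewrite ?eqxx//= => _.
    by rewrite -setI_eq0 finset.setICr.
  by rewrite -setI_eq0 finset.setIC finset.setICr.
- by rewrite !finset.inE negb_or eq_sym B0 eq_sym C0.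
Qed.

Lemma sum_partition4 (R : realType) (F : {set {set 'I_4}} -> R) :
  (forall (Q : {set {set 'I_4}}) i, finset.set1 i \in Q -> F Q = 0) ->
  \sum_(Q : {set {set 'I_4}} | finset.partition Q [set: 'I_4]%SET) F Q =
  F [set [set: 'I_4]]%SET + F [set [set o0; o1]; ~: [set o0; o1]]%SET +
  F [set [set o0; o2]; ~: [set o0; o2]]%SET +
  F [set [set o0; o3]; ~: [set o0; o3]]%SET.
Proof.
move=> F0.
pose Q2 a : {set {set 'I_4}} := [set [set o0; a]; ~: [set o0; a]]%SET.
have part2 a b : b != o0 -> b != a -> finset.partition (Q2 a) [set: 'I_4]%SET.
  move=> b0 ba; apply: partition_compl; apply/finset.set0Pn.
    by exists o0; rewrite !finset.inE.
  by exists b; rewrite !finset.inE negb_or b0 ba.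
have Q2inj a b : a != o0 -> a != b -> Q2 a != Q2 b.
  move=> a0 ab; apply/eqP => /finset.setP/(_ [set o0; a]%SET).
  rewrite !finset.inE eqxx /= => /esym/orP[]/eqP/finset.setP.
    by move=> /(_ a); rewrite !finset.inE eqxx orbT (negbTE a0) (negbTE ab).
  by move=> /(_ o0); rewrite !finset.inE eqxx.
have Q1neq a b : b != o0 -> b != a -> Q2 a != [set [set: 'I_4]]%SET.
  move=> b0 ba; apply/eqP => /finset.setP/(_ [set o0; a]%SET).
  rewrite !finset.inE eqxx /= => /esym/eqP/finset.setP/(_ b).
  by rewrite !finset.inE (negbTE b0) (negbTE ba).
rewrite (bigD1 [set [set: 'I_4]]%SET) ?partition_whole//=.
rewrite (bigD1 (Q2 o1)) ?(part2 _ o2) ?(Q1neq _ o2)//=.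
rewrite (bigD1 (Q2 o2)) ?(part2 _ o1) ?(Q1neq _ o1) ?Q2inj//=.
rewrite (bigD1 (Q2 o3)) ?(part2 _ o1) ?(Q1neq _ o1) ?Q2inj//=.
rewrite [X in _ + (_ + (_ + (_ + X)))]big1 ?addr0 ?addrA// => Q.
move=> /andP[/andP[/andP[/andP[Qp n1] n2] n3] n4].
have [/existsP[i iQ]|nQ] := boolP [exists i : 'I_4, finset.set1 i \in Q].
  exact: F0 iQ.
have ns i : finset.set1 i \notin Q by move: nQ; rewrite negb_exists => /forallP.
by case: (partition4 Qp ns) => e; rewrite e eqxx in n1 n2 n3 n4.
Qed.

End PartitionsOfFour.

(** * The fourth order cumulant of centred variables *)

Section Cumulants.
Context {d : measure_display} {T : measurableType d} {R : realType}.
Variable P : probability T R.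

Let o0 : 'I_4 := @Ordinal 4 0 isT.
Let o1 : 'I_4 := @Ordinal 4 1 isT.
Let o2 : 'I_4 := @Ordinal 4 2 isT.
Let o3 : 'I_4 := @Ordinal 4 3 isT.

(** A partition with a singleton block contributes a factor E Y_i = 0, which leaves
the one-block partition and the three pairings. *)
Lemma cumulant4E (Y : 'I_4 -> T -> R) : (forall i, 'E_P[Y i] = 0)%E ->
  cumulant P Y = mean P (fun x => Y o0 x * Y o1 x * (Y o2 x * Y o3 x)) -
    ip P (Y o0) (Y o1) * ip P (Y o2) (Y o3) -
    ip P (Y o0) (Y o2) * ip P (Y o1) (Y o3) -
    ip P (Y o0) (Y o3) * ip P (Y o1) (Y o2).
Proof.
move=> Y0.
pose mom (B : {set 'I_4}) : R := fine 'E_P[fun x => (\prod_(i in B) Y i x)%R]%E.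
have mom1 i : mom (finset.set1 i) = 0.
  rewrite /mom (_ : (fun x => _) = Y i) ?Y0//.
  by apply/funext => x; rewrite big_set1.
have mom2 (a b : 'I_4) : a != b -> mom [set a; b]%SET = ip P (Y a) (Y b).
  move=> ab; congr (fine _); congr expectation; apply/funext => x.
  by rewrite big_setU1 ?finset.inE//= big_set1.
have part2 (B : {set 'I_4}) : B != (~: B)%SET ->
    (-1) ^+ #|[set B; ~: B]%SET|.-1 * (#|[set B; ~: B]%SET|.-1)`!%:R *
    \prod_(C in [set B; ~: B]%SET) mom C = - (mom B * mom (~: B)%SET).
  move=> BC; rewrite cards2 BC /= expr1 (_ : 1`! = 1%N)// mulr1 mulN1r.
  by rewrite big_setU1 ?finset.inE//= big_set1.
have neq (B : {set 'I_4}) : B != (~: B)%SET.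
  by apply/eqP => /finset.setP/(_ o0); rewrite finset.inE; case: (_ \in _).
rewrite /cumulant sum_partition4; last first.
  move=> Q i iQ; rewrite (bigD1 (finset.set1 i))//= -/(mom _) mom1.
  by rewrite mul0r mulr0.
have compl (a b c : 'I_4) : (~: [set o0; a])%SET = [set b; c]%SET ->
    mom (~: [set o0; a])%SET = mom [set b; c]%SET by move=> ->.
rewrite !(part2 _ (neq _)) cards1 /= fact0 expr0 !mul1r big_set1.
rewrite (compl o1 o2 o3); last first.
  by apply/finset.setP => i; case: (ord4P i) => ->; rewrite !finset.inE.
rewrite (compl o2 o1 o3); last first.
  by apply/finset.setP => i; case: (ord4P i) => ->; rewrite !finset.inE.
rewrite (compl o3 o1 o2); last first.
  by apply/finset.setP => i; case: (ord4P i) => ->; rewrite !finset.inE.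
rewrite !mom2//; congr (_ - _ - _ - _).
congr (fine _); congr expectation; apply/funext => x.
rewrite (eq_bigl xpredT); last by move=> i; rewrite finset.in_setT.
rewrite !big_ord_recl big_ord0 mulr1 mulrA.
by congr (_ * _ * (_ * _)); congr (Y _ x); apply/val_inj.
Qed.

End Cumulants.

(** * Variance of a quadratic form in the observations *)

Section FourthOrder.
Context {d : measure_display} {T : measurableType d} {R : realType}.
Variables (P : probability T R) (X : int -> {RV P >-> R}).
Hypotheses (X0 : mean_zero X) (Xss : second_order_stationary X).
Hypotheses (Xfs : fourth_order_stationary X)
  (X4 : forall t, ('E_P[fun x => (`|X t x| ^+ 4)%R] < +oo)%E).

Let c := autocov X.

Lemma XX2 s t : L2 P (fun x => X s x * X t x).
Proof.
have m s' : measurable_fun setT (X s') by exact: measurable_funP.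
have L4 s' : L1 P (fun x => `|X s' x| ^+ 4).
  apply: L1_ge0 => //.
  by apply: measurable_funX; exact: measurableT_comp.
split; first exact: measurable_funM.
apply: L1_le (L1D (L4 s) (L4 t)).
  by apply: measurable_funX; exact: measurable_funM.
move=> x; rewrite ger0_norm ?sqr_ge0// exprMn.
rewrite -(real_normK (num_real (X s x))) -(real_normK (num_real (X t x))).
set a := `|X s x|; set b := `|X t x|.
have e4 (y : R) : y ^+ 4 = (y ^+ 2) ^+ 2 by rewrite -exprM.
rewrite !e4.
have := sqr_ge0 (a ^+ 2 - b ^+ 2); have := sqr_ge0 (a ^+ 2); have := sqr_ge0 (b ^+ 2).
set p := a ^+ 2; set r := b ^+ 2; nra.
Qed.

Definition mom4 s t u v : R :=
  mean P (fun x => X s x * X t x * (X u x * X v x)).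

Lemma mom4_shift h s t u v : mom4 (h + s) (h + t) (h + u) (h + v) = mom4 s t u v.
Proof.
have := Xfs (h := 4) (fun i => nth 0 [:: s; t; u; v] i) h isT.
move=> /(congr1 fine); rewrite -!/(mean P _) /mom4 => e.
have prodE (h' : int) : (fun x => \prod_(i < 4) X (h' + nth 0 [:: s; t; u; v] i) x) =
    (fun x => X (h' + s) x * X (h' + t) x * (X (h' + u) x * X (h' + v) x)).
  by apply/funext => x; rewrite !big_ord_recl big_ord0 mulr1 mulrA.
move: e; rewrite prodE => ->; congr mean.
by apply/funext => x; rewrite !big_ord_recl big_ord0 mulr1 mulrA.
Qed.

Lemma kappa4E h (a b e : int) : kappa (h := 4) X h [tuple a; b; e] =
  mom4 0 a b e - c a * c (e - b) - c b * c (e - a) - c e * c (b - a).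
Proof.
rewrite /kappa cumulant4E; last by move=> i; exact: X0.
have sub (p q : int) : h + p - (h + q) = p - q by ring.
rewrite /= !ipX// !sub !subr0.
by rewrite -(mom4_shift h) addr0.
Qed.

Definition cov4 (p r : nat * nat) : R :=
  ip P (fun x => X p.1%:Z x * X p.2%:Z x - c (p.2%:Z - p.1%:Z))
       (fun x => X r.1%:Z x * X r.2%:Z x - c (r.2%:Z - r.1%:Z)).

Lemma mean_XX s t : mean P (fun x => X s x * X t x) = c (t - s).
Proof. exact: ipX. Qed.

Lemma cov4E t s u v : cov4 (t, s) (u, v) =
  kappa (h := 4) X 0 [tuple s%:Z - t%:Z; u%:Z - t%:Z; v%:Z - t%:Z] +
  c (u%:Z - t%:Z) * c (v%:Z - s%:Z) + c (v%:Z - t%:Z) * c (u%:Z - s%:Z).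
Proof.
have cst1 (k : R) f : L2 P f -> ip P (fun=> k) f = k * mean P f.
  by move=> f2; rewrite /ip meanZ//; exact: L2_L1.
rewrite /cov4 /=; have h1 := XX2 t s; have h2 := XX2 u v.
rewrite ipBl//; [|exact: L2_cst|by apply: L2B => //; exact: L2_cst].
rewrite ipC ipBl//; [|exact: L2_cst].
rewrite !cst1//; last by apply: L2B => //; exact: L2_cst.
rewrite meanB; [|exact: L2_L1|exact: L1_cst].
rewrite mean_cst !mean_XX ipC -[ip _ _ _]/(mom4 t s u v).
rewrite kappa4E -(mom4_shift t%:Z 0) addr0 !(addrC t%:Z) !subrK.
have -> : v%:Z - t%:Z - (u%:Z - t%:Z) = v%:Z - u%:Z by ring.
have -> : v%:Z - t%:Z - (s%:Z - t%:Z) = v%:Z - s%:Z by ring.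
have -> : u%:Z - t%:Z - (s%:Z - t%:Z) = u%:Z - s%:Z by ring.
ring.
Qed.

Definition pairs n : seq (nat * nat) :=
  [seq (t, s) | t <- index_iota 1 n.+1, s <- index_iota 1 n.+1].

Lemma pairs_uniq n : uniq (pairs n).
Proof. by apply: allpairs_uniq; rewrite ?iota_uniq// => -[? ?] [? ?]. Qed.

Lemma sum_pairs {V : zmodType} n (F : nat * nat -> V) : \sum_(p <- pairs n) F p =
  \sum_(1 <= t < n.+1) \sum_(1 <= s < n.+1) F (t, s).
Proof. by rewrite big_allpairs. Qed.

(** By [cov4E] the covariance of two products is a cumulant plus two products of
autocovariances, each of them absolutely summable over the second pair. *)
Lemma cov4_row (S0 Sk : R) n p : l1_bounded c S0 ->
  l1_bounded (kappa (h := 4) X 0) Sk ->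
  \sum_(r <- pairs n) `|cov4 p r| <= Sk + 2 * S0 ^+ 2.
Proof.
move=> cS0 kSk; case: p => t s; have S00 := ge0_bound cS0.
have prod_le (t' s' : nat) : \sum_(1 <= u < n.+1) \sum_(1 <= v < n.+1)
    `|c (u%:Z - t'%:Z)| * `|c (v%:Z - s'%:Z)| <= S0 ^+ 2.
  under eq_bigr do rewrite -mulr_sumr; rewrite -mulr_suml expr2.
  by rewrite ler_pM ?sumr_ge0//; exact: l1_col.
apply: (@le_trans _ _ (\sum_(r <- pairs n)
   (`|kappa (h := 4) X 0 [tuple s%:Z - t%:Z; r.1%:Z - t%:Z; r.2%:Z - t%:Z]| +
    (`|c (r.1%:Z - t%:Z)| * `|c (r.2%:Z - s%:Z)| +
     `|c (r.2%:Z - t%:Z)| * `|c (r.1%:Z - s%:Z)|)))).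
  apply: ler_sum => -[u v] _; rewrite cov4E -!normrM.
  by rewrite -addrA (le_trans (ler_normD _ _))// lerD2l ler_normD.
rewrite big_split /= lerD//.
  apply: (l1_bounded_inj kSk (pairs_uniq n) (h := fun r : nat * nat =>
    [tuple s%:Z - t%:Z; r.1%:Z - t%:Z; r.2%:Z - t%:Z])).
  by move=> [u v] [u' v'] /(congr1 val) /= [] e1 e2; congr pair; lia.
rewrite sum_pairs /=; under eq_bigr do rewrite big_split /=.
rewrite big_split /= mulr_natl mulr2n lerD//.
by rewrite exchange_big.
Qed.

Lemma cov4C p r : cov4 p r = cov4 r p.
Proof. exact: ipC. Qed.

Definition quad n (q : nat * nat -> R) (x : T) : R :=
  \sum_(p <- pairs n) q p * (X p.1%:Z x * X p.2%:Z x).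

Lemma quadL2 n q : L2 P (quad n q).
Proof. by apply: L2_sum => p; exact: L2Z (XX2 _ _). Qed.

Lemma mean_quad n q : mean P (quad n q) = \sum_(p <- pairs n) q p * c (p.2%:Z - p.1%:Z).
Proof.
rewrite mean_sum; last by move=> p; apply: L1Z; exact: L2_L1 (XX2 _ _).
by apply: eq_bigr => p _; rewrite meanZ ?mean_XX//; exact: L2_L1 (XX2 _ _).
Qed.

(** The variance is the quadratic form of the matrix [cov4], which Schur's test
bounds by its row sums. *)
Lemma quad_variance (S0 Sk : R) n q : l1_bounded c S0 ->
  l1_bounded (kappa (h := 4) X 0) Sk ->
  mean P (fun x => (quad n q x - mean P (quad n q)) ^+ 2) <=
  (Sk + 2 * S0 ^+ 2) * \sum_(p <- pairs n) q p ^+ 2.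
Proof.
move=> cS0 kSk.
pose U p x := q p * (X p.1%:Z x * X p.2%:Z x - c (p.2%:Z - p.1%:Z)).
have D2 (p : nat * nat) : L2 P (fun x => X p.1%:Z x * X p.2%:Z x - c (p.2%:Z - p.1%:Z)).
  by apply: L2B; [exact: XX2|exact: L2_cst].
have U2 p : L2 P (U p) by exact: L2Z.
have -> : mean P (fun x => (quad n q x - mean P (quad n q)) ^+ 2) =
    \sum_(p <- pairs n) \sum_(r <- pairs n) q p * cov4 p r * q r.
  rewrite -ip_sq (_ : (fun x => _) = (fun x => \sum_(p <- pairs n) U p x)); last first.
    apply/funext => x; rewrite mean_quad -sumrB; apply: eq_bigr => p _.
    by rewrite /U mulrBr.
  rewrite ip_suml//; last exact: L2_sum.
  apply: eq_bigr => p _; rewrite ipC ip_suml//; apply: eq_bigr => r _.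
  rewrite ipZl// ipC ipZl// -/(cov4 p r); ring.
apply: (@le_trans _ _ (\sum_(p <- pairs n) \sum_(r <- pairs n)
    `|q p| * `|cov4 p r| * `|q r|)).
  apply: ler_sum => p _; apply: ler_sum => r _.
  by rewrite -!normrM ler_norm.
apply: (le_trans (schur_test _ _ (B := Sk + 2 * S0 ^+ 2) _ _)).
- by move=> p _; exact: cov4_row.
- move=> r _; under eq_bigr do rewrite cov4C; exact: cov4_row.
- by set S := \sum_(_ <- _) _; rewrite (_ : _ / 2 * (S + S) = (Sk + 2 * S0 ^+ 2) * S)//; field.
Qed.

End FourthOrder.

(** * The difference of the two predictive transforms *)

Lemma sum_rev {R : realType} n (F : nat -> R[i]) :
  \sum_(1 <= t < n.+1) F (n.+1 - t)%N = \sum_(1 <= t < n.+1) F t.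
Proof.
rewrite [RHS]big_nat_rev /=; apply: eq_big_nat => t tn.
by congr F; lia.
Qed.

Section Periodogram.
Context {d : measure_display} {T : measurableType d} {R : realType}.
Variables (P : probability T R) (X : int -> {RV P >-> R}).
Hypotheses (X0 : mean_zero X) (Xss : second_order_stationary X).

Let c := autocov X.
Let a := ar_coef X.

Variables (m S0 SK K A : R).
Hypotheses (K1 : 1 <= K) (m_gt0 : 0 < m) (cm : coercive c m).
Hypotheses (S0_gt0 : 0 < S0) (cS0 : l1_bounded c S0).
Hypotheses (SK_gt0 : 0 < SK).
Hypothesis cSK : l1_bounded (fun r => `|r%:~R| `^ K * c r) SK.
Hypotheses (A_gt0 : 0 < A).
Hypothesis aA : forall n, \sum_(1 <= l < n.+1) l%:R `^ K * `|a l| <= A.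
Hypothesis aYW : yule_walker c a.

Let blpE n tau t : (1 <= t < n.+1)%N ->
  toeplitz c n (blp_coef X n tau) t = c (t%:Z - tau).
Proof. exact: (blp_coef_normal X0 Xss tau m_gt0 cm). Qed.

Let c_even r : c (- r) = c r. Proof. exact: autocov_even. Qed.

Let z w l := ztail a w l.

Lemma ztail_is_csum w l : (0 < l)%N ->
  is_csum (fun s => (a (l + s))%:C * cis (- s%:R * w)) (z w l).
Proof.
move=> l0; apply: (@csummable_is_csum _ _ (A / l%:R `^ K)).
by apply: halfline_summable => n; exact: (weighted_sums _ (le_trans ler01 K1) l0 aA).
Qed.

Lemma ar_transferE w : ar_transfer X w = alpha a w.
Proof.
congr (_ - _); apply: is_csumP.
apply: is_csum_ext (is_csumZ (cis (- w)) (ztail_is_csum w (ltn0Sn 0))) => k.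
by rewrite mulrCA -cisD; congr (_ * cis _); rewrite -natr1; ring.
Qed.

Lemma forward_csum w l : (0 < l)%N ->
  cseries (fun s => (a (l + s))%:C * cis (s.+1%:R * w)) = cis w * (z w l)^*.
Proof.
move=> l0; apply: is_csumP.
apply: is_csum_ext (is_csumZ (cis w) (is_csum_conj (ztail_is_csum w l0))) => k.
rewrite conj_realcis mulrCA -cisD; congr (_ * cis _).
by rewrite -natr1; ring.
Qed.

(** The finite-sample counterpart of [ztail] divided by [alpha]. *)
Definition ypred n w t : R[i] :=
  cseries (fun k => (blp_coef X n (- k%:Z) t)%:C * cis (- k%:R * w)).

Lemma ypred_is_csum n w t : (1 <= t < n.+1)%N ->
  is_csum (fun k => (blp_coef X n (- k%:Z) t)%:C * cis (- k%:R * w))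
    (ypred n w t).
Proof.
move=> tn.
apply: (@csummable_is_csum _ _ (inv_l1_cst m SK * (S0 *+ n))).
apply: (halfline_summable (b := fun k => blp_coef X n (- k%:Z) t)) => N.
apply: (@le_trans _ _ (\sum_(0 <= k < N) inv_l1_cst m SK *
    \sum_(1 <= s < n.+1) `|c (s%:Z + k%:Z)|)).
  apply: ler_sum => k _.
  apply: (@le_trans _ _ (\sum_(1 <= s < n.+1) `|blp_coef X n (- k%:Z) s|)).
    by rewrite (bigD1_seq t) ?mem_index_iota ?iota_uniq//= lerDl sumr_ge0.
  apply: (inv_l1 m_gt0 cm SK_gt0 (l1_bounded_moment1 K1 cSK)) => s sn.
  by rewrite blpE// opprK.
rewrite -mulr_sumr ler_wpM2l ?inv_l1_cst_ge0// exchange_big /=.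
apply: (@le_trans _ _ (\sum_(1 <= s < n.+1) S0)).
  apply: ler_sum => s _.
  by apply: (l1_bounded_inj cS0 (iota_uniq _ _) (h := fun k : nat => s%:Z + k%:Z)) => i j /=; lia.
by rewrite sumr_const_nat subSS subn0.
Qed.

Lemma ypred_normal n w t : (1 <= t < n.+1)%N ->
  \sum_(1 <= l < n.+1) (c (t%:Z - l%:Z))%:C * ypred n w l = gtail c w t.
Proof.
move=> tn; apply/esym/is_csumP.
apply: (@is_csum_ext _ (fun k => \sum_(l <- index_iota 1 n.+1)
    (c (t%:Z - l%:Z))%:C * ((blp_coef X n (- k%:Z) l)%:C * cis (- k%:R * w)))).
  move=> k; have := blpE (- k%:Z) tn; rewrite opprK -PoszD => <-.
  rewrite /toeplitz rmorph_sum mulr_suml; apply: eq_bigr => l _.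
  by rewrite rmorphM mulrA.
apply: is_csum_sum => l; rewrite mem_index_iota => ln.
by apply: is_csumZ; exact: ypred_is_csum.
Qed.

(** c is even, so reversing the observations turns the normal equations for a
future value into those for a past one. *)
Lemma blp_coef_rev n k t : (1 <= t < n.+1)%N ->
  blp_coef X n (n.+1 + k)%N%:Z t = blp_coef X n (- k%:Z) (n.+1 - t)%N.
Proof.
apply: (toeplitz_inj m_gt0 cm (y := fun t => blp_coef X n (- k%:Z) (n.+1 - t)%N)).
move=> {}t tn; rewrite blpE//.
have -> : toeplitz c n (fun t => blp_coef X n (- k%:Z) (n.+1 - t)%N) t =
    toeplitz c n (blp_coef X n (- k%:Z)) (n.+1 - t)%N.
  rewrite /toeplitz [LHS]big_nat_rev /=.
  rewrite big_nat [RHS]big_nat; apply: eq_bigr => l ln.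
  have -> : (1 + n.+1 - l.+1 = n.+1 - l)%N by lia.
  have -> : (n.+1 - (n.+1 - l) = l)%N by lia.
  rewrite -c_even; congr (c _ * _); lia.
rewrite blpE; last by lia.
rewrite -c_even; congr (c _); lia.
Qed.

Lemma predictor_left n w x :
  cseries (fun k => (predictor X n (- k%:Z) x)%:C * cis (- k%:R * w)) =
  \sum_(1 <= t < n.+1) (X t%:Z x)%:C * ypred n w t.
Proof.
apply: is_csumP.
apply: (@is_csum_ext _ (fun k => \sum_(t <- index_iota 1 n.+1)
    (X t%:Z x)%:C * ((blp_coef X n (- k%:Z) t)%:C * cis (- k%:R * w)))).
  move=> k; rewrite /predictor /lincomb rmorph_sum mulr_suml; apply: eq_bigr => l _.
  by rewrite rmorphM mulrA [(_)%:C * (_)%:C]mulrC.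
apply: is_csum_sum => l; rewrite mem_index_iota => ln.
by apply: is_csumZ; exact: ypred_is_csum.
Qed.

Lemma predictor_right n w x :
  cseries (fun k => (predictor X n (n.+1 + k)%:Z x)%:C * cis ((n.+1 + k)%:R * w)) =
  \sum_(1 <= t < n.+1) (X t%:Z x)%:C * (cis (n.+1%:R * w) * (ypred n w (n.+1 - t)%N)^*).
Proof.
apply: is_csumP.
apply: (@is_csum_ext _ (fun k => \sum_(t <- index_iota 1 n.+1)
    (X t%:Z x)%:C * (cis (n.+1%:R * w) *
      ((blp_coef X n (- k%:Z) (n.+1 - t)%N)%:C * cis (- k%:R * w))^*))).
  move=> k; rewrite /predictor /lincomb rmorph_sum mulr_suml.
  rewrite big_nat [RHS]big_nat; apply: eq_bigr => t tn.
  rewrite conj_realcis blp_coef_rev// rmorphM.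
  rewrite natrD mulrDl cisD mulNr opprK; ring.
apply: is_csum_sum => l; rewrite mem_index_iota => ln.
apply: is_csumZ; apply: is_csumZ; apply: is_csum_conj; apply: ypred_is_csum.
lia.
Qed.

Definition derr n w t : R[i] := z w t / alpha a w - ypred n w t.

(** The error in the weight of X_t. The second term comes from the prediction of
X_(n+1), X_(n+2), ..., which is the mirror image of the first. *)
Definition Derr n w t : R[i] :=
  derr n w t + cis (n.+1%:R * w) * (derr n w (n.+1 - t)%N)^*.

Lemma predictive_DFT_diff n w x :
  predictive_DFT_inf X n w x - predictive_DFT X n w x =
  ((Num.sqrt n%:R)^-1)%:C * \sum_(1 <= t < n.+1) (X t%:Z x)%:C * Derr n w t.
Proof.
rewrite /predictive_DFT predictor_left predictor_right.
have -> : predictive_DFT_inf X n w x = ((Num.sqrt n%:R)^-1)%:C *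
   (\sum_(1 <= t < n.+1) (X t%:Z x)%:C * (z w t / alpha a w) +
    \sum_(1 <= t < n.+1) (X t%:Z x)%:C *
      (cis (n.+1%:R * w) * (z w (n.+1 - t)%N / alpha a w)^*)).
  rewrite /predictive_DFT_inf ar_transferE mulrDr; congr (_ + _).
    rewrite -mulrA; congr (_ * _); rewrite mulr_sumr; apply: eq_bigr => t _.
    by rewrite mulrCA [_^-1 * _]mulrC.
  rewrite -(sum_rev n (fun t => (X t%:Z x)%:C * _)).
  rewrite !mulr_sumr; apply: eq_big_nat => t tn.
  have -> : (n.+1 - (n.+1 - t) = t)%N by lia.
  rewrite forward_csum; last by lia.
  have -> : n.+1%:R * w = n%:R * w + w by rewrite -natr1; ring.
  rewrite cisD conjcM conjcV; ring.
rewrite -mulrDr -mulrBr; congr (_ * _).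
rewrite -!big_split /= -sumrB; apply: eq_bigr => t _.
rewrite /Derr /derr conjcB; ring.
Qed.

Lemma Derr_l2 n w : (0 < n)%N ->
  \sum_(1 <= t < n.+1) normc (Derr n w t) ^+ 2 <=
  4 * section_cst m S0 SK A * (n%:R * (n%:R `^ (- K)) ^+ 2).
Proof.
move=> n0.
have h := finite_section_error K1 m_gt0 cm S0_gt0 cS0 SK_gt0 cSK A_gt0 aA aYW n0
   (fun t tn => ypred_normal w tn).
have : \sum_(1 <= t < n.+1) normc (Derr n w t) ^+ 2 <=
  2 * \sum_(1 <= t < n.+1) normc (derr n w t) ^+ 2 +
  2 * \sum_(1 <= t < n.+1) normc (derr n w (n.+1 - t)%N) ^+ 2.
  apply: (@le_trans _ _ (\sum_(1 <= t < n.+1) (2 * normc (derr n w t) ^+ 2 +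
      2 * normc (derr n w (n.+1 - t)%N) ^+ 2))).
    apply: ler_sum => t _; apply: (le_trans (sqr_normcD _ _)).
    by rewrite Normc.normcM normc_cis mul1r normc_conj.
  by rewrite big_split -!mulr_sumr.
have -> : \sum_(1 <= t < n.+1) normc (derr n w (n.+1 - t)%N) ^+ 2 =
   \sum_(1 <= t < n.+1) normc (derr n w t) ^+ 2.
  rewrite [RHS]big_nat_rev /=; apply: eq_big_nat => t tn.
  by congr (normc (derr n w _) ^+ 2); lia.
rewrite -/(derr n w _) in h; move: h.
set s := \sum_(_ <= _ < _) _; set u := section_cst _ _ _ _ * _.
rewrite -[_ * section_cst _ _ _ _ * _]mulrA -/u; lra.
Qed.

End Periodogram.

(** * Mean and variance of the error *)

Section ErrorMoments.
Context {d : measure_display} {T : measurableType d} {R : realType}.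
Variables (P : probability T R) (X : int -> {RV P >-> R}).
Hypotheses (X0 : mean_zero X) (Xss : second_order_stationary X).
Hypotheses (Xfs : fourth_order_stationary X)
  (X4 : forall t, ('E_P[fun x => (`|X t x| ^+ 4)%R] < +oo)%E).

Let c := autocov X.

Definition cquad n (q : nat * nat -> R[i]) (x : T) : R[i] :=
  \sum_(p <- pairs n) (X p.1%:Z x * X p.2%:Z x)%:C * q p.

Lemma Re_cquad n q x : Re (cquad n q x) = quad X n (fun p => Re (q p)) x.
Proof. by rewrite Re_sum; apply: eq_bigr => p _; rewrite Re_realM mulrC. Qed.

Lemma Im_cquad n q x : Im (cquad n q x) = quad X n (fun p => Im (q p)) x.
Proof. by rewrite Im_sum; apply: eq_bigr => p _; rewrite Im_realM mulrC. Qed.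

Lemma cexpectation_cquad n q : cexpectation P (cquad n q) =
  \sum_(p <- pairs n) (c (p.2%:Z - p.1%:Z))%:C * q p.
Proof.
rewrite /cexpectation.
have -> : (fun x => Re (cquad n q x)) = quad X n (fun p => Re (q p)).
  by apply/funext => x; exact: Re_cquad.
have -> : (fun x => Im (cquad n q x)) = quad X n (fun p => Im (q p)).
  by apply/funext => x; exact: Im_cquad.
rewrite -!/(mean P _) !(mean_quad X0 Xss X4).
apply/eqP; rewrite eq_complex Re_sum Im_sum; apply/andP; split; apply/eqP;
  by apply: eq_bigr => p _; rewrite ?Re_realM ?Im_realM mulrC.
Qed.

Lemma cvariance_cquad (S0 Sk : R) n q : l1_bounded c S0 ->
  l1_bounded (kappa (h := 4) X 0) Sk ->
  (cvariance P (cquad n q) <=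
   ((Sk + 2 * S0 ^+ 2) * \sum_(p <- pairs n) normc (q p) ^+ 2)%:E)%E.
Proof.
move=> cS0 kSk.
have var := quad_variance X0 Xss Xfs X4 n _ cS0 kSk.
have cE : cexpectation P (cquad n q) =
    mean P (quad X n (fun p => Re (q p))) +i* mean P (quad X n (fun p => Im (q p))).
  rewrite /cexpectation; congr (_ +i* _); congr mean; apply/funext => x.
    exact: Re_cquad.
  exact: Im_cquad.
pose f x := (quad X n (fun p => Re (q p)) x - mean P (quad X n (fun p => Re (q p)))) ^+ 2.
pose g x := (quad X n (fun p => Im (q p)) x - mean P (quad X n (fun p => Im (q p)))) ^+ 2.
have f1 : L1 P f.
  exact: (L2B (quadL2 X4 n (fun p => Re (q p))) (L2_cst P _)).2.
have g1 : L1 P g.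
  exact: (L2B (quadL2 X4 n (fun p => Im (q p))) (L2_cst P _)).2.
rewrite /cvariance (_ : (fun x => _) = (fun x => f x + g x)); last first.
  apply/funext => x; rewrite sqr_normc cE /f /g -Re_cquad -Im_cquad.
  by case: (cquad n q x).
rewrite mean_EFin; last exact: L1D.
rewrite lee_fin meanD//; apply: (le_trans (lerD (var _) (var _))).
rewrite -mulrDr -big_split /= (eq_bigr (fun p => normc (q p) ^+ 2))// => p _.
by rewrite sqr_normc.
Qed.

Lemma normc_cexpectation_cquad n q :
  normc (cexpectation P (cquad n q)) <=
  \sum_(p <- pairs n) `|c (p.2%:Z - p.1%:Z)| * normc (q p).
Proof.
rewrite cexpectation_cquad; apply: (le_trans (normc_sum _ _)).
by apply: ler_sum => p _; rewrite Normc.normcM normc_real.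
Qed.

Variables (m S0 SK K A Sk : R).
Hypotheses (K1 : 1 <= K) (m_gt0 : 0 < m) (cm : coercive c m).
Hypotheses (S0_gt0 : 0 < S0) (cS0 : l1_bounded c S0).
Hypotheses (SK_gt0 : 0 < SK).
Hypothesis cSK : l1_bounded (fun r => `|r%:~R| `^ K * c r) SK.
Hypotheses (A_gt0 : 0 < A).
Hypothesis aA : forall n, \sum_(1 <= l < n.+1) l%:R `^ K * `|ar_coef X l| <= A.
Hypothesis aYW : yule_walker c (ar_coef X).
Hypothesis kSk : l1_bounded (kappa (h := 4) X 0) Sk.

Definition periodogram_diff n w x : R[i] :=
  complete_periodogram_inf X n w x - complete_periodogram X n w x.

Definition diff_coef n w (p : nat * nat) : R[i] :=
  (n%:R^-1)%:C * (Derr X n w p.1 * cis (- p.2%:R * w)).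

Lemma periodogram_diffE n w : periodogram_diff n w = cquad n (diff_coef n w).
Proof.
apply/funext => x.
rewrite /periodogram_diff /complete_periodogram_inf /complete_periodogram.
rewrite /complete_DFT -mulrBl opprD addrACA subrr add0r.
rewrite (predictive_DFT_diff X0 Xss K1 m_gt0 cm S0_gt0 cS0 SK_gt0 cSK A_gt0 aA).
have -> : Num.conj (DFT X n w x) = ((Num.sqrt n%:R)^-1)%:C *
    \sum_(1 <= s < n.+1) (X s%:Z x)%:C * cis (- s%:R * w).
  rewrite /DFT conjcM conjc_real conjc_sum; congr (_ * _).
  by apply: eq_bigr => s _; rewrite conj_realcis mulNr.
rewrite mulrACA -rmorphM -invfM -expr2 sqr_sqrtr ?ler0n//.
rewrite mulr_suml mulr_sumr /cquad sum_pairs /=; apply: eq_bigr => t _.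
rewrite !mulr_sumr; apply: eq_bigr => s _.
rewrite /diff_coef /= rmorphM; ring.
Qed.

Let E2 : R := 4 * section_cst m S0 SK A.

Lemma normc_diff_coef n w p :
  normc (diff_coef n w p) = n%:R^-1 * normc (Derr X n w p.1).
Proof.
rewrite /diff_coef 2!Normc.normcM normc_real normc_cis mulr1.
by rewrite ger0_norm// invr_ge0 ler0n.
Qed.

Lemma Derr_mean_sq n w : (0 < n)%N ->
  n%:R^-1 * \sum_(1 <= t < n.+1) normc (Derr X n w t) ^+ 2 <=
  E2 * (n%:R `^ (- K)) ^+ 2.
Proof.
move=> n0; have nR : 0 < n%:R :> R by rewrite ltr0n.
have := Derr_l2 X0 Xss K1 m_gt0 cm S0_gt0 cS0 SK_gt0 cSK A_gt0 aA aYW w n0.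
rewrite -/E2 mulrCA => h; rewrite mulrC ler_pdivrMr// mulrC; exact: h.
Qed.

Lemma sum_diff_coef_sq n w : (0 < n)%N ->
  \sum_(p <- pairs n) normc (diff_coef n w p) ^+ 2 <=
  E2 * (n%:R `^ (- K)) ^+ 2.
Proof.
move=> n0; have nR : (n%:R : R) != 0 by rewrite pnatr_eq0 -lt0n.
apply: le_trans (Derr_mean_sq w n0); rewrite sum_pairs mulr_sumr.
apply: ler_sum => t _.
rewrite (eq_bigr (fun=> n%:R^-1 ^+ 2 * normc (Derr X n w t) ^+ 2)); last first.
  by move=> s _; rewrite normc_diff_coef exprMn.
rewrite sumr_const_nat subSS subn0 -[X in X <= _]mulr_natl.
set y := normc _ ^+ 2; rewrite (_ : n%:R * _ = n%:R^-1 * y)//; field.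
exact: nR.
Qed.

Lemma periodogram_diff_bias n w : (0 < n)%N ->
  normc (cexpectation P (periodogram_diff n w)) <= S0 * (E2 + 1) * n%:R `^ (- K).
Proof.
move=> n0; have nR : 0 < n%:R :> R by rewrite ltr0n.
rewrite periodogram_diffE; apply: (le_trans (normc_cexpectation_cquad _ _)).
(* the l^1 mean of D, at most its root mean square by Cauchy-Schwarz *)
pose M := n%:R^-1 * \sum_(1 <= t < n.+1) normc (Derr X n w t).
apply: (@le_trans _ _ (S0 * M)).
  rewrite sum_pairs /M mulrA mulr_sumr; apply: ler_sum => t _.
  rewrite (eq_bigr (fun s => `|c (s%:Z - t%:Z)| * (n%:R^-1 * normc (Derr X n w t)))).
    rewrite -mulr_suml -mulrA ler_wpM2r ?mulr_ge0 ?normc_ge0 ?invr_ge0//.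
    exact: l1_col.
  by move=> s _; rewrite normc_diff_coef.
rewrite -mulrA ler_pM2l//.
have E20 : 0 <= E2.
  apply: mulr_ge0 => //; apply: mulr_ge0; last exact: sqr_ge0.
  apply: mulr_ge0; first by rewrite invr_ge0 sqr_ge0.
  by apply: addr_ge0 => //; rewrite divr_ge0 ?sqr_ge0// mulr_ge0 ?sqr_ge0.
have M0 : 0 <= M.
  by rewrite mulr_ge0 ?invr_ge0// sumr_ge0// => t _; exact: normc_ge0.
have rate0 : 0 <= (E2 + 1) * n%:R `^ (- K) by rewrite mulr_ge0 ?powR_ge0// addr_ge0.
rewrite -(@ler_pXn2r _ 2)// ?nnegrE//.
(* (E2 + 1)^2 >= E2: this avoids a square root in the constant *)
apply: (@le_trans _ _ (E2 * (n%:R `^ (- K)) ^+ 2)); last first.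
  by rewrite exprMn ler_wpM2r ?sqr_ge0//; nra.
apply: le_trans (Derr_mean_sq w n0).
have := weighted_cauchy_schwarz (index_iota 1 n.+1) (fun=> 1)
  (fun t => normc (Derr X n w t)).
under eq_bigr do rewrite mul1r.
under [X in _ <= _ * X -> _]eq_bigr do rewrite normr1 mul1r.
rewrite normr1 sumr_const_nat subSS subn0 => h.
rewrite /M exprMn expr2 -mulrA ler_wpM2l ?invr_ge0//.
by rewrite mulrC ler_pdivrMr// mulrC.
Qed.

Lemma periodogram_diff_variance n w : (0 < n)%N ->
  (cvariance P (periodogram_diff n w) <=
   (((Sk + 2 * S0 ^+ 2) * E2) * n%:R `^ (- (2 * K)))%:E)%E.
Proof.
move=> n0; rewrite periodogram_diffE.
apply: (le_trans (cvariance_cquad _ _ cS0 kSk)); rewrite lee_fin.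
have C0 : 0 <= Sk + 2 * S0 ^+ 2.
  by rewrite addr_ge0 ?(ge0_bound kSk)// mulr_ge0 ?sqr_ge0.
rewrite -[leRHS]mulrA; apply: (ler_wpM2l C0).
apply: (le_trans (sum_diff_coef_sq w n0)).
have -> : - (2 * K) = - K * 2%:R by ring.
by rewrite powRrM powR_mulrn ?powR_ge0.
Qed.

End ErrorMoments.

Theorem theorem2p1 (R : realType) (d : measure_display) (T : measurableType d)
    (P : probability T R) (X : int -> {RV P >-> R}) (K : R) :
  mean_zero X -> 1 <= K -> assumptionA X K -> assumptionB X ->
  exists Delta0 : nat -> R -> T -> complex R,
    [/\ forall n w x, complete_periodogram_inf X n w x =
          complete_periodogram X n w x + Delta0 n w x,
        exists C : R, \forall n \near \oo,
          (ereal_sup (range (fun w : R =>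
             (Normc.normc (cexpectation P (Delta0 n w)))%:E))
           <= (C * n%:R `^ (- K))%:E)%E
      & exists C : R, \forall n \near \oo,
          (ereal_sup (range (fun w : R => cvariance P (Delta0 n w)))
           <= (C * n%:R `^ (- (2 * K)))%:E)%E].
Proof.
move=> X0 K1 [Xss _ fpos csum] [Xfs X4 ksum].
pose c := autocov X.
have [B cB] := summable_l1_bounded csum.
have B0 := ge0_bound cB.
pose SK := B + 1; have SK_gt0 : 0 < SK by rewrite ltr_wpDl.
have cSK : l1_bounded (fun r => `|r%:~R| `^ K * c r) SK.
  by apply: l1_bounded_le cB; rewrite lerDl.
pose S0 := `|c 0| + SK; have S0_gt0 : 0 < S0 by rewrite ltr_wpDl.
have cS0 : l1_bounded c S0 := l1_bounded_unweighted K1 cSK.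
have [m [m_gt0 cm]] :=
  coercive_spectrum (autocov_even X0 Xss) cS0 (l1_bounded_moment1 K1 cSK) fpos.
have [Sk kSk] := summable_l1_bounded (ksum 4%N 0 isT).
have [A [a [A_gt0 aA aYW]]] := yule_walker_exists K1 m_gt0 cm S0_gt0 cS0 SK_gt0 cSK.
have a1 n : \sum_(1 <= l < n.+1) `|a l| <= A.
  apply: le_trans (aA n); rewrite big_nat [leRHS]big_nat.
  apply: ler_sum => l /andP[l1 _]; rewrite ler_peMl//.
  by apply: le_trans (powR_nat_ge K1 l1); rewrite ler1n.
have ar : ar_representation X (ar_coef X).
  apply: (@xgetPex _ (fun=> 0) [set a | ar_representation X a]); exists a.
  exact: (ar_representation_exists X0 Xss a1 aYW).
have [arYW [B' arB]] := ar_representation_yule_walker X0 Xss ar.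
have arE l : (1 <= l)%N -> ar_coef X l = a l.
  apply: (yule_walker_uniq K1 m_gt0 cm S0_gt0 cS0 SK_gt0 cSK
    (B := Num.max A B')) => // n.
    by rewrite le_max arB orbT.
  by rewrite le_max a1.
have arA n : \sum_(1 <= l < n.+1) l%:R `^ K * `|ar_coef X l| <= A.
  apply: le_trans (aA n); rewrite big_nat [leRHS]big_nat.
  by apply: ler_sum => l /andP[l1 _]; rewrite arE.
exists (periodogram_diff X); split.
- by move=> n w x; rewrite /periodogram_diff addrC subrK.
- exists (S0 * (4 * section_cst m S0 SK A + 1)); near=> n.
  have n0 : (0 < n)%N by near: n; exact: nbhs_infty_gt.
  apply: ub_ereal_sup => _ [w _ <-]; rewrite lee_fin.
  exact: (periodogram_diff_bias X0 Xss X4 K1 m_gt0 cm S0_gt0 cS0 SK_gt0 cSK).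
- exists ((Sk + 2 * S0 ^+ 2) * (4 * section_cst m S0 SK A)); near=> n.
  have n0 : (0 < n)%N by near: n; exact: nbhs_infty_gt.
  apply: ub_ereal_sup => _ [w _ <-].
  exact: (periodogram_diff_variance X0 Xss Xfs X4 K1 m_gt0 cm S0_gt0 cS0
    SK_gt0 cSK A_gt0 arA arYW kSk).
Unshelve. all: by end_near. Qed.
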